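(* For any $\mu\in\Lambda$, the assignment $$\mathsf E_i(z)\mapsto E_i(z+s_i),\quad\mathsf F_i(z)\mapsto F_i(z+s_i),\quad\mathsf H_i(z)\mapsto K_i(z+s_i)\qquad(1\le i\le r),$$ with $s_i=\frac{i-1}2$ for $i<r$ and $s_r=\frac{r-2}2$, gives rise to an injective $\mathbb C$-algebra homomorphism $\iota_\mu\colon Y_{\bar\mu}(\mathfrak{so}_{2r})\hookrightarrow X_\mu(\mathfrak{so}_{2r})$. Furthermore, there is a tensor product decomposition of algebras $$X_\mu(\mathfrak{so}_{2r})\simeq Y_{\bar\mu}(\mathfrak{so}_{2r})\otimes_{\mathbb C}\mathbb C[\{C_r^{(k)}\}_{k\ge d_r+d_{r+1}+1}].$$
   Context: Let $r\ge3$. $\Lambda^\vee=\bigoplus_{j=1}^{r+1}\mathbb Z\epsilon_j^\vee$ with $(\epsilon_i^\vee,\epsilon_j^\vee)=\delta_{ij}$; $\Lambda=\bigoplus_{j=1}^{r+1}\mathbb Z\epsilon_j$ dual lattice. Simple roots of $\mathfrak{so}_{2r}$: $\alpha_i^\vee=\epsilon_i^\vee-\epsilon_{i+1}^\vee$ ($i<r$), $\alpha_r^\vee=\epsilon_{r-1}^\vee+\epsilon_r^\vee$; $a_{ij}=(\alpha_i^\vee,\alpha_j^\vee)$. $\hat\alpha_i^\vee=\epsilon_i^\vee-\epsilon_{i+1}^\vee$ ($i<r$), $\hat\alpha_r^\vee=\epsilon_{r-1}^\vee-\epsilon_{r+1}^\vee$. For $\mu\in\Lambda$, $\bar\mu$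 is the coweight of $\mathfrak{so}_{2r}$ with $\alpha_i^\vee(\bar\mu)=\hat\alpha_i^\vee(\mu)$; $d_j=\epsilon_j^\vee(\mu)$. **$X_\mu(\mathfrak{so}_{2r})$**: the associative $\mathbb C$-algebra generated by $E_i^{(k)},F_i^{(k)}$ ($1\le i\le r$, $k\ge1$), $D_i^{(k)}$ ($1\le i\le r+1$, $k\ge d_i+1$). $E_i(z)=\sum_{k\ge1}E_i^{(k)}z^{-k}$, $E_i^\circ(z)=\sum_{k\ge2}E_i^{(k)}z^{-k}$, similarly $F_i,F_i^\circ$; $D_i(z)=z^{-d_i}+\sum_{k>d_i}D_i^{(k)}z^{-k}$; $K_i=D_i^{-1}D_{i+1}$ ($i<r$), $K_r=D_{r-1}^{-1}D_{r+1}$; $\underline{K_i(z)}$ is the part of $K_i(z)$ with strictly negative powers of $z$. Defining relations: $[D_i(z),D_j(w)]=0$; $[E_i(z),F_j(w)]=-\delta_{ij}\frac{\underline{K_i(z)}-\underline{K_i(w)}}{z-w}$; $[D_i(z),E_j(w)]=c_{ij}\frac{D_i(z)(E_j(z)-E_j(w))}{z-w}$, $[D_i(z),F_j(w)]=-c_{ij}\frac{(F_j(z)-F_j(w))D_i(z)}{z-w}$ with $c_{ij}=(\epsilon_i^\vee,\alpha_j^\vee)$ for $i\le r$, $c_{r+1,r}=-1$, $c_{r+1,r-1}=1$, $c_{r+1,j}=0$ for $j<r-1$; $[E_i(z),E_i(w)]=-\frac{(E_i(z)-E_i(w))^2}{z-w}$, $[F_i(z),F_i(w)]=\frac{(F_i(z)-F_i(w))^2}{z-w}$;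 for $i<j$: $z[E_i^\circ(z),E_j(w)]-w[E_i(z),E_j^\circ(w)]=a_{ij}E_i(z)E_j(w)$, $z[F_i^\circ(z),F_j(w)]-w[F_i(z),F_j^\circ(w)]=-a_{ij}F_j(w)F_i(z)$; for $i\ne j$, $m=1-a_{ij}$: $\sum_{\sigma\in S_m}[E_i(z_{\sigma(1)}),[\cdots,[E_i(z_{\sigma(m)}),E_j(w)]\cdots]]=0$, and the same for $F$. **Central series**: $C_r(z)=z^{-d_r-d_{r+1}}+\sum_{k>d_r+d_{r+1}}C_r^{(k)}z^{-k}:=\prod_{i=1}^{r-1}\frac{D_i(z+i-r)}{D_i(z+i-r+1)}\cdot D_r(z)D_{r+1}(z)$; its coefficients are central in $X_\mu(\mathfrak{so}_{2r})$. In the decomposition, $Y_{\bar\mu}$ is embedded via $\iota_\mu$, and $\mathbb C[\{C_r^{(k)}\}]$ is the polynomial algebra on the $C_r^{(k)}$. **$Y_\nu(\mathfrak{so}_{2r})$** ($\nu$ a coweight, $b_i=\alpha_i^\vee(\nu)$): generated by $\mathsf E_i^{(k)},\mathsf F_i^{(k)}$ ($k\ge1$), $\mathsf H_i^{(k)}$ ($k>-b_i$), $1\le i\le r$, with $\mathsf H_i^{(-b_i)}=1$, $\mathsf H_i^{(k)}=0$ for $k<-b_i$, and relations ($\{a,b\}=ab+ba$): $[\mathsf H_i^{(k)},\mathsf H_j^{(\ell)}]=0$; $[\mathsf E_i^{(k)},\mathsf F_j^{(\ell)}]=\delta_{ij}\mathsf H_i^{(k+\ell-1)}$; $[\mathsf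 H_i^{(k+1)},\mathsf E_j^{(\ell)}]-[\mathsf H_i^{(k)},\mathsf E_j^{(\ell+1)}]=\frac{a_{ij}}2\{\mathsf H_i^{(k)},\mathsf E_j^{(\ell)}\}$ (all $k\in\mathbb Z$), the same for $\mathsf F_j$ with $-\frac{a_{ij}}2$; $[\mathsf E_i^{(k+1)},\mathsf E_j^{(\ell)}]-[\mathsf E_i^{(k)},\mathsf E_j^{(\ell+1)}]=\frac{a_{ij}}2\{\mathsf E_i^{(k)},\mathsf E_j^{(\ell)}\}$, the same for $\mathsf F$ with $-\frac{a_{ij}}2$; $\sum_{\sigma\in S_m}[\mathsf E_i^{(k_{\sigma(1)})},[\cdots,[\mathsf E_i^{(k_{\sigma(m)})},\mathsf E_j^{(\ell)}]\cdots]]=0$ for $i\ne j$, $m=1-a_{ij}$, and the same for $\mathsf F$. $\mathsf E_i(z)=\sum_{k\ge1}\mathsf E_i^{(k)}z^{-k}$, $\mathsf F_i(z)=\sum_{k\ge1}\mathsf F_i^{(k)}z^{-k}$, $\mathsf H_i(z)=\sum_{k\ge-b_i}\mathsf H_i^{(k)}z^{-k}$. *)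

(* Defs.v *)
From HB Require Import structures.
From mathcomp Require Import all_boot all_order all_algebra perm.
From mathcomp Require Import finmap.
From mathcomp Require Import boolp reals.
From mathcomp Require Import complex.
From mathcomp.multinomials Require Import monalg.

Set Implicit Arguments.
Unset Strict Implicit.
Unset Printing Implicit Defensive.

Import GRing.Theory.
Local Open Scope ring_scope.
Local Open Scope quotient_scope.

(* MathComp's [algType] requires 1 <> 0, which is not known a priori for an
   algebra given by generators and relations; [pzAlgType K] drops it.  The
   structure is given by the central ring morphism [inalg : K -> A]. *)
HB.mixin Record PzRing_isPzAlg (K : pzRingType) A of GRing.PzRing A := {
  inalg : K -> A;
  inalg_zmod_morphism : zmod_morphism inalg;
  inalg_monoid_morphism : monoid_morphism inalg;
  inalg_central : forall (c : K) (x : A), inalg c * x = x * inalg c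
}.

#[short(type="pzAlgType")]
HB.structure Definition PzAlg (K : pzRingType) :=
  {A of GRing.PzRing A & PzRing_isPzAlg K A}.

Definition ascale (K : pzRingType) (A : pzAlgType K) (c : K) (x : A) : A :=
  inalg c * x.
Notation "c *a x" := (ascale c x) (at level 40, left associativity).

Definition algebra_morphism (K : pzRingType) (A B : pzAlgType K) (f : A -> B) :=
  [/\ zmod_morphism f, monoid_morphism f & forall c x, f (c *a x) = c *a f x].

Section MonoidAlgebra.
Variables (M : monomType) (K : fieldType).

Fact malgC_central (c : K) (x : malg M K) : c%:MP * x = x * c%:MP.
Proof.
rewrite mul_malgC [RHS]fgmulgU [in LHS](monalgE x) scaler_sumr.
apply: eq_bigr => k _; rewrite mulm1; apply/malgP => l.
by rewrite mcoeffZ !mcoeffU mulrnAr mulrC.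
Qed.

HB.instance Definition _ := PzRing_isPzAlg.Build K (malg M K)
  (raddfB (@malgC M K)) (rmorphism_monoidP (@malgC M K)) malgC_central.
End MonoidAlgebra.

Section AlgebraQuotient.
Variables (K : pzRingType) (A : pzAlgType K) (rel : A -> A -> Prop).

Inductive ideal_gen : A -> Prop :=
| ideal_gen_rel x y of rel x y : ideal_gen (x - y)
| ideal_gen0 : ideal_gen 0
| ideal_genD x y of ideal_gen x & ideal_gen y : ideal_gen (x + y)
| ideal_genM a x b of ideal_gen x : ideal_gen (a * x * b).

Definition ideal_pred : {pred A} := fun x => `[< ideal_gen x >].

Fact ideal_zmod_closed : zmod_closed ideal_pred.
Proof.
split=> [|x y /asboolP Ix /asboolP Iy]; first exact/asboolP/ideal_gen0.
apply/asboolP/ideal_genD => //.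
by have := ideal_genM (- 1) 1 Iy; rewrite mulr1 mulN1r.
Qed.

HB.instance Definition _ := GRing.isZmodClosed.Build A ideal_pred
  ideal_zmod_closed.

Definition algquot := Quotient.quot ideal_pred.
HB.instance Definition _ := GRing.Zmodule.on algquot.
HB.instance Definition _ := EqQuotient.on algquot.

Local Notation Q := algquot.

Definition algproj (x : A) : algquot := \pi_Q x.

Fact algquot_eqP (x y : A) : \pi_Q x = \pi_Q y <-> ideal_gen (x - y).
Proof.
split=> [/eqP|I]; first by rewrite -Quotient.idealrBE => /asboolP.
by apply/eqP; rewrite -Quotient.idealrBE; apply/asboolP.
Qed.

Fact algquot_piD (x y : A) : \pi_Q (x + y) = \pi_Q x + \pi_Q y.
Proof. exact: Quotient.pi_add. Qed.

Definition algquot_one : Q := \pi_Q 1.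
Definition algquot_mul := lift_op2 Q *%R.
Definition algquot_inalg (c : K) : Q := \pi_Q (inalg c).

Fact algquot_repr (x : A) : ideal_gen (repr (\pi_Q x) - x).
Proof. by apply/algquot_eqP; rewrite reprK. Qed.

Fact algquot_piM (x y : A) : algquot_mul (\pi_Q x) (\pi_Q y) = \pi_Q (x * y).
Proof.
rewrite /algquot_mul; unlock; apply/algquot_eqP; set x' := repr _; set y' := repr _.
have -> : x' * y' - x * y = (1 * (x' - x) * y') + (x * (y' - y) * 1).
  by rewrite mul1r mulr1 mulrBl mulrBr addrA subrK.
apply: ideal_genD; apply: ideal_genM; first exact: (algquot_repr x).
exact: (algquot_repr y).
Qed.

Fact algquot_mulA : associative algquot_mul.
Proof.
by move=> x y z; rewrite -[x]reprK -[y]reprK -[z]reprK !algquot_piM mulrA.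
Qed.

Fact algquot_mul1 : left_id algquot_one algquot_mul.
Proof. by move=> x; rewrite -[x]reprK algquot_piM mul1r. Qed.

Fact algquot_mulr1 : right_id algquot_one algquot_mul.
Proof. by move=> x; rewrite -[x]reprK algquot_piM mulr1. Qed.

Fact algquot_mulDl : left_distributive algquot_mul +%R.
Proof.
move=> x y z; rewrite -[x]reprK -[y]reprK -[z]reprK.
by rewrite -algquot_piD !algquot_piM -algquot_piD mulrDl.
Qed.

Fact algquot_mulDr : right_distributive algquot_mul +%R.
Proof.
move=> x y z; rewrite -[x]reprK -[y]reprK -[z]reprK.
by rewrite -algquot_piD !algquot_piM -algquot_piD mulrDr.
Qed.

HB.instance Definition _ := GRing.Zmodule_isPzRing.Build algquot
  algquot_mulA algquot_mul1 algquot_mulr1 algquot_mulDl algquot_mulDr.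

Fact algquot_inalg_zmod : zmod_morphism algquot_inalg.
Proof.
move=> a b; apply: (addIr (algquot_inalg b)); rewrite subrK -algquot_piD.
by rewrite inalg_zmod_morphism subrK.
Qed.

Fact algquot_inalg_monoid : monoid_morphism algquot_inalg.
Proof.
have [inalg1 inalgM] : monoid_morphism (@inalg K A) := inalg_monoid_morphism.
split=> [|a b]; first by rewrite /algquot_inalg inalg1.
by rewrite [RHS]algquot_piM -inalgM.
Qed.

Fact algquot_inalg_central c (x : algquot) :
  algquot_inalg c * x = x * algquot_inalg c.
Proof.
by rewrite -[x]reprK [LHS]algquot_piM [RHS]algquot_piM inalg_central.
Qed.

HB.instance Definition _ := PzRing_isPzAlg.Build K algquot
  algquot_inalg_zmod algquot_inalg_monoid algquot_inalg_central.
End AlgebraQuotient.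
Arguments algproj {K A} rel x.

Section FreeAlgebra.
Variables (K : fieldType) (G : choiceType).
Definition free_alg := malg (fmonom G) K.
HB.instance Definition _ := PzAlg.on free_alg.
Definition free_gen (g : G) : free_alg := << fmu g >>.
End FreeAlgebra.
Arguments free_gen K {G} g.

Section Tensor.
Variables (K : fieldType) (A B : pzAlgType K).

(* A (x) B is generated by the symbols a (x) b; since products of symbols are
   symbols, it is their K-span modulo bilinearity, with the usual product. *)
Inductive tensor_rel (T : pzAlgType K) (t : A * B -> T) : T -> T -> Prop :=
| tensorDl a a' b : tensor_rel t (t (a + a', b)) (t (a, b) + t (a', b))
| tensorDr a b b' : tensor_rel t (t (a, b + b')) (t (a, b) + t (a, b'))
| tensorZl c a b : tensor_rel t (t (c *a a, b)) (c *a t (a, b))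
| tensorZr c a b : tensor_rel t (t (a, c *a b)) (c *a t (a, b))
| tensorM a a' b b' : tensor_rel t (t (a, b) * t (a', b')) (t (a * a', b * b'))
| tensor1 : tensor_rel t (t (1, 1)) 1.

Definition tensor := algquot (tensor_rel (@free_gen K (A * B)%type)).
HB.instance Definition _ := PzAlg.on tensor.
Definition tens (a : A) (b : B) : tensor :=
  algproj (tensor_rel (@free_gen K (A * B)%type)) (free_gen K (a, b)).
End Tensor.

Section LaurentSeries.
Variables (K : fieldType) (A : pzAlgType K).

(* [LSer v f] is the series \sum_n f_n z^(- v - n) in A((z^-1)); the
   representation is not unique, only [coef] is meaningful. *)
Record lser := LSer { lval : int; lcf : nat -> A }.

(* the coefficient of z^(- k) *)
Definition coef (f : lser) (k : int) : A :=
  if lval f <= k then lcf f `|k - lval f|%N else 0.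

Definition lone : lser := LSer 0 (fun n => (n == 0%N)%:R).

Definition lmul (f g : lser) : lser :=
  LSer (lval f + lval g) (fun n => \sum_(i < n.+1) lcf f i * lcf g (n - i)).

(* Coefficients 0, ..., n of the inverse, for [lcf f 0 = 1]: they solve
   \sum_(i <= n) f_(n - i) g_i = 0 for n > 0. *)
Fixpoint linv_seq (f : nat -> A) (n : nat) : seq A :=
  if n is n'.+1 then
    let g := linv_seq f n' in
    rcons g (- \sum_(i < n'.+1) f (n'.+1 - i)%N * g`_i)
  else [:: 1].

Definition linv (f : lser) : lser :=
  LSer (- lval f) (fun n => (linv_seq (lcf f) n)`_n).

Definition gbinom (x : int) (j : nat) : K :=
  (\prod_(i < j) (x%:~R - i%:R)) / j`!%:R.

(* f(z + s), expanded by
   (z + s)^(- k) = \sum_j gbinom (- k) j * s^j * z^(- k - j) *)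
Definition ltranslate (s : K) (f : lser) : lser :=
  LSer (lval f) (fun n => \sum_(j < n.+1)
    (gbinom (- (lval f + (n - j)%:Z)) j * s ^+ j) *a lcf f (n - j)).

(* the part of f with exponents of z at most - m *)
Definition ltail (m : nat) (f : lser) : lser :=
  LSer m%:Z (fun n => coef f (m + n)%:Z).

(* A series in z and w is given by its coefficients at z^(- k) w^(- l). *)
Definition ser2 := int -> int -> A.

Definition inz (f : lser) : ser2 := fun k l => if l == 0 then coef f k else 0.
Definition inw (f : lser) : ser2 := fun k l => if k == 0 then coef f l else 0.

(* f(z) g(w) and g(w) f(z) *)
Definition prod_zw (f g : lser) : ser2 := fun k l => coef f k * coef g l.
Definition prod_wz (f g : lser) : ser2 := fun k l => coef g l * coef f k.

Definition bracket (x y : A) : A := x * y - y * x.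

(* [f(z), g(w)] *)
Definition br2 (f g : lser) : ser2 := fun k l => bracket (coef f k) (coef g l).

Definition mulz (G : ser2) : ser2 := fun k l => G (k + 1) l.
Definition mulw (G : ser2) : ser2 := fun k l => G k (l + 1).
Definition mulzw (G : ser2) : ser2 := fun k l => mulz G k l - mulw G k l.

Definition serre (m : nat) (x : 'I_m -> A) (y : A) : A :=
  \sum_(s : 'S_m) foldr (fun t => bracket (x (s t))) y (enum 'I_m).

End LaurentSeries.

(* Indices are shifted to start from 0: [i : 'I_r] and [j : 'I_r.+1] stand for
   the indices i + 1 in 1..r and j + 1 in 1..r+1 of the usual numbering.  Both
   lattices are written in coordinates with respect to their dual bases
   epsilon^vee and epsilon, so that [dotp] is the form on Lambda^vee as well as
   the pairing of Lambda^vee with Lambda. *)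
Section RootData.
Variable r : nat.

Definition dotp (u v : 'rV[int]_r.+1) : int := \sum_j u 0 j * v 0 j.

Definition epsv (j : 'I_r.+1) : 'rV[int]_r.+1 := delta_mx 0 j.

Definition last_node (i : 'I_r) : bool := i == r.-1 :> nat.

Definition alphav (i : 'I_r) : 'rV[int]_r.+1 :=
  if last_node i then epsv (inord (r - 2)) + epsv (inord (r - 1))
  else epsv (inord i) - epsv (inord i.+1).

Definition cartan (i j : 'I_r) : int := dotp (alphav i) (alphav j).

Definition alphahat (i : 'I_r) : 'rV[int]_r.+1 :=
  if last_node i then epsv (inord (r - 2)) - epsv (inord r)
  else epsv (inord i) - epsv (inord i.+1).

Definition cmat (i : 'I_r.+1) (j : 'I_r) : int :=
  if i == ord_max then
    if last_node j then - 1 else if j == (r - 2)%N :> nat then 1 else 0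
  else dotp (epsv i) (alphav j).

(* A coweight of so_2r is given by its values on the simple roots. *)
Definition coweight := 'I_r -> int.

Definition mubar (mu : 'rV[int]_r.+1) : coweight := fun i => dotp (alphahat i) mu.

Definition dmu (mu : 'rV[int]_r.+1) (j : 'I_r.+1) : int := dotp (epsv j) mu.

Definition serre_deg (i j : 'I_r) : nat := `|1 - cartan i j|%N.

Definition node_shift (K : fieldType) (i : 'I_r) : K :=
  (if last_node i then (r - 2)%N else i)%:R / 2%:R.

End RootData.

(* [XE i n], [XF i n] are the generators with upper index n + 1, and [XD j n]
   the one with upper index d_j + 1 + n. *)
Variant xgen (r : nat) :=
  XE of 'I_r & nat | XF of 'I_r & nat | XD of 'I_r.+1 & nat.
HB.instance Definition _ (r : nat) := gen_eqMixin (xgen r).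
HB.instance Definition _ (r : nat) := gen_choiceMixin (xgen r).

Section X.
Variables (K : fieldType) (r : nat) (mu : 'rV[int]_r.+1).

Section Relations.
Variables (A : pzAlgType K) (g : xgen r -> A).

Definition Xe (i : 'I_r) : lser A := LSer 1 (fun n => g (XE i n)).
Definition Xf (i : 'I_r) : lser A := LSer 1 (fun n => g (XF i n)).
Definition Xd (j : 'I_r.+1) : lser A :=
  LSer (dmu mu j) (fun n => if n is n'.+1 then g (XD j n') else 1).

Definition Xk (i : 'I_r) : lser A :=
  if last_node i then lmul (linv (Xd (inord (r - 2)))) (Xd (inord r))
  else lmul (linv (Xd (inord i))) (Xd (inord i.+1)).

(* A relation G(z, w) = P(z, w) / (z - w) is imposed as
   (z - w) G(z, w) = P(z, w); this determines G because the exponents of z and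
   of w in G are bounded above. *)
Inductive Xrel : A -> A -> Prop :=
| Xrel_DD i j k l : Xrel (br2 (Xd i) (Xd j) k l) 0
| Xrel_EF i j k l :
    Xrel (mulzw (br2 (Xe i) (Xf j)) k l)
         (- ((inz (ltail 1 (Xk i)) k l - inw (ltail 1 (Xk i)) k l) *+ (i == j)))
| Xrel_DE i j k l :
    Xrel (mulzw (br2 (Xd i) (Xe j)) k l)
         ((inz (lmul (Xd i) (Xe j)) k l - prod_zw (Xd i) (Xe j) k l)
            *~ cmat i j)
| Xrel_DF i j k l :
    Xrel (mulzw (br2 (Xd i) (Xf j)) k l)
         (- ((inz (lmul (Xf j) (Xd i)) k l - prod_wz (Xd i) (Xf j) k l)
               *~ cmat i j))
| Xrel_EE i k l :
    Xrel (mulzw (br2 (Xe i) (Xe i)) k l)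
         (- (inz (lmul (Xe i) (Xe i)) k l - prod_zw (Xe i) (Xe i) k l
             - prod_wz (Xe i) (Xe i) k l + inw (lmul (Xe i) (Xe i)) k l))
| Xrel_FF i k l :
    Xrel (mulzw (br2 (Xf i) (Xf i)) k l)
         (inz (lmul (Xf i) (Xf i)) k l - prod_zw (Xf i) (Xf i) k l
          - prod_wz (Xf i) (Xf i) k l + inw (lmul (Xf i) (Xf i)) k l)
| Xrel_EEij (i j : 'I_r) k l of (i < j)%N :
    Xrel (mulz (br2 (ltail 2 (Xe i)) (Xe j)) k l
          - mulw (br2 (Xe i) (ltail 2 (Xe j))) k l)
         (prod_zw (Xe i) (Xe j) k l *~ cartan i j)
| Xrel_FFij (i j : 'I_r) k l of (i < j)%N :
    Xrel (mulz (br2 (ltail 2 (Xf i)) (Xf j)) k l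
          - mulw (br2 (Xf i) (ltail 2 (Xf j))) k l)
         (- (prod_wz (Xf i) (Xf j) k l *~ cartan i j))
| Xrel_serreE i j (k : 'I_(serre_deg i j) -> int) l of i != j :
    Xrel (serre (fun t => coef (Xe i) (k t)) (coef (Xe j) l)) 0
| Xrel_serreF i j (k : 'I_(serre_deg i j) -> int) l of i != j :
    Xrel (serre (fun t => coef (Xf i) (k t)) (coef (Xf j) l)) 0.

(* In the usual numbering of the D_i, the i-th factor below is
   D_(i+1)(z + (i+1) - r) / D_(i+1)(z + (i+1) - r + 1). *)
Definition Xc : lser A :=
  lmul (lmul
    (\big[@lmul K A/lone A]_(i < r.-1)
        lmul (ltranslate (i.+1%:R - r%:R) (Xd (inord i)))
             (linv (ltranslate (i.+1%:R - r%:R + 1) (Xd (inord i)))))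
    (Xd (inord (r - 1)))) (Xd (inord r)).

End Relations.

Definition Xalg := algquot (Xrel (@free_gen K (xgen r))).
HB.instance Definition _ := PzAlg.on Xalg.
Definition Xgen (x : xgen r) : Xalg :=
  algproj (Xrel (@free_gen K (xgen r))) (free_gen K x).

Definition XE_ := Xe Xgen.
Definition XF_ := Xf Xgen.
Definition XK_ := Xk Xgen.
Definition XC_ := Xc Xgen.

(* upper indices of the central generators C_r^(k) *)
Definition Cindex := {k : int | dmu mu (inord (r - 1)) + dmu mu (inord r) < k}.

Definition Cpoly := malg (cmonom Cindex) K.
HB.instance Definition _ := PzAlg.on Cpoly.
Definition Cvar (k : Cindex) : Cpoly := << ucm k >>.

End X.

(* [YE i n], [YF i n] are the generators with upper index n + 1, and [YH i n]
   the one with upper index - b_i + 1 + n. *)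
Variant ygen (r : nat) :=
  YE of 'I_r & nat | YF of 'I_r & nat | YH of 'I_r & nat.
HB.instance Definition _ (r : nat) := gen_eqMixin (ygen r).
HB.instance Definition _ (r : nat) := gen_choiceMixin (ygen r).

Section Y.
Variables (K : fieldType) (r : nat) (b : coweight r).

Section Relations.
Variables (A : pzAlgType K) (g : ygen r -> A).

Definition Ye (i : 'I_r) : lser A := LSer 1 (fun n => g (YE i n)).
Definition Yf (i : 'I_r) : lser A := LSer 1 (fun n => g (YF i n)).
Definition Yh (i : 'I_r) : lser A :=
  LSer (- b i) (fun n => if n is n'.+1 then g (YH i n') else 1).

Local Notation E i k := (coef (Ye i) k).
Local Notation F i k := (coef (Yf i) k).
Local Notation H i k := (coef (Yh i) k).
Local Notation acomm x y := (x * y + y * x).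
Local Notation half i j := ((cartan i j)%:~R / 2%:R : K).

Inductive Yrel : A -> A -> Prop :=
| Yrel_HH i j k l : Yrel (bracket (H i k) (H j l)) 0
| Yrel_EF i j (k l : int) of 1 <= k & 1 <= l :
    Yrel (bracket (E i k) (F j l)) (H i (k + l - 1) *+ (i == j))
| Yrel_HE i j (k l : int) of 1 <= l :
    Yrel (bracket (H i (k + 1)) (E j l) - bracket (H i k) (E j (l + 1)))
         (half i j *a acomm (H i k) (E j l))
| Yrel_HF i j (k l : int) of 1 <= l :
    Yrel (bracket (H i (k + 1)) (F j l) - bracket (H i k) (F j (l + 1)))
         (- half i j *a acomm (H i k) (F j l))
| Yrel_EE i j (k l : int) of 1 <= k & 1 <= l :
    Yrel (bracket (E i (k + 1)) (E j l) - bracket (E i k) (E j (l + 1)))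
         (half i j *a acomm (E i k) (E j l))
| Yrel_FF i j (k l : int) of 1 <= k & 1 <= l :
    Yrel (bracket (F i (k + 1)) (F j l) - bracket (F i k) (F j (l + 1)))
         (- half i j *a acomm (F i k) (F j l))
| Yrel_serreE i j (k : 'I_(serre_deg i j) -> int) (l : int)
    of i != j & (forall t, 1 <= k t) & 1 <= l :
    Yrel (serre (fun t => E i (k t)) (E j l)) 0
| Yrel_serreF i j (k : 'I_(serre_deg i j) -> int) (l : int)
    of i != j & (forall t, 1 <= k t) & 1 <= l :
    Yrel (serre (fun t => F i (k t)) (F j l)) 0.

End Relations.

Definition Yalg := algquot (Yrel (@free_gen K (ygen r))).
HB.instance Definition _ := PzAlg.on Yalg.
Definition Ygen (x : ygen r) : Yalg :=
  algproj (Yrel (@free_gen K (ygen r))) (free_gen K x).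

Definition YE_ := Ye Ygen.
Definition YF_ := Yf Ygen.
Definition YH_ := Yh Ygen.

End Y.

(* Main.v *)
From HB Require Import structures.
From mathcomp Require Import all_boot all_order all_algebra perm.
From mathcomp Require Import ring zify.
From mathcomp Require Import finmap boolp reals complex.
From mathcomp.multinomials Require Import monalg.
From Stdlib Require Ncring Ncring_tac.
Require Import Defs.

Set Implicit Arguments.
Unset Strict Implicit.
Unset Printing Implicit Defensive.

Import Order.TTheory GRing.Theory Num.Theory.
Local Open Scope ring_scope.

(** The algebra Y sits inside X because the series K_i = D_a^-1 D_b remember
    only the ratios of the series D_j.  What is lost is one overall series, and
    the central series C gives exactly that back.

    One device turns the relations into commutative algebra.  The coefficients
    e_0, e_1, e_2, ... of E_j(w) define the linear map [umbral e] on polynomials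
    that sends X^n to e_n, so that multiplying by X shifts the index.  The
    relation between D_i(z) and E_j(w) then says that D_i(z) carries
    [umbral e (P)] to [umbral e (phi P)], where phi is a quotient of two linear
    functions of z - X ([intertwines], [zratio]).  In this form the relation is
    multiplicative in the pair (D, phi), passes to inverses, and commutes with
    translations of z; translating E_j itself by s becomes the
    substitution X := X + s in phi ([intertwines_shift]).  Hence the relation of
    E_j with K_i or C is obtained by computing the same expression in the
    commuting phi's: K_i gives the relation of H_i in Y once the shifts s_i are
    inserted ([zratio_node]), and C gives phi = 1, that is, C is central
    ([Cseries_Efactor], [Cseries_central]).

    Conversely K and C determine the D_j.  If the K_i are kept and the D_j
    change by delta in the coefficient of order n, then the factors
    D_i(z + i - r) / D_i(z + i - r + 1) of C do not change at that order and C
    changes by 2 delta ([intertwines_upto_Cseries]).  As 2 is invertible, the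
    D_j can be solved for order by order ([D_exists]) in a unique way
    ([D_unique]).  The same count applied to the defect of an intertwining
    relation in place of a difference shows that a relation satisfied by all K_i
    and by C is satisfied by all D_j ([rigidity]); this recovers the relations
    of the D_j with the E_j, with the F_j and among themselves.

    The relations among the E_j are translated directly: a shift by s_j - s_i
    moves that multiple of the commutator from one side to the other
    ([current_shift]), and turns the one-sided relations of X into the symmetric
    ones of Y.  For a_ij = 0 the shifts are not matched, but then the Serre
    relation says that E_i and E_j commute.

    So the translated generators of X satisfy the relations of Y ([Y_of_X]), and
    the tensor product of Y with the polynomial algebra contains elements that
    satisfy the relations of X ([X_of_Y]).  The universal properties of the
    presentations give morphisms phi and psi between X and the tensor product;
    that they are mutually inverse is checked on generators, where [D_unique]
    handles the D_j.  Finally iota is phi after y |-> y (x) 1, and the latter has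
    a retraction, the morphism killing all C^(k); so iota is injective. *)

(** * Series with coefficients in a ring *)

(** These two instances make the normalization tactic of noncommutative
    polynomial identities available in every [pzRingType]. *)
#[global] Instance ncring_ops (A : pzRingType) :
  @Ncring.Ring_ops A 0 1 +%R *%R (fun x y => x - y) -%R eq := {}.
#[global] Instance ncring_laws (A : pzRingType) :
  @Ncring.Ring A 0 1 +%R *%R (fun x y => x - y) -%R eq (ncring_ops A).
Proof.
constructor.
- exact: RelationClasses.eq_equivalence.
- by move=> x _ <- y _ <-.
- by move=> x _ <- y _ <-.
- by move=> x _ <- y _ <-.
- by move=> x _ <-.
- exact: add0r.
- exact: addrC.
- exact: addrA.
- exact: mul1r.
- exact: mulr1.
- exact: mulrA.
- exact: mulrDl.
- by move=> x y z; exact: mulrDr.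
- by [].
- exact: addrN.
Qed.

Ltac ncring := Ncring_tac.non_commutative_ring.

HB.instance Definition _ (K : pzRingType) (A : pzAlgType K) :=
  GRing.isZmodMorphism.Build K A (@inalg K A) inalg_zmod_morphism.
HB.instance Definition _ (K : pzRingType) (A : pzAlgType K) :=
  GRing.isMonoidMorphism.Build K A (@inalg K A) inalg_monoid_morphism.

(** Both sides sum over the pairs (p, q) with p + q < N; the right-hand side
    groups them by m = p + q. *)
Lemma sum_triangle (V : nmodType) N (F : nat -> nat -> V) :
  \sum_(p < N) \sum_(q < N - p) F p q =
  \sum_(m < N) \sum_(p < m.+1) F p (m - p)%N.
Proof.
elim: N => [|N IH]; first by rewrite !big_ord0.
rewrite [RHS]big_ord_recr /= -IH.
under eq_bigr => p _ do rewrite (subSn (leq_ord p)) big_ord_recr /=.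
rewrite big_split /=; congr (_ + _).
by rewrite big_ord_recr /= subnn big_ord0 addr0.
Qed.

Lemma sum_triangleC (V : nmodType) N (F : nat -> nat -> V) :
  \sum_(p < N) \sum_(q < N - p) F p q = \sum_(q < N) \sum_(p < N - q) F p q.
Proof.
rewrite sum_triangle (sum_triangle _ (fun q p => F p q)).
apply: eq_bigr => m _; rewrite (reindex_inj rev_ord_inj) /=.
by apply: eq_bigr => p _; rewrite subSS subKn // leq_ord.
Qed.

(** The series with coefficients f_n at t^n, where t = z^-1.  The name only
    serves to carry the convolution product. *)
Definition series (A : Type) := nat -> A.

Section SeriesZmod.
Variable A : pzRingType.
Implicit Types f g h : series A.
HB.instance Definition _ := gen_eqMixin (series A).
HB.instance Definition _ := gen_choiceMixin (series A).

Definition sadd f g : series A := fun n => f n + g n.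
Definition sopp f : series A := fun n => - f n.
Definition szero : series A := fun=> 0.
Definition smul f g : series A := fun n => \sum_(i < n.+1) f i * g (n - i)%N.
Definition sone : series A := fun n => (n == 0%N)%:R.

Fact saddA : associative sadd.
Proof. by move=> f g h; apply/funext => n; exact: addrA. Qed.
Fact saddC : commutative sadd.
Proof. by move=> f g; apply/funext => n; exact: addrC. Qed.
Fact sadd0 : left_id szero sadd.
Proof. by move=> f; apply/funext => n; exact: add0r. Qed.
Fact saddN : left_inverse szero sopp sadd.
Proof. by move=> f; apply/funext => n; exact: addNr. Qed.
HB.instance Definition _ := GRing.isZmodule.Build (series A)
  saddA saddC sadd0 saddN.

Fact smulA : associative smul.
Proof.
move=> f g h; apply/funext => n; rewrite /smul.
under [RHS]eq_bigr => i _ do rewrite mulr_suml.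
transitivity (\sum_(m < n.+1) \sum_(p < m.+1)
    f p * g (m - p)%N * h (n - (p + (m - p)))%N); last first.
  by apply: eq_bigr => i _; apply: eq_bigr => j _; rewrite subnKC ?leq_ord.
rewrite -(sum_triangle _ (fun j k => f j * g k * h (n - (j + k))%N)).
apply: eq_bigr => i _; rewrite mulr_sumr (subSn (leq_ord i)).
by apply: eq_bigr => j _; rewrite mulrA subnDA.
Qed.
Fact smul1l : left_id sone smul.
Proof.
move=> f; apply/funext => n; rewrite /smul big_ord_recl mul1r subn0 big1 ?addr0 //.
by move=> i _; rewrite mul0r.
Qed.
Fact smul1r : right_id sone smul.
Proof.
move=> f; apply/funext => n; rewrite /smul big_ord_recr /= subnn mulr1 big1 ?add0r //.
by move=> i _; rewrite /sone subn_eq0 leqNgt ltn_ord mulr0.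
Qed.
Fact smulDl : left_distributive smul sadd.
Proof.
move=> f g h; apply/funext => n; rewrite /smul /sadd -big_split.
by apply: eq_bigr => i _; rewrite mulrDl.
Qed.
Fact smulDr : right_distributive smul sadd.
Proof.
move=> f g h; apply/funext => n; rewrite /smul /sadd -big_split.
by apply: eq_bigr => i _; rewrite mulrDr.
Qed.
HB.instance Definition _ := GRing.Zmodule_isPzRing.Build (series A)
  smulA smul1l smul1r smulDl smulDr.

Lemma sadE f g n : (f + g) n = f n + g n. Proof. by []. Qed.
Lemma sopE f n : (- f) n = - f n. Proof. by []. Qed.
Lemma ssbE f g n : (f - g) n = f n - g n. Proof. by []. Qed.
Lemma s0E n : (0 : series A) n = 0. Proof. by []. Qed.
Lemma s1E n : (1 : series A) n = (n == 0%N)%:R. Proof. by []. Qed.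
Lemma smE f g n : (f * g) n = \sum_(i < n.+1) f i * g (n - i)%N.
Proof. by []. Qed.
Lemma smE0 f g : (f * g) 0%N = f 0%N * g 0%N.
Proof. by rewrite smE big_ord1. Qed.
Lemma smErev f g n : (f * g) n = \sum_(i < n.+1) f (n - i)%N * g i.
Proof.
rewrite smE (reindex_inj rev_ord_inj) /=; apply: eq_bigr => i _.
by rewrite subSS subKn // leq_ord.
Qed.

(** Series starting with 1: all the D_j, K_i and C are of this form after
    division by their leading power of z. *)
Definition unipotent f := f 0%N = 1.

Lemma unipotent_mul f g : unipotent f -> unipotent g -> unipotent (f * g).
Proof. by rewrite /unipotent smE0 => -> ->; rewrite mulr1. Qed.

Lemma unipotent1 : unipotent 1. Proof. by []. Qed.

Lemma unipotent_prod I (r : seq I) (F : I -> series A) :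
  (forall i, unipotent (F i)) -> unipotent (\prod_(i <- r) F i).
Proof. by move=> uF; elim/big_ind: _; [exact: unipotent1 | exact: unipotent_mul |]. Qed.
End SeriesZmod.

Section SeriesInv.
Variables (K : fieldType) (A : pzAlgType K).
Implicit Types f g h : series A.
Definition sinv f : series A := fun n => (linv_seq f n)`_n.

Lemma size_linv_seq f n : size (linv_seq f n) = n.+1.
Proof. by elim: n => //= n IH; rewrite size_rcons IH. Qed.

Lemma nth_linv_seq f n i : (i <= n)%N -> (linv_seq f n)`_i = sinv f i.
Proof.
elim: n i => [|n IH] i; first by rewrite leqn0 => /eqP ->.
rewrite leq_eqVlt => /orP[/eqP -> //|lin].
by rewrite /= nth_rcons size_linv_seq lin IH.
Qed.

Lemma sinvS f n :
  sinv f n.+1 = - \sum_(i < n.+1) f (n.+1 - i)%N * sinv f i.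
Proof.
rewrite /sinv /= nth_rcons size_linv_seq ltnn eqxx; congr (- _).
by apply: eq_bigr => i _; rewrite nth_linv_seq // -ltnS.
Qed.

Lemma sinv0 f : sinv f 0%N = 1. Proof. by []. Qed.

Lemma unipotent_sinv f : unipotent (sinv f). Proof. by []. Qed.

Lemma mulsV f : unipotent f -> f * sinv f = 1.
Proof.
move=> uf; apply/funext => -[|n]; first by rewrite smE0 uf mul1r.
rewrite smErev big_ord_recr /= subnn uf mul1r sinvS.
by rewrite addrN.
Qed.

(** A right inverse again has a right inverse, so it is two-sided. *)
Lemma mulVs f : unipotent f -> sinv f * f = 1.
Proof.
move=> uf; have fE : f = sinv (sinv f).
  by rewrite -[LHS]mulr1 -(mulsV (unipotent_sinv f)) mulrA mulsV // mul1r.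
by rewrite [X in _ * X]fE; exact: mulsV.
Qed.
End SeriesInv.

Section SeriesCom.
Variable A : comPzRingType.
Fact smulC : @commutative (series A) _ *%R.
Proof.
move=> f g; apply/funext => n; rewrite smE smErev.
by apply: eq_bigr => i _; rewrite mulrC.
Qed.
HB.instance Definition _ := GRing.PzRing_hasCommutativeMul.Build (series A) smulC.
End SeriesCom.

(** * Translation of the variable *)

Section Gbinom.
Variables (K : fieldType) (char0 : forall n, n.+1%:R != 0 :> K).
Implicit Types (x y : int).
Local Notation g := (gbinom K).

Lemma gbinom0 x : g x 0 = 1.
Proof. by rewrite /gbinom big_ord0 fact0 divr1. Qed.

Lemma gbinomS x j : g x j.+1 * j.+1%:R = g x j * (x%:~R - j%:R).
Proof.
have fne n : n`!%:R != 0 :> K by rewrite -(prednK (fact_gt0 n)).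
rewrite /gbinom big_ord_recr /= factS natrM invfM.
by rewrite !mulrA [LHS]mulrAC mulfVK // mulrAC.
Qed.

(** Multiplying the term of index p by j + 1 = p + (j + 1 - p) lets the
    recurrence [gbinomS] act on one factor at a time, which gives the recurrence
    of the left-hand side. *)
Lemma gbinom_vandermonde x y j :
  g (x + y) j = \sum_(p < j.+1) g x p * g y (j - p).
Proof.
elim: j => [|j IH]; first by rewrite big_ord1 !gbinom0 mulr1.
apply: (mulIf (char0 j)); rewrite gbinomS IH !mulr_suml.
transitivity (\sum_(p < j.+2) (g x p * p%:R * g y (j.+1 - p)
    + g x p * (g y (j.+1 - p) * (j.+1 - p)%:R))); last first.
  apply: eq_bigr => p _.
  have -> : j.+1%:R = p%:R + (j.+1 - p)%:R :> K by rewrite -natrD subnKC // leq_ord.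
  by ring.
rewrite big_split [in RHS]big_ord_recl /= mulr0 mul0r add0r.
rewrite [X in _ = _ + X]big_ord_recr /= subnn !mulr0 addr0 -big_split /=.
apply: eq_bigr => p _.
rewrite gbinomS subSS (subSn (leq_ord p)) gbinomS natrB ?leq_ord // rmorphD.
by ring.
Qed.

Lemma gbinom_mulB x i j : g x i * g (x - i%:Z) j = g x (i + j) * 'C(i + j, i)%:R.
Proof.
have fne n : n`!%:R != 0 :> K by rewrite -(prednK (fact_gt0 n)).
have bE : 'C(i + j, i)%:R = (i + j)`!%:R / (i`!%:R * j`!%:R) :> K.
  apply: (mulIf (mulf_neq0 (fne i) (fne j))); rewrite mulfVK ?mulf_neq0 //.
  by rewrite -!natrM -[in RHS](bin_fact (leq_addr j i)) addKn.
rewrite {}bE /gbinom big_split_ord /=.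
have -> : \prod_(k < j) ((x - i%:Z)%:~R - k%:R) =
          \prod_(k < j) (x%:~R - (i + k)%:R) :> K.
  by apply: eq_bigr => k _; rewrite rmorphB natrD opprD addrA.
by field; rewrite !fne.
Qed.
End Gbinom.

Section Translate.
Variables (K : fieldType) (char0 : forall n, n.+1%:R != 0 :> K).
Variable A : pzAlgType K.
Implicit Types (f g : series A) (s t : K) (v w : int).

(** The coefficients of f(z + s) when f stands for z^(- v) \sum_n f_n z^(- n);
    the result depends on v through the expansion of (z + s)^(- v - n). *)
Definition translate s v f : series A := fun n =>
  \sum_(j < n.+1) (gbinom K (- (v + (n - j)%:Z)) j * s ^+ j) *a f (n - j)%N.

Lemma ltranslateE s f v : ltranslate s (LSer v f) = LSer v (translate s v f).
Proof. by []. Qed.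

Lemma translate_coef0 s v f : translate s v f 0%N = f 0%N.
Proof. by rewrite /translate big_ord1 gbinom0 mulr1 /ascale rmorph1 mul1r. Qed.

Lemma unipotent_tr s v f : unipotent f -> unipotent (translate s v f).
Proof. by rewrite /unipotent translate_coef0. Qed.

Lemma translate0 v f : translate 0 v f = f.
Proof.
apply/funext => n; rewrite /translate big_ord_recl /= subn0 gbinom0 mul1r expr0.
rewrite /ascale rmorph1 mul1r big1 ?addr0 // => i _.
by rewrite expr0n /= mulr0 rmorph0 mul0r.
Qed.

Lemma translateB s v f g : translate s v (f - g) = translate s v f - translate s v g.
Proof.
apply/funext => n; rewrite ssbE /translate -sumrB; apply: eq_bigr => j _.
by rewrite /ascale ssbE mulrBr.
Qed.

(** The coefficient of f_(n - m) is \sum_j binom(m, j) s^j t^(m - j) times one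
    generalized binomial, by [gbinom_mulB]. *)
Lemma translate_comp s t v f :
  translate s v (translate t v f) = translate (s + t) v f.
Proof.
apply/funext => n.
pose F j i := inalg (gbinom K (- (v + (n - j)%:Z)) j * s ^+ j *
  (gbinom K (- (v + (n - (j + i))%:Z)) i * t ^+ i)) * f (n - (j + i))%N.
transitivity (\sum_(j < n.+1) \sum_(i < n.+1 - j) F j i).
  apply: eq_bigr => j _; rewrite /ascale /translate mulr_sumr (subSn (leq_ord j)).
  by apply: eq_bigr => i _; rewrite /F /ascale -!subnDA !rmorphM !mulrA.
rewrite sum_triangle; apply: eq_bigr => m _.
rewrite /ascale (addrC s) exprDn mulr_sumr rmorph_sum mulr_suml.
apply: eq_bigr => j _; rewrite /F subnKC ?leq_ord //; congr (inalg _ * _).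
have jm : (j <= m)%N by rewrite leq_ord.
have mn : (m <= n)%N by rewrite leq_ord.
have -> : - (v + (n - j)%:Z) = - (v + (n - m)%:Z) - (m - j)%:Z.
  by rewrite -opprD -addrA -PoszD addnBA // subnK.
rewrite mulrACA [X in X * _]mulrC gbinom_mulB // subnK // bin_sub //.
by rewrite [in RHS]mulrnAr -[RHS]mulr_natr; ring.
Qed.

(** Comparing the coefficients of f_a g_b, this is the Vandermonde identity for
    the exponents - v - a and - w - b. *)
Lemma translateM s v w f g :
  translate s (v + w) (f * g) = translate s v f * translate s w g.
Proof.
apply/funext => n.
pose G p a q := inalg (gbinom K (- (v + a%:Z)) p
   * gbinom K (- (w + (n - (p + q) - a)%N%:Z)) q * s ^+ (p + q)) *
   (f a * g (n - (p + q) - a)%N).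
transitivity (\sum_(p < n.+1) \sum_(q < n.+1 - p) \sum_(a < n.+1 - (p + q)) G p a q).
  rewrite (sum_triangle _ (fun p q => \sum_(a < n.+1 - (p + q)) G p a q)).
  apply: eq_bigr => m _; rewrite /ascale smE mulr_sumr.
  under [RHS]eq_bigr => p _ do rewrite subnKC ?leq_ord // (subSn (leq_ord m)).
  rewrite exchange_big; apply: eq_bigr => a _ /=.
  rewrite /G; under eq_bigr => p _ do rewrite subnKC ?leq_ord //.
  rewrite -mulr_suml; congr (_ * _); rewrite -rmorph_sum -mulr_suml.
  rewrite -(gbinom_vandermonde char0); congr (inalg (gbinom K _ _ * _)).
  by rewrite -opprD addrACA -PoszD subnKC // leq_ord.
pose H p a q := inalg (gbinom K (- (v + a%:Z)) p * s ^+ p) * f a *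
  (inalg (gbinom K (- (w + (n - (p + a) - q)%N%:Z)) q * s ^+ q) *
   g (n - (p + a) - q)%N).
transitivity (\sum_(p < n.+1) \sum_(a < n.+1 - p) \sum_(q < n.+1 - (p + a)) H p a q).
  apply: eq_bigr => p _.
  under eq_bigr => q _ do rewrite subnDA.
  rewrite (sum_triangleC _ (fun q a => G p a q)).
  apply: eq_bigr => a _; rewrite subnDA; apply: eq_bigr => q _.
  have e (x y z : nat) : (n - (x + y) - z = n - (x + z) - y)%N.
    by rewrite -!subnDA addnAC.
  rewrite /G /H (e p q a) exprD -[RHS]mulrA [X in _ = _ * X]mulrA -[in RHS](inalg_central _ (f a)).
  move: (gbinom K _ p) (gbinom K _ q) => b c; rewrite !mulrA -!rmorphM.
  by congr (inalg _ * _ * _); ring.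
rewrite (sum_triangle _ (fun p a => \sum_(q < n.+1 - (p + a)) H p a q)).
rewrite smE; apply: eq_bigr => m _; rewrite /translate mulr_suml.
apply: eq_bigr => p _; rewrite subnKC ?leq_ord // (subSn (leq_ord m)) mulr_sumr.
by apply: eq_bigr => q _; rewrite /H subnKC ?leq_ord.
Qed.

Lemma translate_val0_1 s : translate s 0 1 = 1.
Proof.
apply/funext => n; rewrite /translate big_ord_recr /= subnn add0r oppr0 big1 ?add0r.
  case: n => [|n]; first by rewrite gbinom0 mulr1 /ascale rmorph1 mul1r.
  by rewrite /gbinom big_ord_recl subrr mul0r mul0r mul0r /ascale rmorph0 mul0r.
by move=> i _; rewrite /ascale s1E subn_eq0 leqNgt ltn_ord mulr0.
Qed.
End Translate.

Lemma sub_lift_lt m n (i : 'I_m) : (m <= n)%N -> (m - lift ord0 i < n)%N.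
Proof. by apply: leq_trans; rewrite ltn_subrL /= (leq_trans _ (ltn_ord i)). Qed.

Section SeriesMore.
Variables (K : fieldType) (char0 : forall n, n.+1%:R != 0 :> K).
Variable A : pzAlgType K.
Implicit Types (f g : series A).

Lemma sinv_uniq f g : unipotent f -> f * g = 1 -> g = sinv f.
Proof. by move=> uf fg; rewrite -[LHS]mul1r -(mulVs uf) -mulrA fg mulr1. Qed.

Lemma sinv1 : sinv (1 : series A) = 1.
Proof. by rewrite -(@sinv_uniq 1 1) ?mulr1. Qed.

Lemma sinvM f g : unipotent f -> unipotent g -> sinv (f * g) = sinv g * sinv f.
Proof.
move=> uf ug; apply/esym/sinv_uniq; first exact: unipotent_mul.
by rewrite mulrA -(mulrA f) mulsV // mulr1 mulsV.
Qed.

Lemma translate_inv (s : K) v f : unipotent f ->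
  translate s (- v) (sinv f) = sinv (translate s v f).
Proof.
move=> uf; apply: sinv_uniq; first exact: unipotent_tr.
by rewrite -translateM // subrr mulsV // translate_val0_1.
Qed.

(** G = d t^n + O(t^(n+1)), where d may vanish. *)
Definition leading n (G : series A) (d : A) :=
  forall m, (m <= n)%N -> G m = if m == n then d else 0.

Lemma leading_mull n D G d : unipotent D -> leading n G d -> leading n (D * G) d.
Proof.
move=> uD lG m mn; rewrite smE big_ord_recl subn0 uD mul1r lG //.
rewrite big1 ?addr0 // => i _; rewrite lG; last exact: leq_trans (leq_subr _ _) mn.
by rewrite (ltn_eqF (sub_lift_lt i mn)) mulr0.
Qed.

Lemma leading_mulr n D G d : unipotent D -> leading n G d -> leading n (G * D) d.
Proof.
move=> uD lG m mn; rewrite smErev big_ord_recl subn0 uD mulr1 lG //.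
rewrite big1 ?addr0 // => i _; rewrite lG; last exact: leq_trans (leq_subr _ _) mn.
by rewrite (ltn_eqF (sub_lift_lt i mn)) mul0r.
Qed.

Lemma leadingD n G H d d' : leading n G d -> leading n H d' -> leading n (G + H) (d + d').
Proof. by move=> lG lH m mn; rewrite sadE lG // lH //; case: eqP; rewrite ?addr0. Qed.

Lemma leadingN n G d : leading n G d -> leading n (- G) (- d).
Proof. by move=> lG m mn; rewrite sopE lG //; case: eqP; rewrite ?oppr0. Qed.

(** f(z + s) and f(z) have the same leading term. *)
Lemma leading_tr n s v G d : leading n G d -> leading n (translate s v G) d.
Proof.
move=> lG m mn; rewrite /translate big_ord_recl subn0 gbinom0 mulr1.
rewrite /ascale rmorph1 mul1r lG //.
rewrite big1 ?addr0 // => i _; rewrite lG; last exact: leq_trans (leq_subr _ _) mn.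
by rewrite (ltn_eqF (sub_lift_lt i mn)) mulr0.
Qed.

Lemma leading_inj n G d d' : leading n G d -> leading n G d' -> d = d'.
Proof. by move=> /(_ n (leqnn n)) + /(_ n (leqnn n)); rewrite eqxx => -> . Qed.

Lemma leading0P G : (forall n, leading n G 0) -> G = 0.
Proof. by move=> lG; apply/funext => n; rewrite (lG n n (leqnn n)) eqxx. Qed.
End SeriesMore.

(** * Umbral evaluation *)

Fact polyC_central (K : fieldType) (c : K) (p : {poly K}) : c%:P * p = p * c%:P.
Proof. exact: mulrC. Qed.

HB.instance Definition _ (K : fieldType) := PzRing_isPzAlg.Build K {poly K}
  (raddfB (@polyC K)) (rmorphism_monoidP (@polyC K)) (@polyC_central K).

Section Ev.
Variables (K : fieldType) (char0 : forall n, n.+1%:R != 0 :> K).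
Variable A : pzAlgType K.
Implicit Types (e : nat -> A) (p q : {poly K}).

(** The linear map sending X^n to e_n.  Applied to the coefficients of a current
    E(w), it identifies E(w) with the image of 1 / (w - X). *)
Definition umbral e p : A := \sum_(i < size p) inalg p`_i * e i.

Lemma umbralw e p n : (size p <= n)%N -> umbral e p = \sum_(i < n) inalg p`_i * e i.
Proof.
move=> pn; have /= E := big_ord_widen n (fun i => inalg p`_i * e i) pn.
rewrite /umbral E big_mkcond.
apply: eq_bigr => i _; case: ltnP => // sp.
by rewrite nth_default // rmorph0 mul0r.
Qed.

Fact umbral_is_zmod e : zmod_morphism (umbral e).
Proof.
move=> p q; pose n := maxn (size p) (size q).
rewrite (@umbralw e p n) ?leq_maxl // (@umbralw e q n) ?leq_maxr // (@umbralw e (p - q) n).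
  by rewrite -sumrB; apply: eq_bigr => i _; rewrite coefB rmorphB mulrBl.
by rewrite (leq_trans (size_polyD _ _)) // size_polyN.
Qed.
HB.instance Definition _ e := GRing.isZmodMorphism.Build {poly K} A (umbral e)
  (umbral_is_zmod e).

Lemma umbralC e c p : umbral e (c%:P * p) = inalg c * umbral e p.
Proof.
rewrite (@umbralw e (c%:P * p) (size p)); last first.
  by rewrite mul_polyC; apply: size_scale_leq.
by rewrite mulr_sumr; apply: eq_bigr => i _; rewrite coefCM rmorphM mulrA.
Qed.

Lemma umbralXn e n : umbral e 'X^n = e n.
Proof.
rewrite /umbral size_polyXn big_ord_recr /= coefXn eqxx rmorph1 mul1r.
rewrite big1 ?add0r // => i _.
by rewrite coefXn (ltn_eqF (ltn_ord i)) rmorph0 mul0r.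
Qed.

Definition poly_linear (F : {poly K} -> A) :=
  zmod_morphism F /\ forall c p, F (c%:P * p) = inalg c * F p.

Lemma umbral_linear e : poly_linear (umbral e).
Proof. by split; [exact: umbral_is_zmod | exact: umbralC]. Qed.

Lemma poly_linear_umbral F : poly_linear F ->
  forall p, F p = umbral (fun n => F 'X^n) p.
Proof.
move=> [Fz FC] p.
pose Fa : {additive {poly K} -> A} := HB.pack F (GRing.isZmodMorphism.Build _ _ F Fz).
rewrite /umbral -[F]/(Fa : _ -> _) -{1}[p]coefK poly_def raddf_sum.
by apply: eq_bigr => i _; rewrite -mul_polyC [LHS]FC.
Qed.
End Ev.

Section PLinear.
Variables (K : fieldType) (A : pzAlgType K).
Implicit Types (F G : {poly K} -> A).

(** Relations between generators are given on the monomials X^n; this extends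
    them to all polynomials, hence to translated generators. *)
Lemma poly_linear_ext F G : poly_linear F -> poly_linear G ->
  (forall n, F 'X^n = G 'X^n) -> F =1 G.
Proof.
move=> lF lG FG p; rewrite (poly_linear_umbral lF) (poly_linear_umbral lG).
by congr (umbral _ p); apply/funext.
Qed.

Lemma poly_linearB F G : poly_linear F -> poly_linear G -> poly_linear (fun p => F p - G p).
Proof.
move=> [Fz FC] [Gz GC]; split=> [p q|c p]; first by rewrite Fz Gz; ncring.
by rewrite FC GC mulrBr.
Qed.

Lemma poly_linearD F G : poly_linear F -> poly_linear G -> poly_linear (fun p => F p + G p).
Proof.
move=> [Fz FC] [Gz GC]; split=> [p q|c p]; first by rewrite Fz Gz; ncring.
by rewrite FC GC mulrDr.
Qed.

Lemma poly_linearMl x F : poly_linear F -> poly_linear (fun p => x * F p).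
Proof.
move=> [Fz FC]; split=> [p q|c p]; first by rewrite Fz mulrBr.
by rewrite FC mulrA -inalg_central mulrA.
Qed.

Lemma poly_linearMr x F : poly_linear F -> poly_linear (fun p => F p * x).
Proof.
move=> [Fz FC]; split=> [p q|c p]; first by rewrite Fz mulrBl.
by rewrite FC mulrA.
Qed.

Lemma poly_linearMp q F : poly_linear F -> poly_linear (fun p => F (q * p)).
Proof.
by move=> [Fz FC]; split=> [p p'|c p]; rewrite ?mulrBr ?Fz // mulrCA FC.
Qed.

Lemma poly_linear_comp q F : poly_linear F -> poly_linear (fun p => F (p \Po q)).
Proof.
move=> [Fz FC]; split=> [p p'|c p]; first by rewrite rmorphB Fz.
by rewrite rmorphM /= comp_polyC FC.
Qed.

Lemma poly_linear0 : poly_linear (fun _ : {poly K} => 0 : A).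
Proof. by split=> [p q|c p]; rewrite ?subr0 ?mulr0. Qed.
End PLinear.

(** * Intertwining *)

Section Intertwine.
Variables (K : fieldType) (char0 : forall n, n.+1%:R != 0 :> K).
Variable A : pzAlgType K.
Implicit Types (e : nat -> A) (p q : {poly K}) (D : series A).
Implicit Types (phi P Q : series {poly K}).

(** [umbral e] applied to each coefficient in t. *)
Definition umbrals e P : series A := fun n => umbral e (P n).

Lemma umbrals_tr e s v P : umbrals e (translate s v P) = translate s v (umbrals e P).
Proof.
apply/funext => n; rewrite /umbrals /translate raddf_sum; apply: eq_bigr => j _.
exact: umbralC.
Qed.

(** How far the series D and D' are from intertwining the multiplication by phi
    on the polynomial side.  D' = D in the relations of the algebra; D' differs
    from D when two solutions are compared. *)
Definition defect e D D' phi P := D * umbrals e P - umbrals e (phi * P) * D'.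

Definition intertwines e D D' phi :=
  forall P, D * umbrals e P = umbrals e (phi * P) * D'.

(** The defect begins in order n, with a coefficient that depends only on the
    constant term P_0.  These leading defects add up under products and are
    negated by inverses. *)
Definition intertwines_upto n e D D' phi (d : {poly K} -> A) :=
  forall P, leading n (defect e D D' phi P) (d (P 0%N)).

Lemma intertwinesP e D D' phi :
  intertwines e D D' phi <-> forall n, intertwines_upto n e D D' phi (fun=> 0).
Proof.
split=> [H n P m _|H P].
  by rewrite /defect H subrr s0E; case: ifP.
by apply/subr0_eq/leading0P => n; exact: H.
Qed.

Lemma intertwines_uptoM n e D1 D1' phi1 d1 D2 D2' phi2 d2 :
    unipotent D1 -> unipotent D2' -> unipotent phi2 ->
  intertwines_upto n e D1 D1' phi1 d1 -> intertwines_upto n e D2 D2' phi2 d2 ->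
  intertwines_upto n e (D1 * D2) (D1' * D2') (phi1 * phi2) (fun p => d1 p + d2 p).
Proof.
move=> u1 u2 u3 H1 H2 P.
have -> : defect e (D1 * D2) (D1' * D2') (phi1 * phi2) P =
    defect e D1 D1' phi1 (phi2 * P) * D2' + D1 * defect e D2 D2' phi2 P.
  by rewrite /defect -(mulrA phi1); ncring.
apply: leadingD; last exact: leading_mull.
apply: leading_mulr => //.
by have := H1 (phi2 * P); rewrite smE0 u3 mul1r.
Qed.

Lemma intertwines_uptoV n e D D' phi d : unipotent D -> unipotent D' -> unipotent phi ->
  intertwines_upto n e D D' phi d ->
  intertwines_upto n e (sinv D) (sinv D') (sinv phi) (fun p => - d p).
Proof.
move=> u1 u2 u3 H P.
have -> : defect e (sinv D) (sinv D') (sinv phi) P =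
    - (sinv D * defect e D D' phi (sinv phi * P) * sinv D').
  rewrite /defect !mulrA mulsV // mul1r mulrBr mulrA mulVs // mul1r mulrBl.
  by rewrite -!mulrA mulsV // mulr1 opprB.
apply: leadingN; apply: leading_mulr => //; apply: leading_mull => //.
by have := H (sinv phi * P); rewrite smE0 sinv0 mul1r.
Qed.

(** [translate s 0] is bijective, so P may be taken to be a translate; then the
    whole defect is a translate.  As phi has valuation 0, all terms are
    translated with the same v. *)
Lemma intertwines_upto_tr n e D D' phi d s v :
  intertwines_upto n e D D' phi d ->
  intertwines_upto n e (translate s v D) (translate s v D') (translate s 0 phi) d.
Proof.
move=> H P; pose Q := translate (- s) 0 P.
have PE : P = translate s 0 Q by rewrite translate_comp // subrr translate0.
have -> : defect e (translate s v D) (translate s v D') (translate s 0 phi) P =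
    translate s v (defect e D D' phi Q).
  rewrite /defect translateB PE -(translateM char0 _ 0 0) addr0 !umbrals_tr.
  by rewrite -(translateM char0 _ v 0) addr0 -(translateM char0 _ 0 v) add0r.
by apply: leading_tr; rewrite PE translate_coef0; exact: H.
Qed.

Lemma intertwinesM e D1 D1' phi1 D2 D2' phi2 :
  intertwines e D1 D1' phi1 -> intertwines e D2 D2' phi2 ->
  intertwines e (D1 * D2) (D1' * D2') (phi1 * phi2).
Proof. by move=> H1 H2 P; rewrite -mulrA H2 mulrA H1 -!mulrA. Qed.

Lemma intertwinesV e D D' phi : unipotent D -> unipotent D' -> unipotent phi ->
  intertwines e D D' phi -> intertwines e (sinv D) (sinv D') (sinv phi).
Proof.
move=> u1 u2 u3 /intertwinesP H; apply/intertwinesP => n P.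
by have := intertwines_uptoV u1 u2 u3 (H n) P; rewrite oppr0.
Qed.

Lemma intertwines_tr e D D' phi s v :
  intertwines e D D' phi -> intertwines e (translate s v D) (translate s v D') (translate s 0 phi).
Proof. by move=> /intertwinesP H; apply/intertwinesP => n; exact: intertwines_upto_tr. Qed.

Lemma intertwines1 e : intertwines e 1 1 1.
Proof. by move=> P; rewrite mul1r mulr1 mul1r. Qed.

(** The polynomial p as a series constant in t. *)
Definition constS p : series {poly K} := fun n => if n == 0%N then p else 0.

Lemma constSr phi p n : (phi * constS p) n = phi n * p.
Proof.
rewrite smE big_ord_recr /= subnn big1 ?add0r // => i _.
by rewrite /constS subn_eq0 leqNgt ltn_ord mulr0.
Qed.

(** Both sides of the intertwining relation are continuous and t-linear in P, so
    the relation can be tested on constant series. *)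
Lemma mul_umbrals_const e D phi P m : (D * umbrals e (phi * P)) m =
  \sum_(l < m.+1) (D * umbrals e (phi * constS (P l))) (m - l)%N.
Proof.
pose F l i := D (m - (l + i))%N * umbral e (phi i * P l).
transitivity (\sum_(l < m.+1) \sum_(i < m.+1 - l) F l i).
  rewrite sum_triangle smErev; apply: eq_bigr => j _.
  rewrite /umbrals smErev raddf_sum mulr_sumr; apply: eq_bigr => l _.
  by rewrite /F subnKC ?leq_ord.
apply: eq_bigr => l _; rewrite smErev (subSn (leq_ord l)).
by apply: eq_bigr => i _; rewrite /F subnDA /umbrals constSr.
Qed.

Lemma umbrals_mul_const e D phi P m : (umbrals e (phi * P) * D) m =
  \sum_(l < m.+1) (umbrals e (phi * constS (P l)) * D) (m - l)%N.
Proof.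
pose F l i := umbral e (phi i * P l) * D (m - (l + i))%N.
transitivity (\sum_(l < m.+1) \sum_(i < m.+1 - l) F l i).
  rewrite sum_triangle smE; apply: eq_bigr => j _.
  rewrite /umbrals smErev raddf_sum mulr_suml; apply: eq_bigr => l _.
  by rewrite /F subnKC ?leq_ord.
apply: eq_bigr => l _; rewrite smE (subSn (leq_ord l)).
by apply: eq_bigr => i _; rewrite /F subnDA /umbrals constSr.
Qed.

(** The sequence x, 0, 0, ... : with phi = 1, to intertwine it means to commute
    with x, or for x = 1 and two series, to be equal. *)
Definition single (x : A) : nat -> A := fun n => if n == 0%N then x else 0.

Lemma umbral_single x p : umbral (single x) p = inalg p`_0 * x.
Proof.
rewrite (@umbralw _ _ _ _ (size p).+1) // big_ord_recl big1 ?addr0 // => i _.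
by rewrite mulr0.
Qed.

Lemma intertwines_upto_single n x D D' d :
  leading n (fun m => D m * x - x * D' m) d ->
  intertwines_upto n (single x) D D' 1 (fun p => inalg p`_0 * d).
Proof.
move=> H P m mn; rewrite /defect ssbE -{1}[P]mul1r mul_umbrals_const umbrals_mul_const.
rewrite -sumrB.
have E (l : 'I_m.+1) : (D * umbrals (single x) (1 * constS (P l))) (m - l)%N -
   (umbrals (single x) (1 * constS (P l)) * D') (m - l)%N =
   inalg (P l)`_0 * (if (m - l)%N == n then d else 0).
  rewrite -H; last exact: leq_trans (leq_subr _ _) mn.
  rewrite smErev smE !big_ord_recl !big1 ?addr0.
  - rewrite /umbrals mul1r /constS /= umbral_single subn0 (mulrA (D _)) -inalg_central.
    by rewrite mulrBr !mulrA.
  - by move=> i _; rewrite /umbrals mul1r raddf0 mul0r.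
  by move=> i _; rewrite /umbrals mul1r raddf0 mulr0.
under eq_bigr => l _ do rewrite E.
rewrite big_ord_recl subn0 big1 ?addr0.
  by case: eqP; rewrite ?mulr0.
by move=> i _; rewrite (ltn_eqF (sub_lift_lt i mn)) mulr0.
Qed.

Lemma intertwines_single x D D' :
  intertwines (single x) D D' 1 <-> forall n, D n * x = x * D' n.
Proof.
split=> H; last first.
  apply/intertwinesP => n; have := @intertwines_upto_single n x D D' 0.
  move=> T P; have := T _ P; rewrite mulr0; apply => m _.
  by rewrite H subrr; case: ifP.
move=> n; have := congr1 (fun f => f n) (H (constS 1)).
rewrite smErev smE !big_ord_recl !big1 ?addr0.
- by rewrite mul1r /umbrals /constS /= umbral_single coef1 rmorph1 mul1r subn0.
- by move=> i _; rewrite /umbrals mul1r raddf0 mul0r.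
by move=> i _; rewrite /umbrals raddf0 mulr0.
Qed.
End Intertwine.

Section Lambda.
Variables (K : fieldType) (char0 : forall n, n.+1%:R != 0 :> K).
Implicit Types (a b c : K).

(** t (z - X + a) = 1 - t (X - a), the unipotent form of z - X + a. *)
Definition zfactor a : series {poly K} := fun n =>
  if n == 0%N then 1 else if n == 1%N then - ('X - a%:P) else 0.
(** (z - X + a) / (z - X + b). *)
Definition zratio a b := zfactor a * sinv (zfactor b).

Lemma unipotent_zfactor a : unipotent (zfactor a). Proof. by []. Qed.
Lemma unipotent_zratio a b : unipotent (zratio a b).
Proof. by apply: unipotent_mul => //; exact: unipotent_sinv. Qed.

Lemma zratioxx a : zratio a a = 1. Proof. exact: mulsV. Qed.
Lemma zratioM a b c : zratio a b * zratio b c = zratio a c.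
Proof. by rewrite /zratio mulrA -(mulrA (zfactor a)) mulVs // mulr1. Qed.
Lemma zratioV a b : sinv (zratio a b) = zratio b a.
Proof. by apply/esym/sinv_uniq; rewrite ?zratioM ?zratioxx //; exact: unipotent_zratio. Qed.

(** The product contains the factor m - m. *)
Lemma gbinom_small m j : (m < j)%N -> gbinom K m%:Z j = 0.
Proof.
by move=> mj; rewrite /gbinom (bigD1 (Ordinal mj)) //= subrr !mul0r.
Qed.

(** z - X + a has valuation - 1 and becomes z + s - X + a. *)
Lemma translate_zfactor s a : translate s (- 1) (zfactor a) = zfactor (a + s).
Proof.
apply/funext => -[|[|n]]; first by rewrite translate_coef0.
  rewrite /translate !big_ord_recl big_ord0 /= addr0 gbinom0 /ascale mul1r rmorph1 mul1r.
  rewrite /zfactor /= (_ : gbinom K _ _ = 1); last first.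
    by rewrite /gbinom big_ord1 subr0 divr1.
  by rewrite mul1r mulr1 /inalg /= rmorphD /=; ring.
rewrite /translate 2!big_ord_recr big1 /=; last first.
  move=> [i lt_in] _ /=; rewrite /zfactor (subSn (ltnW lt_in)) (subSn (lt_in : (i <= n)%N)).
  by rewrite /ascale mulr0.
rewrite add0r subSnn subnn addr0 !gbinom_small // !mul0r /ascale rmorph0 !mul0r.
by rewrite addr0.
Qed.

Lemma translate_zratio s a b : translate s 0 (zratio a b) = zratio (a + s) (b + s).
Proof.
rewrite /zratio -[0 in LHS](addNr (1 : int)) translateM // translate_zfactor; congr (_ * _).
by rewrite -[X in translate s X](opprK (1 : int)) translate_inv // translate_zfactor.
Qed.

Definition subst_shift c (P : series {poly K}) : series {poly K} :=
  fun n => P n \Po ('X - c%:P).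

Lemma subst_shiftM c P Q : subst_shift c (P * Q) = subst_shift c P * subst_shift c Q.
Proof.
apply/funext => n; rewrite /subst_shift smE raddf_sum /=.
by apply: eq_bigr => i _; rewrite comp_polyM.
Qed.

Lemma subst_shift_zfactor c a : subst_shift c (zfactor a) = zfactor (a + c).
Proof.
apply/funext => -[|[|n]]; rewrite /subst_shift /zfactor /= ?comp_poly0 ?comp_polyC //.
by rewrite raddfN /= comp_polyB comp_polyX comp_polyC rmorphD /=; ring.
Qed.

Lemma subst_shift1 c : subst_shift c 1 = 1.
Proof. by apply/funext => -[|n]; rewrite /subst_shift ?comp_polyC // comp_poly0. Qed.

Lemma subst_shift_zratio c a b : subst_shift c (zratio a b) = zratio (a + c) (b + c).
Proof.
rewrite /zratio subst_shiftM subst_shift_zfactor; congr (_ * _); apply: sinv_uniq => //.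
by rewrite -subst_shift_zfactor -subst_shiftM mulsV // subst_shift1.
Qed.

Lemma subst_shiftK c P : subst_shift c (subst_shift (- c) P) = P.
Proof.
apply/funext => n; rewrite /subst_shift -comp_polyA comp_polyB comp_polyX comp_polyC.
by rewrite rmorphN /= opprK subrK comp_polyXr.
Qed.
End Lambda.

Section IntertwineLam.
Variables (K : fieldType) (char0 : forall n, n.+1%:R != 0 :> K).
Variable A : pzAlgType K.
Implicit Types (e : nat -> A) (D : series A).

Lemma gbinom_neg m j : gbinom K (- (1 + m%:Z)) j = (- 1) ^+ j * 'C(m + j, j)%:R.
Proof.
elim: j => [|j IH]; first by rewrite gbinom0 bin0 mulr1.
apply: (mulIf (char0 j)); rewrite gbinomS // IH.
have E : ('C(m + j.+1, j.+1) * j.+1 = (m + j.+1) * 'C(m + j, j))%N.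
  by rewrite mulnC -mul_bin_diag addnS.
rewrite -[RHS]mulrA -natrM E natrM exprS addnS -natr1 natrD.
by rewrite rmorphN rmorphD /= -pmulrn; ring.
Qed.

(** E(z) is the image of 1 / (z - X), so E(z + s) is the image of
    1 / (z - (X - s)). *)
Lemma translate_shift e s n : translate s 1 e n = umbral e (('X - s%:P) ^+ n).
Proof.
rewrite exprBn raddf_sum /=; apply: eq_bigr => j _.
rewrite /ascale gbinom_neg subnK ?leq_ord //.
rewrite -(umbralXn e (n - j)) -umbralC; congr (umbral e _).
by rewrite !rmorphM /= !rmorphXn rmorphN1 rmorph_nat -[in RHS]mulr_natr; ring.
Qed.

Lemma umbral_tr e s p : umbral (translate s 1 e) p = umbral e (p \Po ('X - s%:P)).
Proof.
have L := poly_linear_comp ('X - s%:P) (umbral_linear e).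
rewrite [RHS](poly_linear_umbral L); congr (umbral _ p); apply/funext => n.
by rewrite translate_shift comp_Xn_poly.
Qed.

(** Substituting X := X - s in P turns [umbral e] into [umbral] of the translated
    sequence; phi undergoes the inverse substitution. *)
Lemma intertwines_shift e D D' phi s :
  intertwines e D D' phi -> intertwines (translate s 1 e) D D' (subst_shift (- s) phi).
Proof.
have E P : umbrals (translate s 1 e) P = umbrals e (subst_shift s P).
  by apply/funext => n; rewrite /umbrals umbral_tr.
by move=> H P; rewrite !E H subst_shiftM subst_shiftK.
Qed.

Lemma coef_tr (f : lser A) s (k : int) M : (k < lval f + M%:Z) ->
  coef (ltranslate s f) k =
  \sum_(j < M) inalg (gbinom K (- (k - j%:Z)) j * s ^+ j) * coef f (k - j%:Z).
Proof.
case: f => v f /= kM; rewrite ltranslateE /coef /=; case: (leP v k) => vk.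
  have [n kE] : exists n : nat, k = v + n%:Z.
    by exists `|k - v|%N; lia.
  have nM : (n < M)%N by move: kM; rewrite kE ltrD2l.
  rewrite kE addrC addKr absz_nat /translate.
  pose F j := inalg (gbinom K (- (v + (n%:Z - j%:Z))) j * s ^+ j) *
    (if v <= v + (n%:Z - j%:Z) then f `|n%:Z - j%:Z|%N else 0).
  have /= E := big_ord_widen M F nM.
  transitivity (\sum_(i < n.+1) F i).
    apply: eq_bigr => j _.
    by rewrite /F subzn ?leq_ord // lerDl.
  rewrite E big_mkcond; apply: eq_bigr => j _.
  rewrite /F -(addrA v) (_ : v + _ - v = n%:Z - j%:Z); last by lia.
  case: ifP => // /negbT; rewrite -leqNgt => nj.
  rewrite lerDl subr_ge0 lez_nat leqNgt nj mulr0 //.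
rewrite big1 // => j _; case: ifP; rewrite ?mulr0 // => h.
by move: (lt_le_trans vk h); rewrite ltNge gerBl.
Qed.

(** The nonnegative powers of z stay nonnegative under z := z + s, so the tail of
    f(z + s) is the translated tail of f, whatever the valuation of f.  In
    coefficients, gbinom of a small nonnegative integer vanishes. *)
Lemma coef_tr_tail (f : lser A) s n :
  coef (ltranslate s f) n.+1%:Z = umbral (fun m => coef f m.+1%:Z) (('X - s%:P) ^+ n).
Proof.
rewrite -translate_shift /translate.
(* Any bound beyond both n and the valuation of f serves. *)
pose M := (n.+2 + `|lval f|)%N.
have nM : (n.+1 <= M)%N by rewrite /M addSn ltnW // ltnS leq_addr.
rewrite (@coef_tr f s _ M); last by rewrite /M; lia.
pose F j := inalg (gbinom K (- (n.+1%:Z - j%:Z)) j * s ^+ j) *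
  coef f (n.+1%:Z - j%:Z).
transitivity (\sum_(j < n.+1) F j).
  have /= -> := big_ord_widen M F nM.
  rewrite [RHS]big_mkcond; apply: eq_bigr => j _; case: ltnP => // nj.
  have -> : - (n.+1%:Z - j%:Z) = (j - n.+1)%:Z by rewrite opprB subzn.
  rewrite gbinom_small ?mul0r ?rmorph0 ?mul0r //.
  by rewrite ltn_subrL /=; apply: leq_trans nj.
apply: eq_bigr => j _; rewrite /F /ascale subzn; last exact: ltnW (ltn_ord j).
by rewrite (subSn (leq_ord j)) -[in RHS]PoszD add1n.
Qed.
End IntertwineLam.

(** * Intertwining relations in coefficients *)

Section IntertwineRel.
Variables (K : fieldType) (A : pzAlgType K).
Implicit Types (e : nat -> A) (D : series A).

Lemma mul_umbrals_zfactorS e D b p k : (D * umbrals e (zfactor b * constS p)) k.+1 =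
  D k.+1 * umbral e p - D k * umbral e (('X - b%:P) * p).
Proof.
rewrite smErev !big_ord_recl big1 ?addr0.
  by rewrite /umbrals !constSr /= subn0 subSS subn0 mul1r mulNr raddfN mulrN.
by move=> i _; rewrite /umbrals constSr mul0r raddf0 mulr0.
Qed.

Lemma umbrals_zfactorS_mul e D b p k : (umbrals e (zfactor b * constS p) * D) k.+1 =
  umbral e p * D k.+1 - umbral e (('X - b%:P) * p) * D k.
Proof.
rewrite smE !big_ord_recl big1 ?addr0.
  by rewrite /umbrals !constSr /= subn0 subSS subn0 mul1r mulNr raddfN mulNr.
by move=> i _; rewrite /umbrals constSr mul0r raddf0 mul0r.
Qed.

Lemma umbral_XsubC e b n : umbral e (('X - b%:P) * 'X^n) = e n.+1 - inalg b * e n.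
Proof. by rewrite mulrBl raddfB /= umbralC -exprS !umbralXn. Qed.

(** Clearing the denominator z - X + b, the relation reads
    D(z) (z - X + b) E = (z - X + a) E D(z); its coefficients are the identities
    on the right. *)
Lemma intertwines_zratioP e D a b : unipotent D ->
  intertwines e D D (zratio a b) <->
  forall k n, D k.+1 * e n - D k * (e n.+1 - inalg b * e n) =
              e n * D k.+1 - (e n.+1 - inalg a * e n) * D k.
Proof.
move=> uD; split=> H.
  move=> k n; have := congr1 (fun f => f k.+1) (H (zfactor b * constS 'X^n)).
  rewrite mulrA /zratio -(mulrA (zfactor a)) mulVs // mulr1.
  by rewrite mul_umbrals_zfactorS umbrals_zfactorS_mul !umbral_XsubC umbralXn.
have {}H p k : D k.+1 * umbral e p - D k * umbral e (('X - b%:P) * p) =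
               umbral e p * D k.+1 - umbral e (('X - a%:P) * p) * D k.
  have le := umbral_linear e; move: p; apply: poly_linear_ext => [||n].
  - by apply: poly_linearB; apply: poly_linearMl => //; exact: poly_linearMp.
  - by apply: poly_linearB; apply: poly_linearMr => //; exact: poly_linearMp.
  by rewrite !umbral_XsubC !umbralXn.
move=> P; rewrite -[P in LHS]mul1r -(mulsV (unipotent_zfactor b)) -mulrA /zratio -mulrA.
move: (sinv _ * P) => Q; apply/funext => m.
rewrite mul_umbrals_const umbrals_mul_const; apply: eq_bigr => l _.
case: (m - l)%N => [|k]; last by rewrite mul_umbrals_zfactorS umbrals_zfactorS_mul H.
by rewrite !smE0 uD /umbrals !constSr mul1r mulr1.
Qed.
End IntertwineRel.

(** * Root data *)

(** Splits on equalities between nodes, discarding impossible cases as soon as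
    they appear. *)
Ltac node_cases := repeat (case: eqP => ?; try (exfalso; lia)); try lia; try by [].

Section Nodes.
Variables (r : nat) (hr : (3 <= r)%N).

(** K_i = D_a^-1 D_b with a = [Kden i] and b = [Knum i]. *)
Definition Kden (i : 'I_r) : 'I_r.+1 := if last_node i then inord (r - 2) else inord i.
Definition Knum (i : 'I_r) : 'I_r.+1 := if last_node i then inord r else inord i.+1.
(** 2 s_i, as a natural number. *)
Definition shift2 (i : 'I_r) : nat := if last_node i then (r - 2)%N else i.

(** The coordinates of alpha_j, with indices read as natural numbers. *)
Definition alpha_coord (j k : nat) : int :=
  if j == r.-1 then (k == r - 2)%N%:Z + (k == r - 1)%N%:Z
  else (k == j)%:Z - (k == j.+1)%:Z.

Lemma dotp_epsv k (v : 'rV[int]_r.+1) : dotp (epsv k) v = v 0 k.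
Proof.
rewrite /dotp (bigD1 k) //= big1 ?addr0 => [|i ik]; rewrite /epsv mxE eqxx /=.
  by rewrite eqxx mul1r.
by rewrite (negPf ik) mul0r.
Qed.

Lemma dotpDl (u v w : 'rV[int]_r.+1) : dotp (u + v) w = dotp u w + dotp v w.
Proof. by rewrite /dotp -big_split; apply: eq_bigr => i _; rewrite mxE mulrDl. Qed.

Lemma dotpNl (u w : 'rV[int]_r.+1) : dotp (- u) w = - dotp u w.
Proof. by rewrite /dotp -sumrN; apply: eq_bigr => i _; rewrite mxE mulNr. Qed.

Lemma epsv_inord k n : (n <= r)%N -> epsv (inord n : 'I_r.+1) 0 k = (k == n :> nat)%:Z.
Proof. by move=> nr; rewrite mxE eqxx -val_eqE /= inordK //; case: eqP. Qed.

Lemma alphavE j (k : 'I_r.+1) : alphav j 0 k = alpha_coord j k.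
Proof.
rewrite /alphav /alpha_coord /last_node; case: eqP => [_|/eqP ej].
  by rewrite mxE !epsv_inord //; lia.
have jr := ltn_ord j.
by rewrite mxE [X in _ + X]mxE !epsv_inord //; lia.
Qed.

Lemma cartanE (i j : 'I_r) : cartan i j =
  if i == r.-1 :> nat then alpha_coord j (r - 2) + alpha_coord j (r - 1)
  else alpha_coord j i - alpha_coord j i.+1.
Proof.
have ir := ltn_ord i.
rewrite /cartan [alphav i]/alphav /last_node; case: eqP => [_|/eqP ei].
  by rewrite dotpDl !dotp_epsv !alphavE !inordK //; lia.
by rewrite dotpDl dotpNl !dotp_epsv !alphavE !inordK //; lia.
Qed.

Lemma cmatE (k : 'I_r.+1) (j : 'I_r) : cmat k j =
  if k == r :> nat then if j == r.-1 :> nat then - 1 else (j == r - 2 :> nat)%N%:Z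
  else alpha_coord j k.
Proof.
rewrite /cmat dotp_epsv alphavE -val_eqE /= /last_node.
by case: ifP => // _; case: ifP => // _; case: ifP.
Qed.

Lemma val_Kden i : Kden i = (if i == r.-1 :> nat then (r - 2)%N else i) :> nat.
Proof.
have ir := ltn_ord i.
by rewrite /Kden /last_node; case: ifP => _; rewrite inordK //; lia.
Qed.

Lemma val_Knum i : Knum i = (if i == r.-1 :> nat then r else i.+1) :> nat.
Proof.
have ir := ltn_ord i.
by rewrite /Knum /last_node; case: ifP => _; rewrite inordK //; lia.
Qed.

Lemma cmat_cartan i j : cmat (Kden i) j - cmat (Knum i) j = cartan i j.
Proof.
rewrite !cmatE cartanE val_Kden val_Knum /alpha_coord.
by move: (nat_of_ord i) (nat_of_ord j) (ltn_ord i) (ltn_ord j) => x y xr yr;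
  case: (x =P r.-1) => ?; case: (y =P r.-1) => ?; node_cases.
Qed.

(** The condition on the shifts s_i that makes the relations of K_i in X those of
    H_i in Y. *)
Lemma cmat_shift i j : cartan i j != 0 ->
  cartan i j - 2 * cmat (Kden i) j = (shift2 i)%:Z - (shift2 j)%:Z.
Proof.
rewrite !cmatE cartanE val_Kden /shift2 /last_node /alpha_coord.
by move: (nat_of_ord i) (nat_of_ord j) (ltn_ord i) (ltn_ord j) => x y xr yr;
  case: (x =P r.-1) => ?; case: (y =P r.-1) => ?; node_cases.
Qed.

(** The condition on the shifts s_i that symmetrizes the relations between E_i
    and E_j. *)
Lemma cartan_shift (i j : 'I_r) : (i < j)%N -> cartan i j != 0 ->
  (shift2 j)%:Z - (shift2 i)%:Z = - cartan i j.
Proof.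
rewrite cartanE /shift2 /last_node /alpha_coord.
by move: (nat_of_ord i) (nat_of_ord j) (ltn_ord i) (ltn_ord j) => x y xr yr;
  case: (x =P r.-1) => ?; case: (y =P r.-1) => ?; node_cases.
Qed.

Lemma cartan_diag (i : 'I_r) : cartan i i = 2.
Proof. by rewrite cartanE /alpha_coord; have ir := ltn_ord i; node_cases. Qed.

Lemma cartan_offdiag (i j : 'I_r) : i != j -> cartan i j = 0 \/ cartan i j = - 1.
Proof.
rewrite -val_eqE /= cartanE /alpha_coord.
by move: (nat_of_ord i) (nat_of_ord j) (ltn_ord i) (ltn_ord j) => x y xr yr;
  case: (x =P r.-1) => ?; case: (y =P r.-1) => ?; node_cases.
Qed.

Lemma cartan_sym (i j : 'I_r) : cartan i j = cartan j i.
Proof. by apply: eq_bigr => k _; rewrite mulrC. Qed.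

Lemma mubarE mu i : mubar mu i = dmu mu (Kden i) - dmu mu (Knum i).
Proof.
rewrite /mubar /dmu /alphahat /Kden /Knum.
by case: ifP => _; rewrite dotpDl dotpNl !dotp_epsv.
Qed.
End Nodes.

(** * Recovering the series D from K and C *)

Section CartanSystem.
Variables (K : fieldType) (char0 : forall n, n.+1%:R != 0 :> K).
Variables (r : nat) (hr : (3 <= r)%N).

Section Def.
Variable A : pzAlgType K.
Implicit Types (D : 'I_r.+1 -> series A) (d : 'I_r.+1 -> int).

Definition Cshift (i : nat) : K := i.+1%:R - r%:R.

Definition Kseries D (i : 'I_r) : series A := sinv (D (Kden i)) * D (Knum i).

(** The expression C_r(z) for arbitrary series D_j of valuations d_j.  It is used
    in the algebra, with d_j the coordinates of mu, and for the commuting phi's,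
    with d = 0. *)
Definition Cseries d D : series A :=
  (\prod_(i < r.-1) (translate (Cshift i) (d (inord i)) (D (inord i)) *
     sinv (translate (Cshift i + 1) (d (inord i)) (D (inord i))))) *
  D (inord (r - 1)) * D (inord r).

Lemma unipotent_Kseries D i : (forall j, unipotent (D j)) -> unipotent (Kseries D i).
Proof. by move=> uD; apply: unipotent_mul. Qed.

Lemma unipotent_Cseries d D : (forall j, unipotent (D j)) -> unipotent (Cseries d D).
Proof.
move=> uD; do 2![apply: unipotent_mul => //]; apply: unipotent_prod => i.
by apply: unipotent_mul; [exact: unipotent_tr | exact: unipotent_sinv].
Qed.
End Def.

Lemma double_eq0 (A : pzAlgType K) (x : A) : x + x = 0 -> x = 0.
Proof.
move=> xx; have -> : x = inalg (2%:R^-1 : K) * (x + x); last by rewrite xx mulr0.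
rewrite mulrDr -mulrDl -rmorphD /= (_ : 2%:R^-1 + 2%:R^-1 = 1 :> K).
  by rewrite rmorph1 mul1r.
by field; exact: (char0 1).
Qed.

Section Rigidity.
Variable A : pzAlgType K.
Variables (e : nat -> A) (D D' : 'I_r.+1 -> series A).
Variable phi : 'I_r.+1 -> series {poly K}.
Variable d : 'I_r.+1 -> int.
Hypotheses (uD : forall j, unipotent (D j)) (uD' : forall j, unipotent (D' j)).
Hypothesis uphi : forall j, unipotent (phi j).

Lemma intertwines_upto_eq n (F F' : series A) psi (x y : {poly K} -> A) :
  x =1 y -> intertwines_upto n e F F' psi x -> intertwines_upto n e F F' psi y.
Proof. by move=> xy H P m mn; rewrite -xy; exact: H. Qed.

(** Each factor D_i(z + a) / D_i(z + a + 1) contributes x - x, and the two last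
    factors contribute x each. *)
Lemma intertwines_upto_Cseries n x :
  (forall j, intertwines_upto n e (D j) (D' j) (phi j) x) ->
  intertwines_upto n e (Cseries d D) (Cseries d D') (Cseries (fun=> 0) phi) (fun p => x p + x p).
Proof.
have uC (B : pzAlgType K) dB (G : 'I_r.+1 -> series B) : (forall j, unipotent (G j)) ->
    unipotent (\prod_(i < r.-1) (translate (Cshift i) (dB (inord i)) (G (inord i)) *
     sinv (translate (Cshift i + 1) (dB (inord i)) (G (inord i))))).
  move=> uG; apply: unipotent_prod => i.
  by apply: unipotent_mul; [exact: unipotent_tr | exact: unipotent_sinv].
move=> H; apply: intertwines_uptoM => //.
  by apply: unipotent_mul => //; exact: uC.
rewrite -[x]/(fun p => x p); apply: (@intertwines_upto_eq _ _ _ _ (fun p => 0 + x p)).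
  by move=> p; rewrite add0r.
apply: intertwines_uptoM => //; first exact: uC.
pose Q (F F' : series A) psi :=
  [/\ unipotent F, unipotent F', unipotent psi & intertwines_upto n e F F' psi (fun=> 0)].
suff [] : Q (\prod_(i < r.-1) (translate (Cshift i) (d (inord i)) (D (inord i)) *
     sinv (translate (Cshift i + 1) (d (inord i)) (D (inord i)))))
   (\prod_(i < r.-1) (translate (Cshift i) (d (inord i)) (D' (inord i)) *
     sinv (translate (Cshift i + 1) (d (inord i)) (D' (inord i)))))
   (\prod_(i < r.-1) (translate (Cshift i) 0 (phi (inord i)) *
     sinv (translate (Cshift i + 1) 0 (phi (inord i))))) by [].
elim/big_ind3: _ => [|F1 F1' p1 F2 F2' p2 [u1 u2 u3 H1] [v1 v2 v3 H2]|i _].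
- split; try exact: unipotent1.
  by have /intertwinesP := @intertwines1 K A e; exact.
- split; try exact: unipotent_mul.
  have H' := intertwines_uptoM u1 v2 v3 H1 H2.
  by apply: intertwines_upto_eq H' => p; rewrite addr0.
split; try by apply: unipotent_mul; [exact: unipotent_tr | exact: unipotent_sinv].
apply: (@intertwines_upto_eq _ _ _ _ (fun p => x p + - x p)).
  by move=> p; rewrite addrN.
apply: intertwines_uptoM; [exact: unipotent_tr|exact: unipotent_sinv|exact: unipotent_sinv| |].
  exact: intertwines_upto_tr.
apply: intertwines_uptoV; try exact: unipotent_tr.
exact: intertwines_upto_tr.
Qed.

(** D_b = D_a K_i, and an exact K_i adds nothing to the defect of D_a.  Starting
    from D_1, the nodes i < r reach D_2, ..., D_r, and the last node reaches
    D_(r+1) from D_(r-1). *)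
Lemma intertwines_upto_Kseries n x :
  (forall i, intertwines e (Kseries D i) (Kseries D' i) (Kseries phi i)) ->
  intertwines_upto n e (D ord0) (D' ord0) (phi ord0) x ->
  forall j, intertwines_upto n e (D j) (D' j) (phi j) x.
Proof.
move=> HK H0.
have DE (B : pzAlgType K) (F : 'I_r.+1 -> series B) i :
    (forall j, unipotent (F j)) -> F (Knum i) = F (Kden i) * Kseries F i.
  by move=> uF; rewrite /Kseries mulrA mulsV // mul1r.
have step i : intertwines_upto n e (D (Kden i)) (D' (Kden i)) (phi (Kden i)) x ->
              intertwines_upto n e (D (Knum i)) (D' (Knum i)) (phi (Knum i)) x.
  move=> H; rewrite !DE //.
  apply: (@intertwines_upto_eq _ _ _ _ (fun p => x p + 0)) => [p|]; first by rewrite addr0.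
  apply: intertwines_uptoM => //; try exact: unipotent_Kseries.
  by have /intertwinesP := HK i; exact.
have low k : (k < r)%N -> intertwines_upto n e (D (inord k)) (D' (inord k)) (phi (inord k)) x.
  elim: k => [_|k IH kr].
    by have -> : inord 0 = ord0 :> 'I_r.+1 by apply: val_inj; rewrite /= inordK.
  have kr' : (k < r)%N by lia.
  have := step (Ordinal kr'); rewrite /Kden /Knum /last_node /=.
  have -> : (k == r.-1) = false by lia.
  by apply; apply: IH.
move=> j; have := ltn_ord j; rewrite ltnS leq_eqVlt => /orP[/eqP jr|jr]; last first.
  by have := low _ jr; rewrite inord_val.
have rr : (r.-1 < r)%N by lia.
have := step (Ordinal rr); rewrite /Kden /Knum /last_node /= eqxx.
have -> : inord r = j by apply: val_inj; rewrite /= inordK.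
by apply; apply: low; lia.
Qed.

(** By induction on the order n: once all defects vanish below n, the D_j share
    one leading defect x; that of C is 2 x, and it vanishes. *)
Lemma rigidity :
  (forall i, intertwines e (Kseries D i) (Kseries D' i) (Kseries phi i)) ->
  intertwines e (Cseries d D) (Cseries d D') (Cseries (fun=> 0) phi) ->
  forall j, intertwines e (D j) (D' j) (phi j).
Proof.
move=> HK HC j; apply/intertwinesP => n; move: j.
elim/ltn_ind: n => n IH.
(* The leading defect of D_1, read off on constant series. *)
pose x p := defect e (D ord0) (D' ord0) (phi ord0) (constS p) n.
have H0 : intertwines_upto n e (D ord0) (D' ord0) (phi ord0) x.
  move=> P m mn; rewrite /x /defect !ssbE.
  rewrite -{1}[P]mul1r mul_umbrals_const umbrals_mul_const -sumrB.
  have E l : (D ord0 * umbrals e (1 * constS (P l))) (m - l)%N -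
      (umbrals e (phi ord0 * constS (P l)) * D' ord0) (m - l)%N =
      if (m - l)%N == n then x (P l) else 0.
    rewrite mul1r; case: eqP => [->|/eqP ne]; first by rewrite /x /defect ssbE.
    have lt : (m - l < n)%N by rewrite ltn_neqAle ne (leq_trans (leq_subr _ _)).
    by have := IH _ lt ord0 (constS (P l)) _ (leqnn _); rewrite if_same.
  under eq_bigr => l _ do rewrite E.
  rewrite big_ord_recl subn0 big1 ?addr0 //.
  by move=> i _; rewrite (ltn_eqF (sub_lift_lt i mn)).
have HD := intertwines_upto_Kseries HK H0.
have HC2 := intertwines_upto_Cseries HD; move/intertwinesP: HC => /(_ n) HC.
have x0 p : x p = 0.
  by apply: double_eq0; have := leading_inj (HC2 (constS p)) (HC (constS p)).
by move=> j; apply: intertwines_upto_eq (HD j).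
Qed.
End Rigidity.

Lemma Cseries1 (A : pzAlgType K) : Cseries (fun=> 0) (fun=> 1 : series A) = 1.
Proof.
rewrite /Cseries !mulr1 big1 // => i _.
by rewrite !translate_val0_1 // sinv1 mulr1.
Qed.

Section Existence.
Variable A : pzAlgType K.

(** The n-th coefficient of Psi f is 2 f_n plus a function of the previous
    coefficients, so the equation determines f_n. *)
Lemma solve_recursion (Psi : series A -> series A) :
    (forall f, unipotent f -> unipotent (Psi f)) ->
    (forall n f g, unipotent f -> unipotent g -> (forall m, (m <= n)%N -> f m = g m) ->
       Psi f n.+1 - Psi g n.+1 = f n.+1 - g n.+1 + (f n.+1 - g n.+1)) ->
  forall c, unipotent c -> exists2 f, unipotent f & Psi f = c.
Proof.
move=> uPsi H c uc.
pose next n (s : seq A) := inalg (2%:R^-1) * (c n - Psi (nth 0 s) n).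
pose fix ds n := if n is n'.+1 then rcons (ds n') (next n (ds n')) else [:: 1].
have sz n : size (ds n) = n.+1 by elim: n => //= n IH; rewrite size_rcons IH.
pose f n := (ds n)`_n.
have fE n m : (m <= n)%N -> (ds n)`_m = f m.
  elim: n => [|n IH]; first by rewrite leqn0 => /eqP ->.
  rewrite leq_eqVlt => /orP[/eqP -> //|mn].
  by rewrite /= nth_rcons sz mn IH.
have uf : unipotent f by [].
exists f => //; apply/funext => -[|n]; first by rewrite uPsi.
(* g is f truncated after order n, with coefficient 0 in order n + 1. *)
pose g : series A := nth 0 (ds n).
have ug : unipotent g by rewrite /unipotent /g fE.
have g0 : g n.+1 = 0 by rewrite /g nth_default // sz.
have fn : f n.+1 = inalg (2%:R^-1) * (c n.+1 - Psi g n.+1).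
  by rewrite /f /= nth_rcons sz ltnn eqxx.
have := H n f g uf ug (fun m mn => esym (fE n m mn)); rewrite g0 subr0 fn.
rewrite -mulrDl -rmorphD /=.
have -> : 2%:R^-1 + 2%:R^-1 = 1 :> K by field; exact: (char0 1).
by rewrite rmorph1 mul1r => /addIr.
Qed.

(** All D_j are D_1 times products of the given K_i, and C, as a function of D_1,
    satisfies the hypothesis of [solve_recursion] by [intertwines_upto_Cseries]
    with phi = 1. *)
Lemma D_exists (d : 'I_r.+1 -> int) (kap : 'I_r -> series A) (c : series A) :
    (forall i, unipotent (kap i)) -> unipotent c ->
  exists D : 'I_r.+1 -> series A,
    [/\ forall j, unipotent (D j), forall i, Kseries D i = kap i & Cseries d D = c].
Proof.
move=> uk uc.
(* The K_i indexed by all natural numbers; the default 1 is never reached. *)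
pose kn k : series A := if insub k is Some i then kap i else 1.
have knE (i : 'I_r) : kn i = kap i by rewrite /kn valK.
have ukn k : unipotent (kn k) by rewrite /kn; case: insub => [i|].
pose Dn f := fix Dn k : series A := if k is k'.+1 then Dn k' * kn k' else f.
have uDn f k : unipotent f -> unipotent (Dn f k).
  by move=> uf; elim: k => //= k IH; exact: unipotent_mul.
pose D f (j : 'I_r.+1) := if j == r :> nat then Dn f (r - 2)%N * kn r.-1 else Dn f j.
have uD f j : unipotent f -> unipotent (D f j).
  by move=> uf; rewrite /D; case: ifP => _; [apply: unipotent_mul => //|]; exact: uDn.
have DK f i : unipotent f -> Kseries (D f) i = kap i.
  move=> uf; have ir := ltn_ord i.
  rewrite /Kseries /D !val_Kden // !val_Knum //; case: (i =P r.-1 :> nat) => [ei|ni].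
    rewrite eqxx (_ : (r - 2 == r)%N = false); last by lia.
    rewrite mulrA mulVs; last exact: uDn.
    by rewrite mul1r -ei.
  rewrite (_ : (i.+1 == r) = false); last by lia.
  rewrite (_ : (i == r :> nat) = false); last by lia.
  by rewrite /= mulrA mulVs ?mul1r ?knE //; exact: uDn.
have [f uf fC] : exists2 f, unipotent f & Cseries d (D f) = c.
  apply: solve_recursion => // [f uf|n f g uf ug fg].
    by apply: unipotent_Cseries => j; exact: uD.
  have HK i : intertwines (single (1 : A)) (Kseries (D f) i) (Kseries (D g) i)
                          (Kseries (fun=> 1) i).
    rewrite {3}/Kseries sinv1 mulr1 !DK //.
    by apply/intertwines_single => m; rewrite mulr1 mul1r.
  have H0 : intertwines_upto n.+1 (single (1 : A)) (D f ord0) (D g ord0) 1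
      (fun p => inalg p`_0 * (f n.+1 - g n.+1)).
    apply: intertwines_upto_single => m mn; rewrite mulr1 mul1r /D /=.
    rewrite (_ : (0 == r)%N = false) /=; last by lia.
    by case: eqP => [->//|/eqP ne]; rewrite fg ?subrr // -ltnS ltn_neqAle ne.
  have H := intertwines_upto_Kseries (fun j => uD f j uf) (fun j => uD g j ug)
    (fun j => @unipotent1 _) HK H0.
  have := intertwines_upto_Cseries d (fun j => uD f j uf) (fun j => uD g j ug)
    (fun j => @unipotent1 _) H.
  rewrite Cseries1 => /(_ 1 n.+1 (leqnn _)).
  rewrite /defect mulr1 eqxx s1E coef1 !rmorph1 !mul1r => <-.
  have -> : umbrals (single (1 : A)) 1 = 1.
    by apply/funext => -[|k]; rewrite /umbrals s1E ?raddf0 // umbral_single coef1 rmorph1 mul1r.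
  by rewrite mulr1 mul1r.
by exists (D f); split=> [j|i|] //; [exact: uD|exact: DK].
Qed.
End Existence.

(** The phi's by which D_k intertwines the currents E_j, and for [Ffactor] the
    F_j. *)
Definition Efactor (j : 'I_r) (k : 'I_r.+1) : series {poly K} := zratio 0 (cmat k j)%:~R.
Definition Ffactor (j : 'I_r) (k : 'I_r.+1) : series {poly K} := zratio (cmat k j)%:~R 0.

Lemma Kseries_Efactor j i :
  Kseries (Efactor j) i = zratio (cmat (Kden i) j)%:~R (cmat (Knum i) j)%:~R.
Proof. by rewrite /Kseries /Efactor zratioV zratioM. Qed.

Lemma Kseries_Ffactor j i :
  Kseries (Ffactor j) i = zratio (cmat (Knum i) j)%:~R (cmat (Kden i) j)%:~R.
Proof. by rewrite /Kseries /Ffactor zratioV mulrC zratioM. Qed.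

Lemma cmat_low (j : 'I_r) i : (i < r)%N -> cmat (inord i) j = alpha_coord r j i.
Proof.
by move=> ir; rewrite cmatE // inordK; [rewrite ltn_eqF | exact: ltnW].
Qed.

(** The shape that the product of C takes in all three cases below. *)
Lemma zratio_square a b c :
  zratio a b * zratio c b * (zratio b a * zratio b c) = 1 :> series {poly K}.
Proof. by rewrite mulrACA !zratioM !zratioxx mulr1. Qed.

(** Only the D_k with c_kj <> 0 contribute.  For j < r - 1 these are D_j and
    D_(j+1), whose factors in the product are inverse to each other because their
    arguments differ by 1.  For the two last nodes D_(r-1), D_r and D_(r+1)
    contribute, and the factor of D_(r-1) cancels the product of the others. *)
Lemma Cseries_Efactor j : Cseries (fun=> 0) (Efactor j) = 1.
Proof.
have jr := ltn_ord j; rewrite /Cseries.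
pose G (i : nat) : series {poly K} :=
  zratio (Cshift i) (Cshift i + (alpha_coord r j i)%:~R) *
  zratio (Cshift i + 1 + (alpha_coord r j i)%:~R) (Cshift i + 1).
have E (i : 'I_r.-1) : translate (Cshift i) 0 (Efactor j (inord i)) *
     sinv (translate (Cshift i + 1) 0 (Efactor j (inord i))) = G i.
  rewrite /Efactor !translate_zratio // zratioV !add0r !(addrC _%:~R) cmat_low //.
  by have := ltn_ord i; lia.
under eq_bigr => i _ do rewrite E.
have G1 i : alpha_coord r j i = 0 -> G i = 1.
  by rewrite /G => ->; rewrite !addr0 !zratioxx mulr1.
have Gp i : alpha_coord r j i = 1 -> G i = zratio (Cshift i) (Cshift i + 1) *
    zratio (Cshift i + 1 + 1) (Cshift i + 1) by rewrite /G => ->.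
have Gn i : alpha_coord r j i.+1 = - 1 -> G i.+1 = zratio (Cshift i + 1) (Cshift i) *
    zratio (Cshift i + 1) (Cshift i + 1 + 1).
  rewrite /G => ->; have -> : Cshift i.+1 = Cshift i + 1.
    by rewrite /Cshift -natr1 addrAC.
  by rewrite rmorphN1 !addrK.
have top : Cshift (r - 2) = - 1.
  rewrite /Cshift (_ : (r - 2).+1 = r.-1); last by lia.
  by rewrite -[in r%:R](@prednK r) ?natr1; [rewrite -natr1; ring | lia].
rewrite {1 2}/Efactor cmat_low; last by lia.
have -> : cmat (inord r) j = if j == r.-1 :> nat then - 1 else (j == r - 2 :> nat)%N%:Z.
  by rewrite cmatE // inordK // eqxx.
case: (ltnP j (r - 2)) => [jlt|jge].
  have j1 : (j < r.-1)%N by lia.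
  have j2 : (j.+1 < r.-1)%N by lia.
  rewrite (bigD1 (Ordinal j1)) //= (bigD1 (Ordinal j2)) /=; last first.
    by rewrite -val_eqE /=; lia.
  rewrite big1 => [|[i ir]]; last first.
    rewrite -!val_eqE /= => ij; apply: G1; rewrite /alpha_coord.
    by move: ij; case: (nat_of_ord j) jr jlt j1 j2 => *; node_cases.
  rewrite Gp; last by rewrite /alpha_coord; node_cases.
  rewrite Gn; last by rewrite /alpha_coord; node_cases.
  rewrite mulr1 zratio_square mul1r.
  have -> : alpha_coord r j (r - 1) = 0 by rewrite /alpha_coord; node_cases.
  rewrite (_ : (j == r.-1 :> nat) = false); last by lia.
  rewrite (_ : (j == r - 2 :> nat)%N = false); last by lia.
  by rewrite !zratioxx mulr1.
have j1 : (r - 2 < r.-1)%N by lia.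
rewrite (bigD1 (Ordinal j1)) //= big1 => [|[i ir]]; last first.
  by rewrite -!val_eqE /= => ij; apply: G1; rewrite /alpha_coord; node_cases.
rewrite mulr1 Gp; last by rewrite /alpha_coord; node_cases.
rewrite top addNr add0r.
case: (j =P r.-1 :> nat) => ej.
  have -> : alpha_coord r j (r - 1) = 1 by rewrite /alpha_coord; node_cases.
  by rewrite -mulrA [X in _ * X]mulrC zratio_square.
have -> : alpha_coord r j (r - 1) = - 1 by rewrite /alpha_coord; node_cases.
have -> : (j == r - 2 :> nat)%N by lia.
by rewrite -mulrA zratio_square.
Qed.

Lemma Cseries_mul_com (phi psi : 'I_r.+1 -> series {poly K}) :
    (forall k, unipotent (phi k)) -> (forall k, unipotent (psi k)) ->
  Cseries (fun=> 0) (fun k => phi k * psi k) =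
  Cseries (fun=> 0) phi * Cseries (fun=> 0) psi.
Proof.
move=> u1 u2; rewrite /Cseries [RHS]mulrACA; congr (_ * _).
rewrite [RHS]mulrACA; congr (_ * _); rewrite -big_split; apply: eq_bigr => i _ /=.
rewrite -{1 2}[0]addr0 !translateM // sinvM; try exact: unipotent_tr.
by rewrite [sinv _ * sinv _]mulrC mulrACA.
Qed.

(** The phi's of F_j are the inverses of those of E_j, and C is multiplicative in
    commuting arguments. *)
Lemma Cseries_Ffactor j : Cseries (fun=> 0) (Ffactor j) = 1.
Proof.
rewrite -[LHS]mulr1 -[X in _ * X](Cseries_Efactor j) -Cseries_mul_com; last 2 first.
- by move=> k; exact: unipotent_zratio.
- by move=> k; exact: unipotent_zratio.
rewrite -[RHS](Cseries1 {poly K}); congr Cseries; apply/funext => k.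
by rewrite /Efactor /Ffactor zratioM zratioxx.
Qed.
End CartanSystem.

(** * Current relations *)

Section Currents.
Variables (K : fieldType) (char0 : forall n, n.+1%:R != 0 :> K).
Variable A : pzAlgType K.
Implicit Types (e f : nat -> A) (a b s t : K) (p q : {poly K}).
Local Notation br := (@bracket K A).

(** (z - w) [e(z), f(w)] = a e(z) f(w) + b f(w) e(z) modulo terms constant in z
    or in w. *)
Definition current e f a b := forall m n,
  br (e m.+1) (f n) - br (e m) (f n.+1) =
  inalg a * (e m * f n) + inalg b * (f n * e m).

Lemma poly_linear_brl x F : poly_linear F -> poly_linear (fun p => br x (F p)).
Proof. by move=> lF; apply: poly_linearB; [exact: poly_linearMl|exact: poly_linearMr]. Qed.

Lemma poly_linear_brr x F : poly_linear F -> poly_linear (fun p => br (F p) x).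
Proof. by move=> lF; apply: poly_linearB; [exact: poly_linearMr|exact: poly_linearMl]. Qed.

Lemma current_poly e f a b : current e f a b -> forall p q,
  br (umbral e ('X * p)) (umbral f q) - br (umbral e p) (umbral f ('X * q)) =
  inalg a * (umbral e p * umbral f q) + inalg b * (umbral f q * umbral e p).
Proof.
move=> H p q; have le := umbral_linear e; have lf := umbral_linear f.
have lXe := poly_linearMp 'X le; have lXf := poly_linearMp 'X lf.
move: p; apply: poly_linear_ext => [||m].
- by apply: poly_linearB; exact: poly_linear_brr.
- apply: poly_linearD; apply: poly_linearMl; first exact: poly_linearMr.
  exact: poly_linearMl.
move: q; apply: poly_linear_ext => [||n].
- by apply: poly_linearB; exact: poly_linear_brl.
- apply: poly_linearD; apply: poly_linearMl; first exact: poly_linearMl.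
  exact: poly_linearMr.
by rewrite -!exprS !umbralXn; exact: H.
Qed.

(** In e(z + s) f(w + t) the factor z - w becomes z - w + s - t, so the multiple
    t - s of the commutator moves to the right-hand side. *)
Lemma current_shift e f a b s t : current e f a b ->
  current (translate s 1 e) (translate t 1 f) (a + (t - s)) (b - (t - s)).
Proof.
move=> /current_poly H m n; rewrite !translate_shift // !exprS.
have := H (('X - s%:P) ^+ m) (('X - t%:P) ^+ n).
move: (('X - s%:P) ^+ m) (('X - t%:P) ^+ n) => p q {}H.
have evB x c h : umbral h (('X - c%:P) * x) = umbral h ('X * x) - inalg c * umbral h x.
  by rewrite mulrBl raddfB /= umbralC.
rewrite !evB.
have -> : br (umbral e ('X * p) - inalg s * umbral e p) (umbral f q) -
    br (umbral e p) (umbral f ('X * q) - inalg t * umbral f q) =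
    br (umbral e ('X * p)) (umbral f q) - br (umbral e p) (umbral f ('X * q)) +
    inalg (t - s) * br (umbral e p) (umbral f q).
  rewrite rmorphB /= /bracket.
  move: (umbral e ('X * p)) (umbral e p) (umbral f ('X * q)) (umbral f q) => X x Y y.
  transitivity (X * y - y * X - (x * Y - Y * x) - inalg s * (x * y) +
    y * (inalg s * x) + x * (inalg t * y) - inalg t * (y * x)); first by ncring.
  by rewrite (mulrA y) (mulrA x (inalg t)) -!inalg_central; ncring.
by rewrite H /bracket !(rmorphD, rmorphN) /=; ncring.
Qed.

Lemma current_sym e f a b : current e f a b -> current f e b a.
Proof.
move=> H m n; rewrite addrC [RHS]addrC -H /bracket.
by ncring.
Qed.

(** The Serre relations for a_ij = 0 and for a_ij = -1. *)
Definition serre_comm e f := forall m n, br (e m) (f n) = 0.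
Definition serre_cubic e f := forall m1 m2 n,
  br (e m1) (br (e m2) (f n)) + br (e m2) (br (e m1) (f n)) = 0.

Lemma serre_comm_poly e f : serre_comm e f -> forall p q, br (umbral e p) (umbral f q) = 0.
Proof.
move=> H p q; have le := umbral_linear e; have lf := umbral_linear f.
move: p; apply: poly_linear_ext; [exact: poly_linear_brr | exact: poly_linear0 |] => m.
move: q; apply: poly_linear_ext; [exact: poly_linear_brl | exact: poly_linear0 |] => n.
by rewrite !umbralXn H.
Qed.

Lemma serre_cubic_poly e f : serre_cubic e f -> forall p p' q,
  br (umbral e p) (br (umbral e p') (umbral f q)) +
  br (umbral e p') (br (umbral e p) (umbral f q)) = 0.
Proof.
move=> H p p' q; have le := umbral_linear e; have lf := umbral_linear f.
move: p; apply: poly_linear_ext; [|exact: poly_linear0|] => [|m].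
  apply: poly_linearD; [exact: poly_linear_brr | apply: poly_linear_brl; exact: poly_linear_brr].
move: p'; apply: poly_linear_ext; [|exact: poly_linear0|] => [|m'].
  apply: poly_linearD; [apply: poly_linear_brl; exact: poly_linear_brr | exact: poly_linear_brr].
move: q; apply: poly_linear_ext; [|exact: poly_linear0|] => [|n].
  by apply: poly_linearD; do 2!apply: poly_linear_brl.
by rewrite !umbralXn H.
Qed.

Lemma serre_comm_shift e f s t : serre_comm e f ->
  serre_comm (translate s 1 e) (translate t 1 f).
Proof. by move=> H m n; rewrite !translate_shift // serre_comm_poly. Qed.

Lemma serre_cubic_shift e f s t : serre_cubic e f ->
  serre_cubic (translate s 1 e) (translate t 1 f).
Proof. by move=> H m m' n; rewrite !translate_shift // serre_cubic_poly. Qed.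

Lemma current0_serre_comm e f a b : serre_comm e f -> a + b = 0 -> current e f a b.
Proof.
move=> H ab m n; rewrite !H subrr.
have /subr0_eq -> := H m n.
by rewrite -mulrDl -rmorphD ab rmorph0 mul0r.
Qed.

(** Both sides are values of functions linear in p = (X - s)^m and
    q = (X - s)^n, and the right-hand side depends on the product p q only. *)
Lemma ef_shift e f (k : lser A) s :
    (forall m n, br (e m) (f n) = coef k (m + n).+1%:Z) ->
  forall m n, br (translate s 1 e m) (translate s 1 f n) = coef (ltranslate s k) (m + n).+1%:Z.
Proof.
move=> H m n; rewrite !translate_shift // coef_tr_tail // exprD.
have le := umbral_linear e; have lf := umbral_linear f.
have lk := umbral_linear (fun m => coef k m.+1%:Z).
move: (_ ^+ m) (_ ^+ n) => p q.
move: p; apply: poly_linear_ext => [||i]; first exact: poly_linear_brr.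
  rewrite (_ : (fun p => _) = fun p => umbral (fun m => coef k m.+1%:Z) (q * p)).
    exact: poly_linearMp.
  by apply/funext => p; rewrite mulrC.
move: q; apply: poly_linear_ext => [||j]; [exact: poly_linear_brl|exact: poly_linearMp|].
by rewrite -exprD !umbralXn H.
Qed.

End Currents.

(** * The relations of X in coefficients *)

Section Coef.
Variables (K : fieldType) (A : pzAlgType K).
Implicit Types (e f : nat -> A).

Lemma coef_nat v f n : coef (LSer v f) (v + n%:Z) = f n.
Proof. by rewrite /coef /= lerDl le0z_nat addrC addKr. Qed.

Lemma coef_lt (F : lser A) k : k < lval F -> coef F k = 0.
Proof. by rewrite /coef leNgt => ->. Qed.

(** The index k of a coefficient of a series of valuation v either lies at
    distance n from v or names a vanishing coefficient. *)
Variant int_from_spec (v k : int) : Prop :=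
| IntFrom n of k = v + n%:Z | IntBelow of k < v.

Lemma int_fromP v k : int_from_spec v k.
Proof.
case: (ltP k v) => [|vk]; first by right.
by left with `|k - v|%N; lia.
Qed.

Lemma coefS e n : coef (LSer 1 e) n.+1%:Z = e n.
Proof. by rewrite -add1n PoszD coef_nat. Qed.
Lemma coefSS e n : coef (LSer 1 e) (n.+1%:Z + 1) = e n.+1.
Proof. by rewrite -PoszD addn1 coefS. Qed.
Lemma coef0z e : coef (LSer 1 e) 0 = 0. Proof. exact: coef_lt. Qed.
Lemma coef01 e : coef (LSer 1 e) (0 + 1) = e 0%N. Proof. exact: coefS. Qed.
Lemma coefNz e n : coef (LSer 1 e) (Negz n) = 0. Proof. exact: coef_lt. Qed.
Lemma coefN1 e n : coef (LSer 1 e) (Negz n + 1) = 0.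
Proof. by apply: coef_lt => /=; lia. Qed.
(** Coefficients of a series of valuation 1, at indices k and k + 1 as produced by
    case analysis on k; the rules with k + 1 come first because k + 1 also
    matches a successor up to conversion. *)
Definition coefz := (coefSS, coef01, coefN1, coefS, coef0z, coefNz).

Lemma br0r (x : A) : bracket x 0 = 0. Proof. by rewrite /bracket mulr0 mul0r subrr. Qed.
Lemma br0l (x : A) : bracket 0 x = 0. Proof. by rewrite /bracket mulr0 mul0r subrr. Qed.
Lemma br1l (x : A) : bracket 1 x = 0. Proof. by rewrite /bracket mulr1 mul1r subrr. Qed.

Lemma coef_ltail m (F : lser A) k : coef (ltail m F) k = if m%:Z <= k then coef F k else 0.
Proof.
case: (int_fromP m%:Z k) => [n -> | km]; last by rewrite coef_lt // leNgt km.
by rewrite coef_nat lerDl le0z_nat PoszD.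
Qed.

Lemma serre_1 (x : 'I_1 -> A) y : serre x y = bracket (x ord0) y.
Proof.
rewrite /serre (big_pred1 (1%g : 'S_1)) => [|s]; last by apply/esym/eqP/permP => i; rewrite !ord1.
by rewrite enum_ordSl /= perm1 (enum_ord0).
Qed.

(** The two permutations of two elements. *)
Lemma serre_2 (x : 'I_2 -> A) y : serre x y =
  bracket (x ord0) (bracket (x ord_max) y) + bracket (x ord_max) (bracket (x ord0) y).
Proof.
have o1 : lift ord0 ord0 = ord_max :> 'I_2 by exact: val_inj.
rewrite /serre (bigD1 (1%g : 'S_2)) //= (big_pred1 (tperm ord0 ord_max : 'S_2)) => [|s].
  have -> : enum 'I_2 = [:: ord0; ord_max] by rewrite !enum_ordSl enum_ord0 /= o1.
  by rewrite /= !perm1 tpermL tpermR.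
rewrite /=; apply/idP/eqP => [s1|->]; last first.
  apply/eqP => /permP/(_ ord0); rewrite tpermL perm1 => /eqP.
  by rewrite -val_eqE.
have I2 (i : 'I_2) : i = ord0 \/ i = ord_max.
  by case: i => -[|[|]] // ?; [left|right]; exact: val_inj.
apply/permP => i; have [s0|s0] := I2 (s ord0).
  case/eqP: s1; apply/permP => k; rewrite perm1.
  have [->//|->] := I2 k; have [sm|//] := I2 (s ord_max).
  by have /perm_inj/(congr1 val) : s ord_max = s ord0 by rewrite sm s0.
have [->|->] := I2 i; first by rewrite tpermL.
rewrite tpermR; have [//|sm] := I2 (s ord_max).
by have /perm_inj/(congr1 val) : s ord_max = s ord0 by rewrite sm s0.
Qed.
End Coef.

Section SerreRel.
Variables (K : fieldType) (A : pzAlgType K) (r : nat) (hr : (3 <= r)%N).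
Implicit Types (e f : nat -> A).

Definition serre_nodes (i j : 'I_r) e f :=
  if cartan i j == 0 then serre_comm e f else serre_cubic e f.

(** Generators of index k < 1 are zero, which settles the terms outside the range
    of the generators. *)
Lemma serre_nodes_rel i j e f : i != j -> serre_nodes i j e f ->
  forall (k : 'I_(serre_deg i j) -> int) l,
    serre (fun t => coef (LSer 1 e) (k t)) (coef (LSer 1 f) l) = 0.
Proof.
move=> ij; rewrite /serre_nodes /serre_deg.
have [->|->] := cartan_offdiag hr ij; rewrite /= => H k l.
  rewrite serre_1; case: (k ord0) => [[|m]|m]; rewrite !coefz ?br0l //.
  by case: l => [[|n]|n]; rewrite !coefz ?br0r.
rewrite serre_2.
case: (k ord0) => [[|m]|m]; rewrite !coefz ?br0l ?br0r ?addr0 //.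
case: (k ord_max) => [[|m']|m']; rewrite !coefz ?br0l ?br0r ?addr0 //.
by case: l => [[|n]|n]; rewrite !coefz ?br0r ?addr0 //; exact: H.
Qed.

Lemma serre_rel_nodes i j e f : i != j ->
  (forall (k : 'I_(serre_deg i j) -> int) l, (forall t, 1 <= k t) -> 1 <= l ->
    serre (fun t => coef (LSer 1 e) (k t)) (coef (LSer 1 f) l) = 0) ->
  serre_nodes i j e f.
Proof.
move=> ij; rewrite /serre_nodes /serre_deg.
have [->|->] := cartan_offdiag hr ij; rewrite /= => H.
  move=> m n.
  by have := H (fun=> m.+1%:Z) n.+1%:Z; rewrite serre_1 !coefz; apply.
move=> m1 m2 n.
have := H (fun t => if t == ord0 then m1.+1%:Z else m2.+1%:Z) n.+1%:Z.
by rewrite serre_2 /= !coefz; apply=> // t; case: ifP.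
Qed.
End SerreRel.

Section DE.
Variables (K : fieldType) (A : pzAlgType K).
Implicit Types (e f : nat -> A) (D : series A).

Lemma inalg_mulz (c : int) (x : A) : inalg (c%:~R : K) * x = x *~ c.
Proof. by rewrite rmorph_int mulrzl. Qed.

Lemma move_terms (a z Y V W : A) :
  (a - (Y - W) = z - V) <-> ((a - z) - (Y - V) = - W).
Proof.
split=> E.
  transitivity ((a - (Y - W) - (z - V)) - W); first by ncring.
  by rewrite E; ncring.
transitivity ((a - z) - (Y - V) + W + (z - V)); first by ncring.
by rewrite E; ncring.
Qed.

Lemma move_terms2 (a z Y V W : A) :
  (a - Y = z - (V - W)) <-> ((a - z) - (Y - V) = W).
Proof.
split=> E.
  transitivity ((a - Y) - z + V); first by ncring.
  by rewrite E; ncring.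
transitivity ((a - z) - (Y - V) + z - V); first by ncring.
by rewrite E; ncring.
Qed.

Lemma intertwinesE e D (c : int) : unipotent D ->
  intertwines e D D (zratio 0 (c%:~R)) <->
  forall k n, bracket (D k.+1) (e n) - bracket (D k) (e n.+1) = - (D k * e n *~ c).
Proof.
move=> uD; rewrite (intertwines_zratioP _ _ _ uD) /bracket.
have mE k n : D k * (inalg (c%:~R : K) * e n) = D k * e n *~ c.
  by rewrite inalg_mulz mulrzAr.
split=> H k n; have := H k n; rewrite rmorph0 mul0r subr0 mulrBr mE.
  by move/move_terms.
by move=> E; apply/move_terms.
Qed.

Lemma intertwinesF e D (c : int) : unipotent D ->
  intertwines e D D (zratio (c%:~R) 0) <->
  forall k n, bracket (D k.+1) (e n) - bracket (D k) (e n.+1) = e n * D k *~ c.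
Proof.
move=> uD; rewrite (intertwines_zratioP _ _ _ uD) /bracket.
have mE k n : inalg (c%:~R : K) * e n * D k = e n * D k *~ c.
  by rewrite inalg_mulz mulrzAl.
split=> H k n; have := H k n; rewrite rmorph0 mul0r subr0 mulrBl mE.
  by move/move_terms2.
by move=> E; apply/move_terms2.
Qed.

(** The relation expresses [D_(k+1), e_n] through [D_k, e_(n+1)]; iterating down
    to D_0 = 1 gives the closed form, which is the relation at w^0. *)
Lemma unrollE e D (c : int) : unipotent D ->
    (forall k n, bracket (D k.+1) (e n) - bracket (D k) (e n.+1) = - (D k * e n *~ c)) ->
  forall k n, bracket (D k.+1) (e n) = - (\sum_(i < k.+1) D i * e (n + (k - i))%N *~ c).
Proof.
move=> uD H; elim=> [|k IH] n.
  by rewrite big_ord1 addn0 -H uD br1l subr0.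
rewrite big_ord_recr /= subnn addn0 opprD -H.
under eq_bigr => i _ do rewrite (subSn (leq_ord i)) addnS -addSn.
by rewrite -IH; ncring.
Qed.

Lemma unrollF e D (c : int) : unipotent D ->
    (forall k n, bracket (D k.+1) (e n) - bracket (D k) (e n.+1) = e n * D k *~ c) ->
  forall k n, bracket (D k.+1) (e n) = \sum_(i < k.+1) e (n + (k - i))%N * D i *~ c.
Proof.
move=> uD H; elim=> [|k IH] n.
  by rewrite big_ord1 addn0 -H uD br1l subr0.
rewrite big_ord_recr /= subnn addn0 -H.
under eq_bigr => i _ do rewrite (subSn (leq_ord i)) addnS -addSn.
by rewrite -IH; ncring.
Qed.

(** At w^(- l) with l > 0 the relation is the coefficient form of the
    intertwining relation; at w^0 it is [unrollE]. *)
Lemma rel_DE v e D (c : int) : unipotent D ->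
  (forall k l, mulzw (br2 (LSer v D) (LSer 1 e)) k l =
     (inz (lmul (LSer v D) (LSer 1 e)) k l
       - prod_zw (LSer v D) (LSer 1 e) k l) *~ c) <->
  intertwines e D D (zratio 0 (c%:~R)).
Proof.
move=> uD; rewrite intertwinesE //; split=> H.
  move=> k n; have := H (v + k%:Z) n.+1%:Z.
  rewrite /mulzw /mulz /mulw /br2 /inz /prod_zw /= sub0r mulNrz.
  by rewrite !coefz -(addrA v) -PoszD addn1 !coef_nat.
have {}U := unrollE uD H.
move=> k l; rewrite /mulzw /mulz /mulw /br2 /inz /prod_zw.
case: l => [[|n]|n]; rewrite !coefz ?br0r ?mulr0 ?subr0 ?sub0r ?mul0rz //=.
  case: (int_fromP v k) => [m ->|kv]; last first.
    by rewrite !coef_lt ?br0l ?oppr0 ?mul0rz //=; lia.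
  case: m => [|m].
    by rewrite coef_nat uD br1l oppr0 coef_lt ?mul0rz //= addr0 ltrDl.
  rewrite coef_nat U opprK (_ : v + m.+1%:Z = v + 1 + m%:Z) ?coef_nat; last by lia.
  by rewrite mulrz_suml; apply: eq_bigr => i _; rewrite add0n.
case: (int_fromP (v - 1) k) => [m ->|kv]; last first.
  by rewrite !coef_lt ?br0l ?mul0r ?subrr ?oppr0 ?mul0rz //=; lia.
case: m => [|m].
  have -> : v - 1 + 0%:Z + 1 = v + 0%:Z by lia.
  by rewrite coef_nat uD br1l coef_lt ?br0l ?mul0r ?subrr ?oppr0 ?mul0rz //=; lia.
have -> : v - 1 + m.+1%:Z = v + m%:Z by lia.
by rewrite -(addrA v) -PoszD addn1 !coef_nat H mulNrz.
Qed.

Lemma rel_DF v e D (c : int) : unipotent D ->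
  (forall k l, mulzw (br2 (LSer v D) (LSer 1 e)) k l =
     - ((inz (lmul (LSer 1 e) (LSer v D)) k l
       - prod_wz (LSer v D) (LSer 1 e) k l) *~ c)) <->
  intertwines e D D (zratio (c%:~R) 0).
Proof.
move=> uD; rewrite intertwinesF //; split=> H.
  move=> k n; have := H (v + k%:Z) n.+1%:Z.
  rewrite /mulzw /mulz /mulw /br2 /inz /prod_wz /= sub0r mulNrz opprK.
  by rewrite !coefz -(addrA v) -PoszD addn1 !coef_nat.
have {}U := unrollF uD H.
move=> k l; rewrite /mulzw /mulz /mulw /br2 /inz /prod_wz.
case: l => [[|n]|n]; rewrite !coefz ?br0r ?mul0r ?subr0 ?sub0r ?mul0rz ?oppr0 //=.
  case: (int_fromP v k) => [m ->|kv]; last first.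
    by rewrite !coef_lt ?br0l ?oppr0 ?mul0rz ?oppr0 //=; lia.
  case: m => [|m].
    by rewrite coef_nat uD br1l oppr0 coef_lt ?mul0rz ?oppr0 //= addr0 ltrDr.
  rewrite coef_nat U (_ : v + m.+1%:Z = 1 + v + m%:Z) ?coef_nat; last by lia.
  congr (- _); rewrite mulrz_suml (reindex_inj rev_ord_inj) /=.
  by apply: eq_bigr => i _; rewrite add0n subSS subKn ?leq_ord.
case: (int_fromP (v - 1) k) => [m ->|kv]; last first.
  by rewrite !coef_lt ?br0l ?mulr0 ?subrr ?oppr0 ?mul0rz ?oppr0 //=; lia.
case: m => [|m].
  have -> : v - 1 + 0%:Z + 1 = v + 0%:Z by lia.
  rewrite coef_nat uD br1l coef_lt ?br0l ?mulr0 ?subrr ?oppr0 ?mul0rz ?oppr0 //=.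
  by lia.
have -> : v - 1 + m.+1%:Z = v + m%:Z by lia.
by rewrite -(addrA v) -PoszD addn1 !coef_nat H mulNrz opprK.
Qed.

(** Summing the relations for e_i e_(m - i) telescopes to
    [e_(m+1), e_0] - [e_0, e_(m+1)], twice the left-hand side. *)
Lemma current_self_unroll e (a : K) :
    (forall n, n.+1%:R != 0 :> K) ->
    current e e a a ->
  forall m, bracket (e m.+1) (e 0%N) = inalg a * \sum_(i < m.+1) e i * e (m - i)%N.
Proof.
move=> char0 H m; apply/subr0_eq/(double_eq0 char0).
pose G (i : nat) := bracket (e i) (e (m.+1 - i)%N).
have T : \sum_(i < m.+1) (G i.+1 - G i) = G m.+1 - G 0%N.
  by rewrite -(big_mkord xpredT (fun i => G i.+1 - G i)) telescope_sumr.
have S : \sum_(i < m.+1) (G i.+1 - G i) =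
    inalg a * \sum_(i < m.+1) e i * e (m - i)%N +
    inalg a * \sum_(i < m.+1) e i * e (m - i)%N.
  rewrite [X in _ + _ * X](reindex_inj rev_ord_inj) /= -mulrDr -big_split /= mulr_sumr.
  apply: eq_bigr => i _; rewrite /G subSS (subSn (leq_ord i)) H mulrDr.
  by rewrite subKn ?leq_ord.
have GN : G 0%N = - G m.+1 by rewrite /G subnn subn0 /bracket; ncring.
rewrite GN in T; move: S; rewrite T /G subnn.
by move: (bracket _ _) (inalg a * _) => x y E; rewrite -[RHS](subrr (y + y)) -{1}E; ncring.
Qed.

(** At z^0 or w^0 the relation is [current_self_unroll]. *)
Lemma rel_EE e (a : int) : (forall n, n.+1%:R != 0 :> K) ->
  (forall k l, mulzw (br2 (LSer 1 e) (LSer 1 e)) k l =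
     - ((inz (lmul (LSer 1 e) (LSer 1 e)) k l - prod_zw (LSer 1 e) (LSer 1 e) k l
       - prod_wz (LSer 1 e) (LSer 1 e) k l + inw (lmul (LSer 1 e) (LSer 1 e)) k l) *~ a))
  <-> current e e (a%:~R) (a%:~R).
Proof.
move=> char0; split=> H.
  move=> m n; have := H m.+1%:Z n.+1%:Z.
  rewrite /mulzw /mulz /mulw /br2 /inz /inw /prod_zw /prod_wz !coefz /= => ->.
  by rewrite !inalg_mulz -mulrzDl -mulNrz; congr (_ *~ a); ncring.
have U := current_self_unroll char0 H.
have L (m : nat) : coef (lmul (LSer 1 e) (LSer 1 e)) m.+1%:Z =
    if m is m'.+1 then \sum_(i < m'.+1) e i * e (m' - i)%N else 0.
  case: m => [|m]; first exact: coef_lt.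
  by rewrite (_ : m.+2%:Z = 1 + 1 + m%:Z) ?coef_nat.
have U0 m : bracket (e m) (e 0%N) = coef (lmul (LSer 1 e) (LSer 1 e)) m.+1%:Z *~ a.
  case: m => [|m]; rewrite L; first by rewrite /bracket subrr mul0rz.
  by rewrite U inalg_mulz.
move=> k l; rewrite /mulzw /mulz /mulw /br2 /inz /inw /prod_zw /prod_wz.
case: k => [[|m]|m]; case: l => [[|n]|n];
  rewrite !coefz ?br0l ?br0r ?mulr0 ?mul0r ?subr0 ?sub0r ?addr0 ?add0r ?mul0rz ?oppr0 //=.
- by rewrite -U0 /bracket opprB.
- by rewrite -U0.
- rewrite H !inalg_mulz -mulrzDl -mulNrz; congr (_ *~ a); ncring.
Qed.
End DE.

Section EFRel.
Variables (K : fieldType) (A : pzAlgType K).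
Implicit Types (e f : nat -> A).

Lemma rel_EF e f (k : lser A) (c : bool) :
  (forall i j, mulzw (br2 (LSer 1 e) (LSer 1 f)) i j =
     - ((inz (ltail 1 k) i j - inw (ltail 1 k) i j) *+ c)) <->
  forall m n, bracket (e m) (f n) = coef k (m + n).+1%:Z *+ c.
Proof.
split=> H.
  move=> m n; elim: n m => [|n IH] m.
    have := H m.+1%:Z 0; rewrite /mulzw /mulz /mulw /br2 /inz /inw !coef_ltail !coefz /=.
    by rewrite br0r sub0r subr0 /= addn0 => /oppr_inj.
  have := H m.+1%:Z n.+1%:Z; rewrite /mulzw /mulz /mulw /br2 /inz /inw !coefz /=.
  by rewrite subr0 mul0rn oppr0 => /subr0_eq <-; rewrite IH addSnnS.
move=> i j; rewrite /mulzw /mulz /mulw /br2 /inz /inw !coef_ltail.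
case: i => [[|m]|m]; case: j => [[|n]|n];
  rewrite !coefz ?br0l ?br0r ?subr0 ?sub0r ?mul0rn ?oppr0 //=.
- by rewrite H mulNrn opprK.
- by rewrite H addn0.
by rewrite !H addSnnS subrr.
Qed.

Lemma rel_EEij e f (a : int) :
  (forall k l, mulz (br2 (ltail 2 (LSer 1 e)) (LSer 1 f)) k l
          - mulw (br2 (LSer 1 e) (ltail 2 (LSer 1 f))) k l =
         prod_zw (LSer 1 e) (LSer 1 f) k l *~ a) <-> current e f (a%:~R) 0.
Proof.
split=> H.
  move=> m n; have := H m.+1%:Z n.+1%:Z.
  rewrite /mulz /mulw /br2 /prod_zw !coef_ltail !coefz -!PoszD !addn1 /= => ->.
  by rewrite inalg_mulz rmorph0 mul0r addr0.
move=> k l; rewrite /mulz /mulw /br2 /prod_zw !coef_ltail.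
case: k => [[|m]|m]; case: l => [[|n]|n];
  rewrite !coefz ?if_same ?br0l ?br0r ?mulr0 ?mul0r ?subr0 ?mul0rz //=.
have -> : (2%:Z <= m.+1%:Z + 1) by lia.
have -> : (2%:Z <= n.+1%:Z + 1) by lia.
by rewrite H inalg_mulz rmorph0 mul0r addr0.
Qed.

Lemma rel_FFij e f (a : int) :
  (forall k l, mulz (br2 (ltail 2 (LSer 1 e)) (LSer 1 f)) k l
          - mulw (br2 (LSer 1 e) (ltail 2 (LSer 1 f))) k l =
         - (prod_wz (LSer 1 e) (LSer 1 f) k l *~ a)) <-> current e f 0 (- a%:~R).
Proof.
split=> H.
  move=> m n; have := H m.+1%:Z n.+1%:Z.
  rewrite /mulz /mulw /br2 /prod_wz !coef_ltail !coefz -!PoszD !addn1 /= => ->.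
  by rewrite -rmorphN /= inalg_mulz rmorph0 mul0r add0r mulrNz.
move=> k l; rewrite /mulz /mulw /br2 /prod_wz !coef_ltail.
case: k => [[|m]|m]; case: l => [[|n]|n];
  rewrite !coefz ?if_same ?br0l ?br0r ?mulr0 ?mul0r ?subr0 ?mul0rz ?oppr0 //=.
have -> : (2%:Z <= m.+1%:Z + 1) by lia.
have -> : (2%:Z <= n.+1%:Z + 1) by lia.
by rewrite H -rmorphN /= inalg_mulz rmorph0 mul0r add0r mulrNz.
Qed.
End EFRel.

Section XNormal.
Variables (K : fieldType) (char0 : forall n, n.+1%:R != 0 :> K).
Variables (r : nat) (hr : (3 <= r)%N) (mu : 'rV[int]_r.+1).
Variables (A : pzAlgType K) (g : xgen r -> A).

Definition Xsat := forall x y, Xrel mu g x y -> x = y.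

Definition xe j : nat -> A := fun n => g (XE j n).
Definition xf j : nat -> A := fun n => g (XF j n).
Definition xd j : series A := lcf (Xd mu g j).

Lemma unipotent_xd j : unipotent (xd j). Proof. by []. Qed.

(** The relations of X on the generators, without reference to series in two
    variables. *)
Record Xnormal : Prop := {
  xn_dd : forall i j m n, xd i m * xd j n = xd j n * xd i m;
  xn_ef : forall i j m n,
    bracket (xe i m) (xf j n) = coef (Xk mu g i) (m + n).+1%:Z *+ (i == j);
  xn_de : forall k j, intertwines (xe j) (xd k) (xd k) (Efactor K j k);
  xn_df : forall k j, intertwines (xf j) (xd k) (xd k) (Ffactor K j k);
  xn_ee : forall i, current (xe i) (xe i) 1 1;
  xn_ff : forall i, current (xf i) (xf i) (- 1) (- 1);
  xn_eeij : forall i j : 'I_r, (i < j)%N -> current (xe i) (xe j) (cartan i j)%:~R 0;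
  xn_ffij : forall i j : 'I_r, (i < j)%N -> current (xf i) (xf j) 0 (- (cartan i j)%:~R);
  xn_se : forall i j, i != j -> serre_nodes i j (xe i) (xe j);
  xn_sf : forall i j, i != j -> serre_nodes i j (xf i) (xf j) }.

Lemma lcf_Xk i : lcf (Xk mu g i) = Kseries xd i.
Proof. by rewrite /Xk /Kseries /Kden /Knum; case: ifP. Qed.

Lemma lval_Xk i : lval (Xk mu g i) = - mubar mu i.
Proof. by rewrite mubarE /Kden /Knum /Xk; case: ifP => _ /=; rewrite opprB addrC. Qed.

(** K_i(z) has the valuation of H_i(z) in Y. *)
Lemma Xk_LSer i : Xk mu g i = LSer (- mubar mu i) (Kseries xd i).
Proof. by rewrite -lcf_Xk -lval_Xk; case: (Xk mu g i). Qed.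

Lemma Xc_LSer : Xc mu g =
  LSer (dmu mu (inord (r - 1)) + dmu mu (inord r)) (Cseries (dmu mu) xd).
Proof.
rewrite /Xc; set B := \big[_/_]_(i < _) _.
have Bv : lval B = 0.
  rewrite /B; elim/big_ind: _ => [||i _] //=; last by rewrite addrN.
  by move=> x y /= -> ->; rewrite addr0.
have Bc : lcf B = \prod_(i < r.-1) (translate (Cshift K r i) (dmu mu (inord i)) (xd (inord i)) *
     sinv (translate (Cshift K r i + 1) (dmu mu (inord i)) (xd (inord i)))).
  by rewrite /B; elim/big_ind2: _ => // x1 x2 y1 y2 /= <- <-.
by rewrite {1}/lmul /= Bv add0r Bc.
Qed.

Lemma Xsat_normal : Xsat <-> Xnormal.
Proof.
split=> [H|[dd ef de df ee ff eeij ffij se sf]].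
  split.
  - move=> i j m n; apply/subr0_eq.
    have := H _ _ (Xrel_DD mu g i j (dmu mu i + m%:Z) (dmu mu j + n%:Z)).
    by rewrite /br2 !coef_nat.
  - by move=> i j; apply/rel_EF => k l; exact/H/Xrel_EF.
  - by move=> k j; apply/(rel_DE (dmu mu k)) => // *; exact/H/Xrel_DE.
  - by move=> k j; apply/(rel_DF (dmu mu k)) => // *; exact/H/Xrel_DF.
  - move=> i; apply/(@rel_EE _ _ (xe i) 1) => // *; rewrite mulr1z.
    exact/H/Xrel_EE.
  - move=> i; have := @rel_EE _ _ (xf i) (- 1) char0; rewrite rmorphN1 => -[+ _].
    apply=> k l; rewrite mulrN1z opprK; exact/H/Xrel_FF.
  - by move=> i j ij; apply/rel_EEij => *; exact/H/Xrel_EEij.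
  - by move=> i j ij; apply/rel_FFij => *; exact/H/Xrel_FFij.
  - move=> i j ij; apply: serre_rel_nodes => // k l _ _.
    exact/H/Xrel_serreE.
  - move=> i j ij; apply: serre_rel_nodes => // k l _ _.
    exact/H/Xrel_serreF.
move=> x y; case=> {x y}.
- move=> i j k l; rewrite /br2.
  case: (int_fromP (dmu mu i) k) => [m ->|lt]; last by rewrite coef_lt // br0l.
  case: (int_fromP (dmu mu j) l) => [n ->|lt]; last by rewrite [X in bracket _ X]coef_lt // br0r.
  by rewrite !coef_nat /bracket [X in X - _]dd subrr.
- by move=> i j k l; move: k l; apply/rel_EF; exact: ef.
- by move=> i j k l; move: k l; apply/rel_DE => //; exact: de.
- by move=> i j k l; move: k l; apply/rel_DF => //; exact: df.
- move=> i k l; rewrite -[X in - X]mulr1z; move: k l; apply/rel_EE => //; exact: ee.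
- move=> i k l; have := @rel_EE _ _ (xf i) (- 1) char0; rewrite rmorphN1 => -[_ /(_ (ff i))].
  by move=> /(_ k l) ->; rewrite mulrN1z opprK.
- by move=> i j k l ij; move: k l; apply/rel_EEij; exact: eeij.
- by move=> i j k l ij; move: k l; apply/rel_FFij; exact: ffij.
- by move=> i j k l ij; apply: serre_nodes_rel => //; exact: se.
- by move=> i j k l ij; apply: serre_nodes_rel => //; exact: sf.
Qed.
End XNormal.

(** * The relations of Y in coefficients *)

Section YRel.
Variables (K : fieldType) (A : pzAlgType K).
Implicit Types (e f : nat -> A) (D : series A).

(** The symmetric relation of H_i(z) with E_j(w) in Y, h = a_ij / 2. *)
Lemma intertwines_half e D (h : K) : unipotent D ->
  intertwines e D D (zratio h (- h)) <->
  forall k n, bracket (D k.+1) (e n) - bracket (D k) (e n.+1) =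
    inalg h * (D k * e n + e n * D k).
Proof.
move=> uD; rewrite (intertwines_zratioP _ _ _ uD) /bracket.
split=> H k n; have := H k n; rewrite rmorphN mulNr opprK !mulrDr mulrBl.
  rewrite (mulrA (D k) (inalg h)) -inalg_central -mulrA => E.
  transitivity ((D k.+1 * e n - (D k * e n.+1 + inalg h * (D k * e n))) -
    (e n * D k.+1 - (e n.+1 * D k - inalg h * e n * D k)) +
    (inalg h * (D k * e n) + inalg h * e n * D k)); first by ncring.
  by rewrite E; ncring.
move=> E; rewrite (mulrA (D k) (inalg h)) -inalg_central -mulrA.
transitivity ((D k.+1 * e n - e n * D k.+1 - (D k * e n.+1 - e n.+1 * D k)) +
  e n * D k.+1 - e n.+1 * D k - inalg h * (D k * e n)); first by ncring.
by rewrite E; ncring.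
Qed.

Lemma rel_HE v e D (h : K) : unipotent D ->
  (forall k l, 1 <= l ->
    bracket (coef (LSer v D) (k + 1)) (coef (LSer 1 e) l) -
    bracket (coef (LSer v D) k) (coef (LSer 1 e) (l + 1)) =
    h *a (coef (LSer v D) k * coef (LSer 1 e) l +
          coef (LSer 1 e) l * coef (LSer v D) k)) <->
  intertwines e D D (zratio h (- h)).
Proof.
move=> uD; rewrite intertwines_half // /ascale; split=> H.
  move=> k n; have := H (v + k%:Z) n.+1%:Z isT.
  by rewrite !coefz -(addrA v) -PoszD addn1 !coef_nat.
move=> k [[//|n]|//] _; rewrite !coefz.
case: (int_fromP (v - 1) k) => [m ->|kv]; last first.
  by rewrite !coef_lt ?br0l ?mul0r ?mulr0 ?addr0 ?mulr0 ?subrr //=; lia.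
case: m => [|m].
  have -> : v - 1 + 0%:Z + 1 = v + 0%:Z by lia.
  rewrite coef_nat uD br1l coef_lt ?br0l ?mul0r ?mulr0 ?addr0 ?mulr0 ?subrr //=.
  by lia.
have -> : v - 1 + m.+1%:Z = v + m%:Z by lia.
by rewrite -(addrA v) -PoszD addn1 !coef_nat H.
Qed.

Lemma rel_current e f (h : K) :
  (forall k l, 1 <= k -> 1 <= l ->
    bracket (coef (LSer 1 e) (k + 1)) (coef (LSer 1 f) l) -
    bracket (coef (LSer 1 e) k) (coef (LSer 1 f) (l + 1)) =
    h *a (coef (LSer 1 e) k * coef (LSer 1 f) l +
          coef (LSer 1 f) l * coef (LSer 1 e) k)) <-> current e f h h.
Proof.
rewrite /ascale; split=> H.
  by move=> m n; have := H m.+1%:Z n.+1%:Z isT isT; rewrite !coefz mulrDr.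
by move=> [[//|m]|//] [[//|n]|//] _ _; rewrite !coefz H mulrDr.
Qed.
End YRel.

Section YNormal.
Variables (K : fieldType) (r : nat) (hr : (3 <= r)%N) (b : coweight r).
Variables (A : pzAlgType K) (g : ygen r -> A).

Definition Ysat := forall x y, Yrel b g x y -> x = y.

Definition ye j : nat -> A := fun n => g (YE j n).
Definition yf j : nat -> A := fun n => g (YF j n).
Definition yh i : series A := lcf (Yh b g i).

Definition half_cartan (i j : 'I_r) : K := (cartan i j : int)%:~R / 2%:R.
Local Notation hc i j := (half_cartan i j).

Record Ynormal : Prop := {
  yn_hh : forall i j m n, yh i m * yh j n = yh j n * yh i m;
  yn_ef : forall i j m n,
    bracket (ye i m) (yf j n) = coef (Yh b g i) (m + n).+1%:Z *+ (i == j);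
  yn_he : forall i j, intertwines (ye j) (yh i) (yh i) (zratio (hc i j) (- hc i j));
  yn_hf : forall i j, intertwines (yf j) (yh i) (yh i) (zratio (- hc i j) (hc i j));
  yn_ee : forall i j, current (ye i) (ye j) (hc i j) (hc i j);
  yn_ff : forall i j, current (yf i) (yf j) (- hc i j) (- hc i j);
  yn_se : forall i j, i != j -> serre_nodes i j (ye i) (ye j);
  yn_sf : forall i j, i != j -> serre_nodes i j (yf i) (yf j) }.

Lemma Yh_LSer i : Yh b g i = LSer (- b i) (yh i). Proof. by []. Qed.
Lemma unipotent_yh i : unipotent (yh i). Proof. by []. Qed.

Lemma Ysat_normal : Ysat <-> Ynormal.
Proof.
split=> [H|[hh ef he hf ee ff se sf]].
  split.
  - move=> i j m n; apply/subr0_eq.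
    have := H _ _ (Yrel_HH b g i j (- b i + m%:Z) (- b j + n%:Z)).
    by rewrite !coef_nat.
  - move=> i j m n; have := H _ _ (@Yrel_EF _ _ b _ g i j m.+1%:Z n.+1%:Z isT isT).
    rewrite !coefz => ->.
    by congr (coef _ _ *+ _); lia.
  - move=> i j; apply/(rel_HE (- b i)) => // k l l1; exact/H/Yrel_HE.
  - move=> i j; rewrite -[X in zratio _ X]opprK; apply/(rel_HE (- b i)) => // k l l1.
    exact/H/Yrel_HF.
  - by move=> i j; apply/rel_current => k l k1 l1; exact/H/Yrel_EE.
  - by move=> i j; apply/rel_current => k l k1 l1; exact/H/Yrel_FF.
  - move=> i j ij; apply: serre_rel_nodes => // k l k1 l1; exact/H/Yrel_serreE.
  - move=> i j ij; apply: serre_rel_nodes => // k l k1 l1; exact/H/Yrel_serreF.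
move=> x y; case=> {x y}.
- move=> i j k l.
  case: (int_fromP (- b i) k) => [m ->|lt]; last by rewrite coef_lt // br0l.
  case: (int_fromP (- b j) l) => [n ->|lt]; last by rewrite [X in bracket _ X]coef_lt // br0r.
  by rewrite !coef_nat /bracket [X in X - _]hh subrr.
- move=> i j [[//|m]|//] [[//|n]|//] _ _; rewrite !coefz; have := ef i j m n => ->.
  by congr (coef _ _ *+ _); lia.
- by move=> i j k l; move: k l; apply/rel_HE => //; exact: he.
- move=> i j k l; move: k l; apply/rel_HE => //; rewrite opprK; exact: hf.
- by move=> i j k l k1 l1; have /rel_current := ee i j; apply.
- by move=> i j k l k1 l1; have /rel_current := ff i j; apply.
- by move=> i j k l ij _ _; apply: serre_nodes_rel => //; exact: se.
- by move=> i j k l ij _ _; apply: serre_nodes_rel => //; exact: sf.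
Qed.
End YNormal.

(** * Matching the two sets of shifts *)

Section Arith.
Variables (K : fieldType) (char0 : forall n, n.+1%:R != 0 :> K).
Variables (r : nat) (hr : (3 <= r)%N).
Local Notation s i := (node_shift K i).
Local Notation hc i j := (half_cartan K i j).

Lemma node_shiftE (i : 'I_r) : s i = (shift2 i)%:R / 2%:R.
Proof. by []. Qed.

Let two_neq0 : 2%:R != 0 :> K := char0 1.

Lemma half_cartan0 (i j : 'I_r) : cartan i j = 0 -> hc i j = 0.
Proof. by rewrite /half_cartan => ->; rewrite mul0r. Qed.

(** This is [cmat_shift] over K. *)
Lemma cartan_cases (i j : 'I_r) :
  cartan i j = 0 \/ (cmat (Kden i) j)%:~R + s i - s j = hc i j.
Proof.
have [->|ne] := eqVneq (cartan i j) 0; [by left | right].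
have /(congr1 (fun z : int => z%:~R : K)) := cmat_shift hr ne.
rewrite !rmorphB rmorphM /= -!pmulrn => E.
by rewrite !node_shiftE /half_cartan -addrA -mulrBl -E; field.
Qed.

Lemma cartan_cases_lt (i j : 'I_r) : (i < j)%N ->
  cartan i j = 0 \/ s j - s i = - hc i j.
Proof.
move=> ij; have [->|ne] := eqVneq (cartan i j) 0; [by left | right].
have /(congr1 (fun z : int => z%:~R : K)) := cartan_shift hr ij ne.
rewrite !rmorphB rmorphN /= -!pmulrn => E.
by rewrite !node_shiftE /half_cartan -mulrBl E mulNr.
Qed.
Lemma half_cartan_double (i j : 'I_r) : (cartan i j)%:~R = hc i j + hc i j.
Proof. by rewrite /half_cartan; field. Qed.

Lemma half_cartan_diag (i : 'I_r) : hc i i = 1.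
Proof. by rewrite /half_cartan cartan_diag // divff. Qed.

Lemma half_cartan_sym (i j : 'I_r) : hc i j = hc j i.
Proof. by rewrite /half_cartan cartan_sym. Qed.

(** K_i(z + s_i) intertwines E_j(w + s_j) by (z - X + c_a + s_i - s_j) /
    (z - X + c_b + s_i - s_j), where c_a and c_b are the coefficients c_kj of the
    two D_k in K_i, and this is the factor of H_i in Y.  When a_ij = 0 both
    quotients are 1. *)
Lemma zratio_node (i j : 'I_r) :
  zratio ((cmat (Kden i) j)%:~R + s i - s j) ((cmat (Knum i) j)%:~R + s i - s j) =
  zratio (hc i j) (- hc i j).
Proof.
have cE := cmat_cartan hr i j.
have [c0|E] := cartan_cases i j.
  rewrite half_cartan0 // oppr0 zratioxx; move: cE; rewrite c0 => /subr0_eq ->.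
  by rewrite zratioxx.
rewrite E; congr (zratio _ _).
have -> : cmat (Knum i) j = cmat (Kden i) j - cartan i j by rewrite -cE; ring.
rewrite rmorphB /=; rewrite half_cartan_double.
by rewrite -{1}E; ring.
Qed.

Lemma zratio_node_rev (i j : 'I_r) :
  zratio (hc i j - s i + s j) (- hc i j - s i + s j) =
  zratio (cmat (Kden i) j)%:~R (cmat (Knum i) j)%:~R.
Proof.
have cE := cmat_cartan hr i j.
have [c0|E] := cartan_cases i j.
  rewrite half_cartan0 // oppr0 zratioxx; move: cE; rewrite c0 => /subr0_eq ->.
  by rewrite zratioxx.
congr (zratio _ _); first by rewrite -E; ring.
have -> : cmat (Knum i) j = cmat (Kden i) j - cartan i j by rewrite -cE; ring.
rewrite rmorphB /=; rewrite half_cartan_double.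
by rewrite -{2}E; ring.
Qed.
End Arith.

(** * From X to Y *)

Section Central.
Variables (K : fieldType) (char0 : forall n, n.+1%:R != 0 :> K).
Variables (r : nat) (hr : (3 <= r)%N).
Variable A : pzAlgType K.
Implicit Types (e : nat -> A) (D : 'I_r.+1 -> series A).

(** phi = 1 means that C commutes with all e_n. *)
Lemma intertwines_commP e (C : series A) :
  intertwines e C C 1 <-> forall n m, C n * e m = e m * C n.
Proof.
split=> H.
  move=> n m; have := congr1 (fun f => f n) (H (constS 'X^m)).
  rewrite smErev smE !big_ord_recl !big1 ?addr0.
  - by rewrite mul1r /umbrals /constS /= umbralXn subn0.
  - by move=> i _; rewrite /umbrals mul1r raddf0 mul0r.
  by move=> i _; rewrite /umbrals raddf0 mulr0.
move=> P; apply/funext => n; rewrite mul1r smErev smE; apply: eq_bigr => i _.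
have le := umbral_linear e; rewrite /umbrals; move: (P i).
apply: poly_linear_ext => [||m]; [exact: poly_linearMl|exact: poly_linearMr|].
by rewrite umbralXn H.
Qed.

Lemma intertwines_Kseries e D D' (phi : 'I_r.+1 -> series {poly K}) :
    (forall j, unipotent (D j)) -> (forall j, unipotent (D' j)) -> (forall j, unipotent (phi j)) ->
    (forall j, intertwines e (D j) (D' j) (phi j)) ->
  forall i, intertwines e (Kseries D i) (Kseries D' i) (Kseries phi i).
Proof. by move=> u1 u2 u3 H i; apply: intertwinesM => //; apply: intertwinesV. Qed.

Lemma intertwines_Cseries d e D D' (phi : 'I_r.+1 -> series {poly K}) :
    (forall j, unipotent (D j)) -> (forall j, unipotent (D' j)) -> (forall j, unipotent (phi j)) ->
    (forall j, intertwines e (D j) (D' j) (phi j)) ->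
  intertwines e (Cseries d D) (Cseries d D') (Cseries (fun=> 0) phi).
Proof.
move=> u1 u2 u3 H; apply/intertwinesP => n.
have /(_ e n (fun=> 0)) T := intertwines_upto_Cseries char0 d u1 u2 u3.
apply: intertwines_upto_eq (T _) => [p|j]; first by rewrite addr0.
by have /intertwinesP := H j; exact.
Qed.

Lemma Kseries1 i : Kseries (fun=> 1 : series {poly K}) (i : 'I_r) = 1.
Proof. by rewrite /Kseries sinv1 mulr1. Qed.

Lemma comm_Kseries D x : (forall j, unipotent (D j)) ->
    (forall j n, D j n * x = x * D j n) ->
  forall i n, Kseries D i n * x = x * Kseries D i n.
Proof.
move=> uD H i; apply/intertwines_single; rewrite -(Kseries1 i).
by apply: intertwines_Kseries => // j; apply/intertwines_single.
Qed.

Lemma comm_Cseries d D x : (forall j, unipotent (D j)) ->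
    (forall j n, D j n * x = x * D j n) ->
  forall n, Cseries d D n * x = x * Cseries d D n.
Proof.
move=> uD H; apply/intertwines_single; rewrite -(Cseries1 r {poly K}).
by apply: intertwines_Cseries => // j; apply/intertwines_single.
Qed.

(** [rigidity] for the relation of commuting with x. *)
Lemma comm_D d D x : (forall j, unipotent (D j)) ->
    (forall i n, Kseries D i n * x = x * Kseries D i n) ->
    (forall n, Cseries d D n * x = x * Cseries d D n) ->
  forall j n, D j n * x = x * D j n.
Proof.
move=> uD HK HC j; apply/intertwines_single; move: j.
apply: (rigidity char0 hr (d := d)) => // [i|].
  by rewrite Kseries1; apply/intertwines_single.
by rewrite Cseries1 //; apply/intertwines_single.
Qed.

(** [rigidity] for the relation of being equal. *)
Lemma D_unique d D D' : (forall j, unipotent (D j)) -> (forall j, unipotent (D' j)) ->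
  (forall i, Kseries D i = Kseries D' i) -> Cseries d D = Cseries d D' -> forall j, D j = D' j.
Proof.
move=> uD uD' HK HC j.
suff /intertwines_single H : intertwines (single (1 : A)) (D j) (D' j) 1.
  by apply/funext => n; have := H n; rewrite mulr1 mul1r.
move: j; apply: (rigidity char0 hr (d := d)) => // [i|].
  by rewrite Kseries1 HK; apply/intertwines_single => n; rewrite mulr1 mul1r.
by rewrite Cseries1 // HC; apply/intertwines_single => n; rewrite mulr1 mul1r.
Qed.

Lemma comm_tr s v (f : series A) x : (forall n, f n * x = x * f n) ->
  forall n, translate s v f n * x = x * translate s v f n.
Proof.
move=> /intertwines_single H; apply/intertwines_single.
by rewrite -(translate_val0_1 {poly K} s); exact: intertwines_tr.
Qed.
End Central.

Section YofX.
Variables (K : fieldType) (char0 : forall n, n.+1%:R != 0 :> K).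
Variables (r : nat) (hr : (3 <= r)%N) (mu : 'rV[int]_r.+1).
Variable A : pzAlgType K.
Variable g : xgen r -> A.
Local Notation s i := (node_shift K i).
Local Notation hc i j := (half_cartan K i j).
Local Notation e := (xe g).
Local Notation f := (xf g).
Local Notation D := (xd mu g).

(** The images of the generators of Y under iota. *)
Definition Ygens_in_X (x : ygen r) : A := match x with
  | YE i n => translate (s i) 1 (e i) n
  | YF i n => translate (s i) 1 (f i) n
  | YH i n => translate (s i) (- mubar mu i) (Kseries D i) n.+1
  end.

Lemma yh_Ygens_in_X i : yh (mubar mu) Ygens_in_X i = translate (s i) (- mubar mu i) (Kseries D i).
Proof.
apply/funext => -[|n] //; rewrite translate_coef0.
by apply/esym; apply: unipotent_Kseries.
Qed.

Lemma Yh_Ygens_in_X i : Yh (mubar mu) Ygens_in_X i = ltranslate (s i) (Xk mu g i).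
Proof. by rewrite Xk_LSer // ltranslateE -yh_Ygens_in_X. Qed.

(** K_i inherits its relations from the D_k by multiplicativity, and the shifts
    turn them into those of H_i by [zratio_node]; the relations among the E_j and
    among the F_j follow from [current_shift]. *)
Lemma Y_of_X : Xnormal mu g -> Ynormal (mubar mu) Ygens_in_X.
Proof.
move=> [dd ef de df ee ff eeij ffij se sf].
have uD j : unipotent (D j) by exact: unipotent_xd.
have KK (i j : 'I_r) m n : Kseries D i m * Kseries D j n = Kseries D j n * Kseries D i m.
  apply: comm_Kseries => // k m'; apply/esym.
  by apply: comm_Kseries => // k' n'; exact: dd.
have ne_lt (i j : 'I_r) : (i < j)%N -> i != j by rewrite -val_eqE neq_ltn => ->.
have cEE (i j : 'I_r) : (i < j)%N ->
    current (translate (s i) 1 (e i)) (translate (s j) 1 (e j)) (hc i j) (hc i j).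
  move=> ij; have [c0|sE] := cartan_cases_lt K hr ij.
    apply: current0_serre_comm; last by rewrite half_cartan0 // addr0.
    apply: serre_comm_shift => //; have := se i j (ne_lt i j ij).
    by rewrite /serre_nodes c0 eqxx.
  have := current_shift char0 (s i) (s j) (eeij i j ij).
  by rewrite sE (half_cartan_double char0) addrK sub0r opprK.
have cFF (i j : 'I_r) : (i < j)%N ->
    current (translate (s i) 1 (f i)) (translate (s j) 1 (f j)) (- hc i j) (- hc i j).
  move=> ij; have [c0|sE] := cartan_cases_lt K hr ij.
    apply: current0_serre_comm; last by rewrite half_cartan0 // oppr0 addr0.
    apply: serre_comm_shift => //; have := sf i j (ne_lt i j ij).
    by rewrite /serre_nodes c0 eqxx.
  have := current_shift char0 (s i) (s j) (ffij i j ij).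
  by rewrite sE (half_cartan_double char0) add0r opprK opprD addrNK.
split=> [i j m n|i j m n|i j|i j|i j|i j|i j ij|i j ij].
- rewrite !yh_Ygens_in_X; apply: comm_tr => // k; apply/esym.
  by apply: comm_tr => // l; exact: KK.
- rewrite Yh_Ygens_in_X; case: eqP => [<-|/eqP ij].
    apply: ef_shift => // k l; by rewrite ef eqxx.
  apply: serre_comm_shift => // k l; by rewrite ef (negPf ij).
- rewrite yh_Ygens_in_X -(zratio_node char0 hr).
  have := intertwines_Kseries uD uD (fun k => @unipotent_zratio K _ _) (fun k => de k j) i.
  rewrite Kseries_Efactor => /(intertwines_tr char0 (s i) (- mubar mu i)).
  rewrite translate_zratio // => /(intertwines_shift char0 (s j)).
  by rewrite subst_shift_zratio.
- rewrite yh_Ygens_in_X -[X in zratio X _]opprK -[X in zratio _ X]opprK.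
  have := intertwines_Kseries uD uD (fun k => @unipotent_zratio K _ _) (fun k => df k j) i.
  rewrite Kseries_Ffactor => /(intertwines_tr char0 (s i) (- mubar mu i)).
  rewrite translate_zratio // => /(intertwines_shift char0 (s j)).
  rewrite subst_shift_zratio -zratioV zratio_node //.
  by rewrite zratioV !opprK.
- case: (ltngtP i j) => [ij|ij|/val_inj ij].
  + exact: cEE.
  + by rewrite half_cartan_sym; apply: current_sym; exact: cEE.
  rewrite -ij (half_cartan_diag char0 hr); have := current_shift char0 (s i) (s i) (ee i).
  by rewrite !subrr addr0 subr0.
- case: (ltngtP i j) => [ij|ij|/val_inj ij].
  + exact: cFF.
  + by rewrite half_cartan_sym; apply: current_sym; exact: cFF.
  rewrite -ij (half_cartan_diag char0 hr); have := current_shift char0 (s i) (s i) (ff i).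
  by rewrite !subrr addr0 subr0.
- have := se i j ij; rewrite /serre_nodes; case: ifP => _; first exact: serre_comm_shift.
  exact: serre_cubic_shift.
have := sf i j ij; rewrite /serre_nodes; case: ifP => _; first exact: serre_comm_shift.
exact: serre_cubic_shift.
Qed.

(** C intertwines E_j by [Cseries_Efactor], that is by 1, and similarly F_j. *)
Lemma Cseries_central : Xnormal mu g -> forall n x,
  Cseries (dmu mu) D n * g x = g x * Cseries (dmu mu) D n.
Proof.
move=> [dd ef de df ee ff eeij ffij se sf] n x.
have uD j : unipotent (D j) by exact: unipotent_xd.
case: x => [j m|j m|j m].
- have := intertwines_Cseries char0 (dmu mu) uD uD
    (fun k => @unipotent_zratio K _ _) (fun k => de k j).
  by rewrite Cseries_Efactor // => /intertwines_commP; exact.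
- have := intertwines_Cseries char0 (dmu mu) uD uD
    (fun k => @unipotent_zratio K _ _) (fun k => df k j).
  by rewrite Cseries_Ffactor // => /intertwines_commP; exact.
apply: comm_Cseries => // k l.
by have := dd k j l m.+1.
Qed.
End YofX.

(** * From Y to X *)

Section XofY.
Variables (K : fieldType) (char0 : forall n, n.+1%:R != 0 :> K).
Variables (r : nat) (hr : (3 <= r)%N) (mu : 'rV[int]_r.+1).
Variable A : pzAlgType K.
Variables (g : ygen r -> A) (C : series A).
Local Notation s i := (node_shift K i).
Local Notation hc i j := (half_cartan K i j).
Local Notation b := (mubar mu).

(** The K_i are the H_i translated back and C is given, so [D_exists] provides
    the D_j.  Their relations hold by [rigidity], as those of K_i and C do. *)
Lemma X_of_Y : Ynormal b g -> unipotent C -> (forall n x, C n * g x = g x * C n) ->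
    (forall m n, C m * C n = C n * C m) ->
  exists gX : xgen r -> A,
    [/\ Xnormal mu gX,
        forall i, xe gX i = translate (- s i) 1 (ye g i),
        forall i, xf gX i = translate (- s i) 1 (yf g i),
        forall i, Kseries (xd mu gX) i = translate (- s i) (- b i) (yh b g i) &
        Cseries (dmu mu) (xd mu gX) = C].
Proof.
move=> [hh ef he hf ee ff se sf] uC Cg CC.
pose kap i := translate (- s i) (- b i) (yh b g i).
have [D [uD DK DC]] := D_exists char0 hr (dmu mu)
  (fun i => unipotent_tr (- s i) (- b i) (@unipotent_yh K r b A g i)) uC.
pose gX (x : xgen r) : A := match x with
  | XE i n => translate (- s i) 1 (ye g i) n
  | XF i n => translate (- s i) 1 (yf g i) n
  | XD j n => D j n.+1
  end.
have xdE j : xd mu gX j = D j by apply/funext => -[|n] //; exact/esym/uD.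
have xdE' : xd mu gX = D by apply/funext.
exists gX; split=> //; rewrite ?xdE' //.
have Ch i m n : C m * yh b g i n = yh b g i n * C m.
  by case: n => [|n]; rewrite ?(unipotent_yh b g i) ?mulr1 ?mul1r //; exact: Cg.
have Ck i m n : C m * kap i n = kap i n * C m.
  by apply/esym; apply: comm_tr => // k; exact/esym/Ch.
have kk (i j : 'I_r) m n : kap i m * kap j n = kap j n * kap i m.
  apply: comm_tr => // k; apply/esym.
  by apply: comm_tr => // l; exact: hh.
have Dk i n j m : D j m * kap i n = kap i n * D j m.
  apply: (comm_D char0 hr (d := dmu mu)) => // [k l|l].
    by rewrite DK; exact: kk.
  by rewrite DC; exact: Ck.
have DCc n j m : D j m * C n = C n * D j m.
  apply: (comm_D char0 hr (d := dmu mu)) => // [k l|l].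
    by rewrite DK -Ck.
  by rewrite DC CC.
have ne_lt (i j : 'I_r) : (i < j)%N -> i != j by rewrite -val_eqE neq_ltn => ->.
have nat_e (e : nat -> A) (i : 'I_r) : (forall m n, C m * e n = e n * C m) ->
    forall m n, C m * translate (- s i) 1 e n = translate (- s i) 1 e n * C m.
  by move=> H m n; apply/esym; apply: comm_tr => // k; exact/esym/H.
split=> [i j m n|i j m n|k j|k j|i|i|i j ij|i j ij|i j ij|i j ij].
- rewrite !xdE; apply: (comm_D char0 hr (d := dmu mu)) => // [k l|l].
    by rewrite DK -Dk.
  by rewrite DC DCc.
- have KE : Xk mu gX i = ltranslate (- s i) (Yh b g i).
    by rewrite Xk_LSer // xdE' DK Yh_LSer ltranslateE.
  rewrite KE; case: eqP => [<-|/eqP ij].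
    by apply: ef_shift => // k l; rewrite ef eqxx.
  by apply: serre_comm_shift => // k l; rewrite ef (negPf ij).
- rewrite xdE; move: k;
  apply: (rigidity char0 hr (d := dmu mu) (D := D) (D' := D) (phi := Efactor K j)) => //.
  + by move=> k; exact: unipotent_zratio.
  + by move=> i; rewrite DK Kseries_Efactor -(zratio_node_rev char0 hr);
    have := intertwines_shift char0 (- s j) (intertwines_tr char0 (- s i) (- b i) (he i j));
    rewrite translate_zratio // subst_shift_zratio opprK.
  rewrite DC Cseries_Efactor //; apply/intertwines_commP => n m.
  by apply: nat_e => k l; exact: Cg.
- rewrite xdE; move: k;
  apply: (rigidity char0 hr (d := dmu mu) (D := D) (D' := D) (phi := Ffactor K j)) => //.
  + by move=> k; exact: unipotent_zratio.
  + by move=> i; rewrite DK Kseries_Ffactor -zratioV -(zratio_node_rev char0 hr) zratioV;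
    have := intertwines_shift char0 (- s j) (intertwines_tr char0 (- s i) (- b i) (hf i j));
    rewrite translate_zratio // subst_shift_zratio opprK.
  rewrite DC Cseries_Ffactor //; apply/intertwines_commP => n m.
  by apply: nat_e => k l; exact: Cg.
- have := current_shift char0 (- s i) (- s i) (ee i i).
  by rewrite (half_cartan_diag char0 hr) subrr addr0 subr0.
- have := current_shift char0 (- s i) (- s i) (ff i i).
  by rewrite (half_cartan_diag char0 hr) subrr addr0 subr0.
- have [c0|sE] := cartan_cases_lt K hr ij.
    apply: current0_serre_comm; last by rewrite c0 addr0.
    apply: serre_comm_shift => //; have := se i j (ne_lt i j ij).
    by rewrite /serre_nodes c0 eqxx.
  have := current_shift char0 (- s i) (- s j) (ee i j).
  have -> : - s j - - s i = hc i j by rewrite -opprD sE opprK.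
  by rewrite (half_cartan_double char0) subrr.
- have [c0|sE] := cartan_cases_lt K hr ij.
    apply: current0_serre_comm; last by rewrite c0 oppr0 addr0.
    apply: serre_comm_shift => //; have := sf i j (ne_lt i j ij).
    by rewrite /serre_nodes c0 eqxx.
  have := current_shift char0 (- s i) (- s j) (ff i j).
  have -> : - s j - - s i = hc i j by rewrite -opprD sE opprK.
  by rewrite (half_cartan_double char0) addNr opprD.
- have := se i j ij; rewrite /serre_nodes; case: ifP => _; first exact: serre_comm_shift.
  exact: serre_cubic_shift.
have := sf i j ij; rewrite /serre_nodes; case: ifP => _; first exact: serre_comm_shift.
exact: serre_cubic_shift.
Qed.
End XofY.

(** * Maps out of algebras given by generators *)

Section AlgMorphism.
Variables (K : fieldType) (A B : pzAlgType K) (f : A -> B).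
Hypothesis Hf : algebra_morphism f.

Lemma amorphB x y : f (x - y) = f x - f y. Proof. by case: Hf. Qed.
Lemma amorph0 : f 0 = 0. Proof. by rewrite -(subrr (0 : A)) amorphB subrr. Qed.
Lemma amorphN x : f (- x) = - f x. Proof. by rewrite -sub0r amorphB amorph0 sub0r. Qed.
Lemma amorphD x y : f (x + y) = f x + f y.
Proof. by rewrite -[y in LHS]opprK amorphB amorphN opprK. Qed.
Lemma amorph1 : f 1 = 1. Proof. by case: Hf => _ []. Qed.
Lemma amorphM x y : f (x * y) = f x * f y. Proof. by case: Hf => _ []. Qed.
Lemma amorphZ c x : f (c *a x) = c *a f x. Proof. by case: Hf. Qed.
Lemma amorphC c : f (inalg c) = inalg c.
Proof. by have := amorphZ c 1; rewrite /ascale amorph1 !mulr1. Qed.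
Lemma amorph_sum I (s : seq I) (P : pred I) (F : I -> A) :
  f (\sum_(i <- s | P i) F i) = \sum_(i <- s | P i) f (F i).
Proof. by rewrite (big_morph f amorphD amorph0). Qed.
Lemma amorphMn x n : f (x *+ n) = f x *+ n.
Proof. by elim: n => [|n IH]; rewrite ?mulr0n ?amorph0 // !mulrS amorphD IH. Qed.
Lemma amorphMz x (n : int) : f (x *~ n) = f x *~ n.
Proof.
by case: n => n; rewrite ?NegzE ?mulrNz ?amorphN -!pmulrn amorphMn.
Qed.
End AlgMorphism.

Lemma amorph_id (K : fieldType) (A : pzAlgType K) : algebra_morphism (@id A).
Proof. by split. Qed.

Lemma amorph_comp (K : fieldType) (A B C : pzAlgType K) (f : A -> B) (g : B -> C) :
  algebra_morphism f -> algebra_morphism g -> algebra_morphism (g \o f).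
Proof.
move=> Hf Hg; split=> [x y||c x]; rewrite /= ?(amorphB Hf) ?(amorphB Hg) ?(amorphZ Hf) ?(amorphZ Hg) //.
by split=> [|x y] /=; rewrite ?(amorph1 Hf) ?(amorph1 Hg) // (amorphM Hf) (amorphM Hg).
Qed.

Section MonoidAlgebraMaps.
Variables (K : fieldType) (M : monomType) (B : pzAlgType K).
Local Notation MA := (malg M K).

Lemma malgE (x : MA) : x = \sum_(k <- msupp x) inalg x@_k * << k >>.
Proof.
rewrite {1}[x]monalgE; apply: eq_bigr => k _.
rewrite [RHS]mul_malgC; apply/malgP => l.
by rewrite mcoeffZ !mcoeffU mulr_natr.
Qed.

(** A morphism is linear, so it is determined on monomials. *)
Lemma malg_morphism_ext (f f' : MA -> B) :
  algebra_morphism f -> algebra_morphism f' ->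
  (forall k : M, f << k >> = f' << k >>) -> f =1 f'.
Proof.
move=> Hf Hf' E x; rewrite [x]malgE !(amorph_sum Hf) (amorph_sum Hf').
by apply: eq_bigr => k _; rewrite (amorphM Hf) (amorphM Hf') (amorphC Hf) (amorphC Hf') E.
Qed.

Lemma malgU_mul (k l : M) : << mmul k l >> = << k >> * << l >> :> MA.
Proof. by rewrite malgM_def fgmulUU mulr1. Qed.

Variable h : M -> B.
Hypotheses (h1 : h (@mone M) = 1) (hM : forall x y, h (mmul x y) = h x * h y).

Definition malg_eval (x : MA) : B := \sum_(k <- msupp x) inalg x@_k * h k.

Lemma malg_evalw (d : {fset M}) x : (msupp x `<=` d)%fset ->
  malg_eval x = \sum_(k <- d) inalg x@_k * h k.
Proof.
move=> le; rewrite [LHS](big_fset_incl _ le) => //= k kd /mcoeff_outdom ->.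
by rewrite rmorph0 mul0r.
Qed.

Lemma malg_evalU (c : K) (k : M) : malg_eval << c *g k >> = inalg c * h k.
Proof. by rewrite (malg_evalw msuppU_le) big_seq_fset1 mcoeffUU. Qed.

Lemma malg_evalB x y : malg_eval (x - y) = malg_eval x - malg_eval y.
Proof.
pose d := (msupp x `|` msupp y)%fset.
rewrite (@malg_evalw d x) ?fsubsetUl // (@malg_evalw d y) ?fsubsetUr //.
rewrite (@malg_evalw d) ?msuppB_le // -sumrB; apply: eq_bigr => k _.
by rewrite mcoeffB rmorphB mulrBl.
Qed.

Lemma malg_eval_morphism : algebra_morphism malg_eval.
Proof.
have eD x y : malg_eval (x + y) = malg_eval x + malg_eval y.
  rewrite -[y in LHS]opprK malg_evalB; congr (_ + _).
  by rewrite -[- y]sub0r malg_evalB -(subrr (0 : MA)) malg_evalB !subrr sub0r opprK.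
have e0 : malg_eval 0 = 0 by rewrite -(subrr (0 : MA)) malg_evalB subrr.
have eM x y : malg_eval (x * y) = malg_eval x * malg_eval y.
  rewrite malgME (big_morph _ eD e0) mulr_suml; apply: eq_bigr => i _.
  rewrite (big_morph _ eD e0) mulr_sumr; apply: eq_bigr => j _.
  rewrite malg_evalU rmorphM hM -!mulrA; congr (_ * _).
  by rewrite !mulrA inalg_central.
have eC c : malg_eval (inalg c) = inalg c by rewrite malg_evalU h1 mulr1.
split=> [x y||c x]; first exact: malg_evalB; last by rewrite /ascale eM eC.
split; last exact: eM.
by rewrite -(rmorph1 (@inalg K MA)) eC rmorph1.
Qed.
End MonoidAlgebraMaps.

Section FreeMaps.
Variables (K : fieldType) (G : choiceType) (B : pzAlgType K).

Lemma free_universal (g : G -> B) : exists f : free_alg K G -> B,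
  algebra_morphism f /\ forall x, f (free_gen K x) = g x.
Proof.
pose h (m : fmonom G) : B := \prod_(x <- m) g x.
exists (malg_eval h); split.
  apply: malg_eval_morphism; first by rewrite /h fm1 big_nil.
  by move=> x y; rewrite /h fmM big_cat.
by move=> x; rewrite malg_evalU rmorph1 mul1r /h fmU big_seq1.
Qed.

Lemma free_morphism_ext (f f' : free_alg K G -> B) :
  algebra_morphism f -> algebra_morphism f' ->
  (forall x, f (free_gen K x) = f' (free_gen K x)) -> f =1 f'.
Proof.
move=> Hf Hf' E; apply: malg_morphism_ext => // m.
have -> : m = FMonom (fmonom_val m) by rewrite fmK.
elim: (fmonom_val m) => [|x s IH].
  by rewrite -fmoneE [<< _ >>]/(1 : free_alg K G) (amorph1 Hf) (amorph1 Hf').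
have -> : FMonom (x :: s) = mmul (fmu x) (FMonom s).
  by apply/eqP; rewrite fmP fmM fmU.
by rewrite malgU_mul (amorphM Hf) (amorphM Hf') IH -/(free_gen K x) E.
Qed.

Lemma free_comm (f : free_alg K G -> B) (c : B) : algebra_morphism f ->
  (forall x, c * f (free_gen K x) = f (free_gen K x) * c) ->
  forall y, c * f y = f y * c.
Proof.
move=> Hf E y; rewrite [y]malgE (amorph_sum Hf) mulr_sumr mulr_suml.
apply: eq_bigr => m _; rewrite (amorphM Hf) (amorphC Hf) mulrA -inalg_central -!mulrA.
congr (_ * _); have -> : m = FMonom (fmonom_val m) by rewrite fmK.
elim: (fmonom_val m) => [|x t IH].
  by rewrite -fmoneE [<< _ >>]/(1 : free_alg K G) (amorph1 Hf) mulr1 mul1r.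
have -> : FMonom (x :: t) = mmul (fmu x) (FMonom t).
  by apply/eqP; rewrite fmP fmM fmU.
by rewrite malgU_mul (amorphM Hf) -/(free_gen K x) mulrA E -mulrA IH mulrA.
Qed.
End FreeMaps.

Section QuotientMaps.
Variables (K : fieldType) (A B : pzAlgType K) (rel : A -> A -> Prop).

Lemma algproj_morphism : algebra_morphism (algproj rel).
Proof.
split=> [x y||c x].
- by apply: (addIr (algproj rel y)); rewrite -algquot_piD !subrK.
- by split=> // x y; rewrite /algproj -algquot_piM.
by rewrite /ascale [RHS]algquot_piM.
Qed.

Lemma algproj_rel x y : rel x y -> algproj rel x = algproj rel y.
Proof. by move=> xy; apply/algquot_eqP; exact: ideal_gen_rel. Qed.

Lemma algproj_surj (q : algquot rel) : exists x, algproj rel x = q.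
Proof. by exists (repr q)%qT; rewrite /algproj reprK. Qed.

Lemma quot_universal (f : A -> B) : algebra_morphism f ->
  (forall x y, rel x y -> f x = f y) ->
  exists fbar : algquot rel -> B,
    algebra_morphism fbar /\ forall x, fbar (algproj rel x) = f x.
Proof.
move=> Hf fr.
have fI x : ideal_gen rel x -> f x = 0.
  elim=> [{}x y xy||{}x y _ Hx _ Hy|a {}x b _ Hx].
  - by rewrite (amorphB Hf) (fr _ _ xy) subrr.
  - exact: amorph0.
  - by rewrite (amorphD Hf) Hx Hy addr0.
  by rewrite !(amorphM Hf) Hx mulr0 mul0r.
pose fbar (q : algquot rel) := f (repr q).
have fE x : fbar (algproj rel x) = f x.
  apply/subr0_eq; rewrite -(amorphB Hf); apply: fI; exact: algquot_repr.
exists fbar; split=> //; have Hp := algproj_morphism.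
split=> [p q||c p].
- have [[x <-] [y <-]] := (algproj_surj p, algproj_surj q).
  by rewrite -(amorphB Hp) !fE (amorphB Hf).
- split=> [|p q]; first by rewrite -(amorph1 Hp) fE (amorph1 Hf).
  have [[x <-] [y <-]] := (algproj_surj p, algproj_surj q).
  by rewrite -(amorphM Hp) !fE (amorphM Hf).
have [x <-] := algproj_surj p.
by rewrite -(amorphZ Hp) !fE (amorphZ Hf).
Qed.

Lemma quot_morphism_ext (f f' : algquot rel -> B) :
  (forall x, f (algproj rel x) = f' (algproj rel x)) -> f =1 f'.
Proof. by move=> E q; have [x <-] := algproj_surj q. Qed.
End QuotientMaps.

Section Center.
Variable A : pzRingType.

Definition center_pred : {pred A} := fun x => `[< forall y, x * y = y * x >].

Fact center_subring : subring_closed center_pred.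
Proof.
split=> [|x y /asboolP Hx /asboolP Hy|x y /asboolP Hx /asboolP Hy]; apply/asboolP => z.
- by rewrite mul1r mulr1.
- by rewrite mulrBl mulrBr Hx Hy.
by rewrite -mulrA Hy mulrA Hx mulrA.
Qed.
HB.instance Definition _ := GRing.isSubringClosed.Build A center_pred center_subring.

(** The center as a commutative ring: monomials in central elements can be
    multiplied there without regard to the order of the factors. *)
Record center := Center { center_val :> A; center_valP : center_val \in center_pred }.
HB.instance Definition _ := [isSub for center_val].
HB.instance Definition _ := [Choice of center by <:].
HB.instance Definition _ := GRing.SubChoice_isSubPzRing.Build A center_pred center
  center_subring.
Fact center_mulC : @commutative center _ *%R.
Proof. by move=> x y; apply: val_inj; have /asboolP := valP x; exact. Qed.
HB.instance Definition _ := GRing.PzRing_hasCommutativeMul.Build center center_mulC.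
End Center.

Section PolyMaps.
Variables (K : fieldType) (I : choiceType) (B : pzAlgType K).
Local Notation P := (malg (cmonom I) K).

(** The polynomial algebra maps to any algebra by sending the variables to
    central elements, and the image is central. *)
Lemma cmonom_universal (c : I -> B) : (forall i y, c i * y = y * c i) ->
  exists f : P -> B, [/\ algebra_morphism f, forall i, f << ucm i >> = c i &
    forall p y, f p * y = y * f p].
Proof.
move=> cC.
pose z i : center B := Center (introT (asboolP _) (cC i)).
pose h (m : cmonom I) : center B := \prod_(i <- finsupp m) z i ^+ m i.
have hw (d : {fset I}) (m : cmonom I) : (finsupp m `<=` d)%fset -> h m = \prod_(i <- d) z i ^+ m i.
  move=> le; rewrite /h (big_fset_incl _ le) // => i _.
  by rewrite -cmE_eq0 => /eqP ->; rewrite expr0.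
have h1 : h (@mone (cmonom I)) = 1 by rewrite /h mdom1 big_seq_fset0.
have hM m n : h (mmul m n) = h m * h n.
  rewrite [LHS]/h mdomD (hw _ m (fsubsetUl _ (finsupp n))) (hw _ n (fsubsetUr (finsupp m) _)).
  by rewrite -big_split /=; apply: eq_bigr => i _; rewrite cmM exprD.
exists (malg_eval (val \o h)); split.
- apply: malg_eval_morphism => [|x y] /=; first by rewrite h1.
  by rewrite hM.
- move=> i; rewrite malg_evalU rmorph1 mul1r /= /h mdomU big_seq_fset1 cmUU expr1.
  by [].
move=> p y; rewrite /malg_eval mulr_suml mulr_sumr; apply: eq_bigr => m _ /=.
have /asboolP hC := valP (h m).
by rewrite -mulrA hC !mulrA inalg_central.
Qed.

Lemma cmonom_morphism_ext (f f' : P -> B) :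
  algebra_morphism f -> algebra_morphism f' ->
  (forall i, f << ucm i >> = f' << ucm i >>) -> f =1 f'.
Proof.
move=> Hf Hf' E; apply: malg_morphism_ext => // m.
have [n] := ubnP (mdeg m); elim: n => // n IH in m *.
have [->|/negPf m1] := eqVneq m mone.
  by rewrite [<< _ >>]/(1 : P) (amorph1 Hf) (amorph1 Hf').
rewrite ltnS => mn.
have [i im] : exists i, i \in finsupp m.
  case: (fset_0Vmem (finsupp m)) => [e0|[i im]]; last by exists i.
  by move: m1; rewrite -mdeg_eq0 mdegE e0 big_seq_fset0.
have mE : m = mmul (ucm i) (divcm m (ucm i)).
  apply/eqP/cmP => j; rewrite cmM divcmE cmU subnKC //.
  by case: eqP => // <-; move: im; rewrite -cmE_neq0 lt0n.
move: (divcm m (ucm i)) mE => m' mE.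
have lt : (mdeg m' < n)%N by move: mn; rewrite mE mdegM mdegU add1n.
have {}mE : << m >> = << ucm i >> * << m' >> :> P by rewrite mE; exact: malgU_mul.
rewrite mE [LHS](amorphM Hf) [RHS](amorphM Hf').
by congr (_ * _); [exact: E | exact: IH].
Qed.
End PolyMaps.

Section TensorMaps.
Variables (K : fieldType) (A B : pzAlgType K).
Local Notation T := (tensor A B).

(** A relation between the images of the symbols under a morphism f is the image
    of a relation between the symbols themselves.  This is what shows that the
    relations hold in the quotient. *)
Lemma tensor_rel_lift (S S' : pzAlgType K) (f : S -> S') (t : A * B -> S) x y :
  algebra_morphism f -> tensor_rel (f \o t) x y ->
  exists x' y', [/\ tensor_rel t x' y', f x' = x & f y' = y].
Proof.
move=> Hf; case=> [a a' b|a b b'|c a b|c a b|a a' b b'|]; eexists; eexists.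
- by split; [exact: (tensorDl t a a' b) | | exact: (amorphD Hf)].
- by split; [exact: (tensorDr t a b b') | | exact: (amorphD Hf)].
- by split; [exact: (tensorZl t c a b) | | exact: (amorphZ Hf)].
- by split; [exact: (tensorZr t c a b) | | exact: (amorphZ Hf)].
- by split; [exact: (tensorM t a a' b b') | exact: (amorphM Hf) | ].
by split; [exact: (tensor1 t) | | exact: (amorph1 Hf)].
Qed.

Lemma tensor_rel_map (S S' : pzAlgType K) (f : S -> S') (t : A * B -> S) x y :
  algebra_morphism f -> tensor_rel t x y -> tensor_rel (f \o t) (f x) (f y).
Proof.
move=> Hf; case=> [a a' b|a b b'|c a b|c a b|a a' b b'|].
- by rewrite (amorphD Hf); exact: (tensorDl (f \o t)).
- by rewrite (amorphD Hf); exact: (tensorDr (f \o t)).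
- by rewrite (amorphZ Hf); exact: (tensorZl (f \o t)).
- by rewrite (amorphZ Hf); exact: (tensorZr (f \o t)).
- by rewrite (amorphM Hf); exact: (tensorM (f \o t)).
by rewrite (amorph1 Hf); exact: (tensor1 (f \o t)).
Qed.

Lemma tens_rel x y : tensor_rel (fun ab => tens ab.1 ab.2 : T) x y -> x = y.
Proof.
have Hp := algproj_morphism (tensor_rel (@free_gen K (A * B)%type)).
have -> : (fun ab => tens ab.1 ab.2 : T) =
    algproj (tensor_rel (@free_gen K (A * B)%type)) \o @free_gen K (A * B)%type.
  by apply/funext => -[].
by move=> /(tensor_rel_lift Hp) [x' [y' [r <- <-]]]; exact: algproj_rel.
Qed.

Lemma tensMM a a' b b' : tens a b * tens a' b' = tens (a * a') (b * b') :> T.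
Proof. exact: (tens_rel (tensorM _ a a' b b')). Qed.
Lemma tens11 : tens 1 1 = 1 :> T.
Proof. exact: (tens_rel (tensor1 _)). Qed.
Lemma tensE a b : tens a b = tens a 1 * tens 1 b :> T.
Proof. by rewrite tensMM mulr1 mul1r. Qed.

Lemma tens_comm a b : tens 1 b * tens a 1 = tens a 1 * tens 1 b :> T.
Proof. by rewrite -tensE tensMM mulr1 mul1r. Qed.

Lemma tensl_morphism : algebra_morphism (fun a => tens a 1 : T).
Proof.
have D a a' : tens (a + a') 1 = tens a 1 + tens a' 1 :> T.
  exact: (tens_rel (tensorDl _ a a' 1)).
split=> [a a'||c a].
- by apply: (addIr (tens a' 1)); rewrite -D !subrK.
- by split=> [|a a']; [exact: tens11 | rewrite tensMM mulr1].
exact: (tens_rel (tensorZl _ c a 1)).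
Qed.

Lemma tensr_morphism : algebra_morphism (fun b => tens 1 b : T).
Proof.
have D b b' : tens 1 (b + b') = tens 1 b + tens 1 b' :> T.
  exact: (tens_rel (tensorDr _ 1 b b')).
split=> [b b'||c b].
- by apply: (addIr (tens 1 b')); rewrite -D !subrK.
- by split=> [|b b']; [exact: tens11 | rewrite tensMM mulr1].
exact: (tens_rel (tensorZr _ c 1 b)).
Qed.

Lemma tensor_universal (S : pzAlgType K) (f : A -> S) (g : B -> S) :
    algebra_morphism f -> algebra_morphism g ->
    (forall a b, f a * g b = g b * f a) ->
  exists h : T -> S, algebra_morphism h /\ forall a b, h (tens a b) = f a * g b.
Proof.
move=> Hf Hg fg.
have [k [Hk kE]] := @free_universal K _ S (fun ab : A * B => f ab.1 * g ab.2).
have kt : k \o @free_gen K (A * B)%type = fun ab : A * B => f ab.1 * g ab.2.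
  by apply/funext => ab; rewrite /= kE.
have [x y xy|h [Hh hE]] := quot_universal (rel := tensor_rel (@free_gen K (A * B)%type)) Hk.
  have := tensor_rel_map Hk xy; rewrite kt.
  case=> [a a' b|a b b'|c a b|c a b|a a' b b'|] /=.
  - by rewrite (amorphD Hf) mulrDl.
  - by rewrite (amorphD Hg) mulrDr.
  - by rewrite (amorphZ Hf) /ascale mulrA.
  - by rewrite (amorphZ Hg) /ascale mulrA -inalg_central mulrA.
  - by rewrite (amorphM Hf) (amorphM Hg) !mulrA -[f a * g b * f a']mulrA -fg mulrA.
  by rewrite (amorph1 Hf) (amorph1 Hg) mulr1.
exists h; split=> // a b.
by rewrite /tens hE kE.
Qed.

Lemma tensor_morphism_ext (S : pzAlgType K) (h h' : T -> S) :
    algebra_morphism h -> algebra_morphism h' ->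
    (forall a, h (tens a 1) = h' (tens a 1)) ->
    (forall b, h (tens 1 b) = h' (tens 1 b)) -> h =1 h'.
Proof.
move=> Hh Hh' El Er; apply: quot_morphism_ext.
have Hp := algproj_morphism (tensor_rel (@free_gen K (A * B)%type)).
apply: (free_morphism_ext (amorph_comp Hp Hh) (amorph_comp Hp Hh')) => -[a b] /=.
by rewrite -/(tens a b) tensE (amorphM Hh) (amorphM Hh') El Er.
Qed.
End TensorMaps.

(** * Naturality of the relations *)

Section LserMaps.
Variables (K : fieldType) (A B : pzAlgType K) (f : A -> B).
Hypothesis Hf : algebra_morphism f.

Definition lmap (F : lser A) : lser B := LSer (lval F) (fun n => f (lcf F n)).

Lemma amorph_coef F k : f (coef F k) = coef (lmap F) k.
Proof. by rewrite /coef /=; case: ifP => // _; exact: amorph0. Qed.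

Lemma amorph_conv (h h' : nat -> A) n : f (\sum_(i < n.+1) h i * h' (n - i)%N) =
  \sum_(i < n.+1) f (h i) * f (h' (n - i)%N).
Proof. by rewrite (amorph_sum Hf); apply: eq_bigr => i _; exact: amorphM. Qed.

Lemma lmap_lmul F G : lmap (lmul F G) = lmul (lmap F) (lmap G).
Proof. by congr LSer; apply/funext => n; exact: amorph_conv. Qed.

Lemma lmap_linv F : lmap (linv F) = linv (lmap F).
Proof.
congr LSer; apply/funext => n.
have E m : [seq f x | x <- linv_seq (lcf F) m] = linv_seq (fun n => f (lcf F n)) m.
  elim: m => [|m IH] /=; first by rewrite (amorph1 Hf).
  rewrite map_rcons IH (amorphN Hf) (amorph_sum Hf); congr (rcons _ (- _)).
  apply: eq_bigr => i _; rewrite (amorphM Hf) -IH (nth_map 0) //.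
  by rewrite size_linv_seq.
by rewrite -E (nth_map 0) // size_linv_seq.
Qed.

Lemma lmap_ltranslate s F : lmap (ltranslate s F) = ltranslate s (lmap F).
Proof.
congr LSer; apply/funext => n; rewrite (amorph_sum Hf); apply: eq_bigr => i _.
exact: amorphZ.
Qed.

Lemma lmap_ltail m F : lmap (ltail m F) = ltail m (lmap F).
Proof. by congr LSer; apply/funext => n; exact: amorph_coef. Qed.

Lemma lmap_lone : lmap (lone A) = lone B.
Proof. by congr LSer; apply/funext => -[|n] /=; rewrite ?(amorph1 Hf) ?(amorph0 Hf). Qed.

Lemma amorph_bracket x y : f (bracket x y) = bracket (f x) (f y).
Proof. by rewrite /bracket (amorphB Hf) !(amorphM Hf). Qed.
Lemma amorph_inz F k l : f (inz F k l) = inz (lmap F) k l.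
Proof. by rewrite /inz; case: ifP; rewrite ?amorph_coef ?(amorph0 Hf). Qed.
Lemma amorph_inw F k l : f (inw F k l) = inw (lmap F) k l.
Proof. by rewrite /inw; case: ifP; rewrite ?amorph_coef ?(amorph0 Hf). Qed.
Lemma amorph_prod_zw F G k l : f (prod_zw F G k l) = prod_zw (lmap F) (lmap G) k l.
Proof. by rewrite /prod_zw (amorphM Hf) !amorph_coef. Qed.
Lemma amorph_prod_wz F G k l : f (prod_wz F G k l) = prod_wz (lmap F) (lmap G) k l.
Proof. by rewrite /prod_wz (amorphM Hf) !amorph_coef. Qed.
Lemma amorph_br2 F G k l : f (br2 F G k l) = br2 (lmap F) (lmap G) k l.
Proof. by rewrite /br2 amorph_bracket !amorph_coef. Qed.
Lemma amorph_mulz_br2 F G k l : f (mulz (br2 F G) k l) = mulz (br2 (lmap F) (lmap G)) k l.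
Proof. exact: amorph_br2. Qed.
Lemma amorph_mulw_br2 F G k l : f (mulw (br2 F G) k l) = mulw (br2 (lmap F) (lmap G)) k l.
Proof. exact: amorph_br2. Qed.
Lemma amorph_mulzw_br2 F G k l : f (mulzw (br2 F G) k l) = mulzw (br2 (lmap F) (lmap G)) k l.
Proof. by rewrite /mulzw (amorphB Hf) amorph_mulz_br2 amorph_mulw_br2. Qed.

Lemma amorph_serre m (x : 'I_m -> A) y : f (serre x y) = serre (fun t => f (x t)) (f y).
Proof.
rewrite /serre (amorph_sum Hf); apply: eq_bigr => s _.
by elim: (enum 'I_m) => //= t l IH; rewrite amorph_bracket IH.
Qed.
End LserMaps.

Section XMaps.
Variables (K : fieldType) (r : nat) (mu : 'rV[int]_r.+1).
Variables (A B : pzAlgType K) (f : A -> B) (g : xgen r -> A).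
Hypothesis Hf : algebra_morphism f.

Lemma lmap_Xd j : lmap f (Xd mu g j) = Xd mu (f \o g) j.
Proof. by congr LSer; apply/funext => -[|n] //=; exact: amorph1. Qed.
Lemma lmap_Xk i : lmap f (Xk mu g i) = Xk mu (f \o g) i.
Proof.
by rewrite /Xk; case: ifP => _; rewrite (lmap_lmul Hf) (lmap_linv Hf) !lmap_Xd.
Qed.
Lemma lmap_Xc : lmap f (Xc mu g) = Xc mu (f \o g).
Proof.
rewrite /Xc !(lmap_lmul Hf) !lmap_Xd; congr (lmul (lmul _ _) _).
rewrite (big_morph (lmap f) (lmap_lmul Hf) (lmap_lone Hf)); apply: eq_bigr => i _.
by rewrite (lmap_lmul Hf) (lmap_linv Hf) !(lmap_ltranslate Hf) !lmap_Xd.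
Qed.

Ltac am := rewrite ?(amorphB Hf) ?(amorphN Hf) ?(amorphD Hf) ?(amorphB Hf) ?(amorphN Hf) ?(amorphMn Hf)
  ?(amorphMz Hf) ?(amorphB Hf) ?(amorphD Hf) ?(amorphN Hf) ?(amorphB Hf) ?(amorphD Hf)
  ?(amorph_mulzw_br2 Hf) ?(amorph_mulz_br2 Hf) ?(amorph_mulw_br2 Hf)
  ?(amorph_br2 Hf) ?(amorph_inz Hf) ?(amorph_inw Hf) ?(amorph_prod_zw Hf) ?(amorph_prod_wz Hf)
  ?(amorph_serre Hf) ?(lmap_ltail Hf) ?(lmap_lmul Hf) ?lmap_Xd ?lmap_Xk ?(amorph0 Hf)
  ?(amorph_coef Hf).

(** Every operation that occurs in the relations commutes with algebra
    morphisms. *)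
Lemma Xrel_lift x y : Xrel mu (f \o g) x y ->
  exists x' y', [/\ Xrel mu g x' y', f x' = x & f y' = y].
Proof.
case=> [i j k l|i j k l|i j k l|i j k l|i k l|i k l|i j k l ij|i j k l ij
  |i j k l ij|i j k l ij]; eexists; eexists.
- by split; [exact: (Xrel_DD mu g i j k l) | am | am].
- by split; [exact: (Xrel_EF mu g i j k l) | am | am].
- by split; [exact: (Xrel_DE mu g i j k l) | am | am].
- by split; [exact: (Xrel_DF mu g i j k l) | am | am].
- by split; [exact: (Xrel_EE mu g i k l) | am | am].
- by split; [exact: (Xrel_FF mu g i k l) | am | am].
- by split; [exact: (Xrel_EEij mu g k l ij) | am | am].
- by split; [exact: (Xrel_FFij mu g k l ij) | am | am].
- split; [exact: (Xrel_serreE mu g k l ij) | am | am] => //.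
  by congr (serre _ _); apply/funext => t; rewrite (amorph_coef Hf).
split; [exact: (Xrel_serreF mu g k l ij) | am | am] => //.
by congr (serre _ _); apply/funext => t; rewrite (amorph_coef Hf).
Qed.

Lemma Xrel_map x y : Xrel mu g x y -> Xrel mu (f \o g) (f x) (f y).
Proof.
case=> [i j k l|i j k l|i j k l|i j k l|i k l|i k l|i j k l ij|i j k l ij
  |i j k l ij|i j k l ij].
- by have := Xrel_DD mu (f \o g) i j k l; am.
- by have := Xrel_EF mu (f \o g) i j k l; am.
- by have := Xrel_DE mu (f \o g) i j k l; am.
- by have := Xrel_DF mu (f \o g) i j k l; am.
- by have := Xrel_EE mu (f \o g) i k l; am.
- by have := Xrel_FF mu (f \o g) i k l; am.
- by have := Xrel_EEij mu (f \o g) k l ij; am.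
- by have := Xrel_FFij mu (f \o g) k l ij; am.
- have := Xrel_serreE mu (f \o g) k l ij; am.
  rewrite (_ : (fun t => f _) = fun t => coef (Xe (f \o g) i) (k t)) //.
  by apply/funext => t; rewrite (amorph_coef Hf).
have := Xrel_serreF mu (f \o g) k l ij; am.
rewrite (_ : (fun t => f _) = fun t => coef (Xf (f \o g) i) (k t)) //.
by apply/funext => t; rewrite (amorph_coef Hf).
Qed.
End XMaps.

Section YMaps.
Variables (K : fieldType) (r : nat) (b : coweight r).
Variables (A B : pzAlgType K) (f : A -> B) (g : ygen r -> A).
Hypothesis Hf : algebra_morphism f.

Lemma lmap_Yh j : lmap f (Yh b g j) = Yh b (f \o g) j.
Proof. by congr LSer; apply/funext => -[|n] //=; exact: amorph1. Qed.

Ltac am := rewrite ?(amorphZ Hf) ?(amorphB Hf) ?(amorphD Hf) ?(amorphM Hf) ?(amorphMn Hf)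
  ?(amorph_bracket Hf) ?(amorph_serre Hf) ?(amorph0 Hf) ?(amorph_coef Hf) ?lmap_Yh.

Lemma Yrel_lift x y : Yrel b (f \o g) x y ->
  exists x' y', [/\ Yrel b g x' y', f x' = x & f y' = y].
Proof.
case=> [i j k l|i j k l k1 l1|i j k l l1|i j k l l1|i j k l k1 l1|i j k l k1 l1
  |i j k l ij k1 l1|i j k l ij k1 l1]; eexists; eexists.
- by split; [exact: (Yrel_HH b g i j k l) | am | am].
- by split; [exact: (Yrel_EF b g i j k1 l1) | am | am].
- by split; [exact: (Yrel_HE b g i j k l1) | am | am].
- by split; [exact: (Yrel_HF b g i j k l1) | am | am].
- by split; [exact: (Yrel_EE b g i j k1 l1) | am | am].
- by split; [exact: (Yrel_FF b g i j k1 l1) | am | am].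
- split; [exact: (Yrel_serreE b g ij k1 l1) | am | am] => //.
  by congr (serre _ _); apply/funext => t; rewrite (amorph_coef Hf).
split; [exact: (Yrel_serreF b g ij k1 l1) | am | am] => //.
by congr (serre _ _); apply/funext => t; rewrite (amorph_coef Hf).
Qed.

Lemma Yrel_map x y : Yrel b g x y -> Yrel b (f \o g) (f x) (f y).
Proof.
case=> [i j k l|i j k l k1 l1|i j k l l1|i j k l l1|i j k l k1 l1|i j k l k1 l1
  |i j k l ij k1 l1|i j k l ij k1 l1].
- by have := Yrel_HH b (f \o g) i j k l; am.
- by have := Yrel_EF b (f \o g) i j k1 l1; am.
- by have := Yrel_HE b (f \o g) i j k l1; am.
- by have := Yrel_HF b (f \o g) i j k l1; am.
- by have := Yrel_EE b (f \o g) i j k1 l1; am.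
- by have := Yrel_FF b (f \o g) i j k1 l1; am.
- have := Yrel_serreE b (f \o g) ij k1 l1; am.
  rewrite (_ : (fun t => f _) = fun t => coef (Ye (f \o g) i) (k t)) //.
  by apply/funext => t; rewrite (amorph_coef Hf).
have := Yrel_serreF b (f \o g) ij k1 l1; am.
rewrite (_ : (fun t => f _) = fun t => coef (Yf (f \o g) i) (k t)) //.
by apply/funext => t; rewrite (amorph_coef Hf).
Qed.
End YMaps.

(** * The decomposition *)

Section XUniv.
Variables (K : fieldType) (r : nat) (mu : 'rV[int]_r.+1).
Local Notation X := (Xalg K mu).

Lemma Xsat_gen : Xsat mu (Xgen K mu : _ -> X).
Proof.
move=> x y; have Hp := algproj_morphism (Xrel mu (@free_gen K (xgen r))).
by move=> /(Xrel_lift Hp) [x' [y' [xy <- <-]]]; exact: algproj_rel.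
Qed.

Lemma X_universal (B : pzAlgType K) (g : xgen r -> B) : Xsat mu g ->
  exists f : X -> B, algebra_morphism f /\ forall x, f (Xgen K mu x) = g x.
Proof.
move=> Hg; have [k [Hk kE]] := free_universal g.
have kg : k \o @free_gen K (xgen r) = g by apply/funext.
have [x y xy|f [Hf fE]] := quot_universal (rel := Xrel mu (@free_gen K (xgen r))) Hk.
  by apply: Hg; rewrite -kg; exact: Xrel_map.
by exists f; split=> // x; rewrite fE kE.
Qed.

Lemma X_morphism_ext (B : pzAlgType K) (f f' : X -> B) :
    algebra_morphism f -> algebra_morphism f' ->
  (forall x, f (Xgen K mu x) = f' (Xgen K mu x)) -> f =1 f'.
Proof.
move=> Hf Hf' E; apply: quot_morphism_ext.
have Hp := algproj_morphism (Xrel mu (@free_gen K (xgen r))).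
exact: (free_morphism_ext (amorph_comp Hp Hf) (amorph_comp Hp Hf')).
Qed.

Lemma X_comm (c : X) : (forall x, c * Xgen K mu x = Xgen K mu x * c) ->
  forall x, c * x = x * c.
Proof.
move=> H x; have Hp := algproj_morphism (Xrel mu (@free_gen K (xgen r))).
have [y <-] := algproj_surj x.
exact: (free_comm Hp).
Qed.
End XUniv.

Section YUniv.
Variables (K : fieldType) (r : nat) (b : coweight r).
Local Notation Y := (Yalg K b).

Lemma Ysat_map (A B : pzAlgType K) (f : A -> B) (g : ygen r -> A) :
  algebra_morphism f -> Ysat b g -> Ysat b (f \o g).
Proof.
by move=> Hf Hg x y /(Yrel_lift Hf) [x' [y' [/Hg -> <- <-]]].
Qed.

Lemma Ysat_gen : Ysat b (Ygen K b : _ -> Y).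
Proof.
move=> x y; have Hp := algproj_morphism (Yrel b (@free_gen K (ygen r))).
by move=> /(Yrel_lift Hp) [x' [y' [xy <- <-]]]; exact: algproj_rel.
Qed.

Lemma Y_universal (B : pzAlgType K) (g : ygen r -> B) : Ysat b g ->
  exists f : Y -> B, algebra_morphism f /\ forall x, f (Ygen K b x) = g x.
Proof.
move=> Hg; have [k [Hk kE]] := free_universal g.
have kg : k \o @free_gen K (ygen r) = g by apply/funext.
have [x y xy|f [Hf fE]] := quot_universal (rel := Yrel b (@free_gen K (ygen r))) Hk.
  by apply: Hg; rewrite -kg; exact: Yrel_map.
by exists f; split=> // x; rewrite fE kE.
Qed.

Lemma Y_morphism_ext (B : pzAlgType K) (f f' : Y -> B) :
    algebra_morphism f -> algebra_morphism f' ->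
  (forall x, f (Ygen K b x) = f' (Ygen K b x)) -> f =1 f'.
Proof.
move=> Hf Hf' E; apply: quot_morphism_ext.
have Hp := algproj_morphism (Yrel b (@free_gen K (ygen r))).
exact: (free_morphism_ext (amorph_comp Hp Hf) (amorph_comp Hp Hf')).
Qed.
End YUniv.

Section Naturality.
Variables (K : fieldType) (char0 : forall n, n.+1%:R != 0 :> K).
Variables (r : nat) (hr : (3 <= r)%N) (mu : 'rV[int]_r.+1).
Variables (A B : pzAlgType K) (f : A -> B).
Hypothesis Hf : algebra_morphism f.

Lemma amorph_tr s v (h : series A) n : f (translate s v h n) = translate s v (fun n => f (h n)) n.
Proof. by rewrite /translate (amorph_sum Hf); apply: eq_bigr => i _; exact: amorphZ. Qed.

Lemma amorph_Kseries (g : xgen r -> A) i n :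
  f (Kseries (xd mu g) i n) = Kseries (xd mu (f \o g)) i n.
Proof. by rewrite -!lcf_Xk -(lmap_Xk mu g Hf). Qed.

Lemma amorph_Cseries (g : xgen r -> A) n :
  f (Cseries (dmu mu) (xd mu g) n) = Cseries (dmu mu) (xd mu (f \o g)) n.
Proof.
have := lmap_Xc mu g Hf; rewrite !Xc_LSer => -[E].
by have := congr1 (fun h => h n) E.
Qed.

Lemma amorph_Ygens_in_X (g : xgen r -> A) x : f (Ygens_in_X mu g x) = Ygens_in_X mu (f \o g) x.
Proof.
case: x => [i n|i n|i n] /=; rewrite amorph_tr //.
by congr (translate _ _ _ _); apply/funext => m; exact: amorph_Kseries.
Qed.
End Naturality.

Section Main.
Variables (K : fieldType) (char0 : forall n, n.+1%:R != 0 :> K).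
Variables (r : nat) (hr : (3 <= r)%N) (mu : 'rV[int]_r.+1).
Local Notation X := (Xalg K mu).
Local Notation Y := (Yalg K (mubar mu)).
Local Notation P := (Cpoly K mu).
Local Notation T := (tensor Y P).
Local Notation s i := (node_shift K i).
Local Notation v := (dmu mu (inord (r - 1)) + dmu mu (inord r)).

Fact Cindex_proof n : v < v + n.+1%:Z.
Proof. by rewrite ltrDl. Qed.
Definition Cidx n : Cindex mu := exist _ (v + n.+1%:Z) (Cindex_proof n).
(** An index above v is v + 1 + n for a unique n, which turns the variables
    C^(k) into a sequence. *)
Lemma CidxP (k : Cindex mu) : exists n, k = Cidx n.
Proof.
have kv := valP k; exists `|val k - v|%N.-1; apply: val_inj; rewrite /=.
by move: kv; rewrite /=; lia.
Qed.

Theorem decomposition :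
  exists iota : Y -> X,
    [/\ algebra_morphism iota,
        forall (i : 'I_r) (k : int),
          [/\ iota (coef (YE_ K (mubar mu) i) k) =
                coef (ltranslate (s i) (XE_ K mu i)) k,
              iota (coef (YF_ K (mubar mu) i) k) =
                coef (ltranslate (s i) (XF_ K mu i)) k &
              iota (coef (YH_ K (mubar mu) i) k) =
                coef (ltranslate (s i) (XK_ K mu i)) k],
        injective iota &
        exists phi : T -> X,
          [/\ algebra_morphism phi,
              bijective phi,
              forall y, phi (tens y 1) = iota y &
              forall k : Cindex mu,
                phi (tens 1 (Cvar K k)) = coef (XC_ K mu) (val k)]].
Proof.
have XN : Xnormal mu (Xgen K mu : _ -> X).
  by apply/(Xsat_normal char0 hr); exact: Xsat_gen.
have YN : Ynormal (mubar mu) (Ygens_in_X mu (Xgen K mu)) by exact: Y_of_X.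
have [iota [Hi iE]] := Y_universal (proj2 (Ysat_normal hr _ _) YN).
have XCE : XC_ K mu = LSer v (Cseries (dmu mu) (xd mu (Xgen K mu))) by exact: Xc_LSer.
have Cgen (k : Cindex mu) (x : X) :
    coef (XC_ K mu) (val k) * x = x * coef (XC_ K mu) (val k).
  have [n ->] := CidxP k; rewrite XCE coef_nat; apply: X_comm => y.
  exact: Cseries_central.
have [gam [Hgam gamE gamC]] : exists gam : P -> X,
    [/\ algebra_morphism gam,
        forall k, gam (Cvar K k) = coef (XC_ K mu) (val k) &
        forall p y, gam p * y = y * gam p].
  exact: cmonom_universal Cgen.
have ig a b : iota a * gam b = gam b * iota a by rewrite gamC.
have [phi [Hphi phi_tens]] := tensor_universal Hi Hgam ig.
have Hl : algebra_morphism (fun y : Y => tens y 1 : T) := tensl_morphism Y P.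
have Hr : algebra_morphism (fun p : P => tens 1 p : T) := tensr_morphism Y P.
pose gT := (fun y : Y => tens y 1 : T) \o Ygen K (mubar mu).
have YNT : Ynormal (mubar mu) gT.
  by apply/(Ysat_normal hr); apply: Ysat_map => //; exact: Ysat_gen.
(* The central series of the tensor product. *)
pose C : series T := fun n => if n is m.+1 then tens 1 (Cvar K (Cidx m)) else 1.
have Cc n x : C n * gT x = gT x * C n.
  by case: n => [|n]; [exact: etrans (mul1r _) (esym (mulr1 _)) | exact: tens_comm].
have PC (p q : P) : p * q = q * p by exact: (@mulrC (malg (cmonom (Cindex mu)) K)).
have CC m n : C m * C n = C n * C m.
  case: m => [|m]; first exact: etrans (mul1r _) (esym (mulr1 _)).
  case: n => [|n]; first exact: etrans (mulr1 _) (esym (mul1r _)).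
  rewrite [LHS](tensMM (1 : Y) 1 (Cvar K (Cidx m)) (Cvar K (Cidx n))).
  rewrite [RHS](tensMM (1 : Y) 1 (Cvar K (Cidx n)) (Cvar K (Cidx m))).
  exact: (congr1 (tens (1 * 1 : Y)) (PC _ _)).
have [gX [XNT gXe gXf gXk gXc]] := X_of_Y char0 hr YNT (erefl : unipotent C) Cc CC.
have [psi [Hpsi psiE]] := X_universal (proj2 (Xsat_normal char0 hr _ _) XNT).
have psig : psi \o Xgen K mu = gX by apply/funext.
have psiC n : psi (Cseries (dmu mu) (xd mu (Xgen K mu)) n) = C n.
  by rewrite (amorph_Cseries mu Hpsi) psig gXc.
have psi_Ygens_in_X x : psi (Ygens_in_X mu (Xgen K mu) x) = gT x.
  rewrite (amorph_Ygens_in_X mu Hpsi) psig; case: x => [i n|i n|i n] /=.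
  - by rewrite gXe translate_comp // subrr translate0.
  - by rewrite gXf translate_comp // subrr translate0.
  by rewrite gXk translate_comp // subrr translate0.
have phi_l y : phi (tens y 1) = iota y by rewrite phi_tens (amorph1 Hgam) mulr1.
have phi_r p : phi (tens 1 p) = gam p by rewrite phi_tens (amorph1 Hi) mul1r.
have psiphi : cancel phi psi.
  apply: (tensor_morphism_ext (amorph_comp Hphi Hpsi) (amorph_id T)) => [a|p] /=.
    rewrite phi_l; move: a.
    apply: (Y_morphism_ext (amorph_comp Hi Hpsi) Hl) => x /=.
    by rewrite iE psi_Ygens_in_X.
  rewrite phi_r; move: p; apply: (cmonom_morphism_ext (amorph_comp Hgam Hpsi) Hr) => k /=.
  by rewrite gamE; have [n ->] := CidxP k; rewrite XCE coef_nat psiC.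
have phi_gT x : phi (gT x) = Ygens_in_X mu (Xgen K mu) x by rewrite /gT /= phi_l iE.
have phi_C : (fun n => phi (C n)) = Cseries (dmu mu) (xd mu (Xgen K mu)).
  apply/funext => -[|n]; first by rewrite (amorph1 Hphi); apply/esym/unipotent_Cseries.
  by rewrite /C phi_r gamE XCE coef_nat.
have phipsi : cancel psi phi.
  apply: (X_morphism_ext (amorph_comp Hpsi Hphi) (amorph_id X)) => x /=.
  rewrite psiE.
  (* phi sends the D_j of the tensor product to a solution of the equations
     for K and C in X, and so do the D_j of X. *)
  have Dphi j : xd mu (phi \o gX) j = xd mu (Xgen K mu) j.
    move: j; apply: (D_unique char0 hr (d := dmu mu)) => // [i|].
      apply/funext => n; rewrite -(amorph_Kseries mu Hphi) gXk amorph_tr //.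
      rewrite (_ : (fun n0 => phi _) = yh (mubar mu) (Ygens_in_X mu (Xgen K mu)) i); last first.
        by apply/funext => -[|m] /=; rewrite ?(amorph1 Hphi) // phi_gT.
      by rewrite yh_Ygens_in_X // translate_comp // addNr translate0.
    by apply/funext => n; rewrite -(amorph_Cseries mu Hphi) gXc -phi_C.
  case: x => [i n|i n|j n].
  - rewrite -[gX _]/(xe gX i n) gXe amorph_tr //.
    rewrite (_ : (fun n0 => phi _) = translate (s i) 1 (xe (Xgen K mu) i)); last first.
      by apply/funext => m; rewrite phi_gT.
    by rewrite translate_comp // addNr translate0.
  - rewrite -[gX _]/(xf gX i n) gXf amorph_tr //.
    rewrite (_ : (fun n0 => phi _) = translate (s i) 1 (xf (Xgen K mu) i)); last first.
      by apply/funext => m; rewrite phi_gT.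
    by rewrite translate_comp // addNr translate0.
  by have := congr1 (fun h => h n.+1) (Dphi j).
(* A retraction of y |-> y (x) 1. *)
have [eps [Heps epsC]] : exists eps : P -> Y,
    algebra_morphism eps /\ forall p y, eps p * y = y * eps p.
  have [|eps [Heps _ epsC]] := @cmonom_universal K (Cindex mu) Y (fun=> 0).
    by move=> _ y; rewrite mul0r mulr0.
  by exists eps.
have [rho [Hrho rhoE]] := tensor_universal (amorph_id Y) Heps (fun a p => esym (epsC p a)).
exists iota; split; first exact: Hi.
- move=> i k; rewrite !(amorph_coef Hi); split; congr (coef _ k).
  + by congr LSer; apply/funext => n; rewrite /= iE.
  + by congr LSer; apply/funext => n; rewrite /= iE.
  rewrite (lmap_Yh (mubar mu) (Ygen K (mubar mu)) Hi).
  have -> : iota \o Ygen K (mubar mu) = Ygens_in_X mu (Xgen K mu) by apply/funext => x /=.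
  exact: Yh_Ygens_in_X.
- move=> y y'; rewrite -!phi_l => /(can_inj psiphi)/(congr1 rho).
  by rewrite !rhoE (amorph1 Heps) !mulr1.
exists phi; split; [exact: Hphi | by exists psi | exact: phi_l |].
move=> k; exact: etrans (phi_r _) (gamE k).
Qed.
End Main.

Theorem proposition2p114 (R : realType) (r : nat) (hr : (3 <= r)%N)
    (mu : 'rV[int]_r.+1) :
  exists iota : Yalg R[i] (mubar mu) -> Xalg R[i] mu,
    [/\ algebra_morphism iota,
        forall (i : 'I_r) (k : int),
          [/\ iota (coef (YE_ R[i] (mubar mu) i) k) =
                coef (ltranslate (node_shift R[i] i) (XE_ R[i] mu i)) k,
              iota (coef (YF_ R[i] (mubar mu) i) k) =
                coef (ltranslate (node_shift R[i] i) (XF_ R[i] mu i)) k &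
              iota (coef (YH_ R[i] (mubar mu) i) k) =
                coef (ltranslate (node_shift R[i] i) (XK_ R[i] mu i)) k],
        injective iota &
        exists phi : tensor (Yalg R[i] (mubar mu)) (Cpoly R[i] mu) ->
                       Xalg R[i] mu,
          [/\ algebra_morphism phi,
              bijective phi,
              forall y, phi (tens y 1) = iota y &
              forall k : Cindex mu,
                phi (tens 1 (Cvar R[i] k)) = coef (XC_ R[i] mu) (val k)]].
Proof. by apply: decomposition => // n; rewrite pnatr_eq0. Qed.
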